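(* Let $0<s\le1$, $\nu>0$, $\sigma\in(\frac1s,2)$, and assume that we are given mean-zero initial data $u_0$ on $\mathbb{T}^2$ satisfying $$\|u_0\|_{\mathcal G^\sigma_{\alpha+\epsilon}}=\big\|e^{(\alpha+\epsilon)A^{1/2}}u_0\big\|_{\dot H^{\sigma s}}\le\frac{\nu^2}{2}-\beta$$ for some $\alpha>0$, $\epsilon>0$ and $0<\beta<\frac{\nu^2}{2}$. Define $\phi(t):=\alpha+\beta t$. Then with probability at least $1-e^{-2\frac{\alpha\beta}{\nu^2}}$ there exists a pathwise unique global solution $u\in C^0([0,\infty),\mathcal G^\sigma_\phi)$ to $$\begin{cases}\partial_tu+\Gamma\big(R^\perp\Gamma^{-1}u\cdot\nabla\Gamma^{-1}u\big)=-\frac12\nu^2|\nabla|^{2s}u,\\ u(0)=u_0.\end{cases}$$ Moreover, the mapping $$t\mapsto\|u(t)\|_{\mathcal G^\sigma_\phi}=\big\|e^{\phi(t)A^{1/2}}u(t)\big\|_{\dot H^{\sigma s}}$$ is pathwise monotonically decreasing.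
   Context: Torus and Fourier conventions: $\mathbb{T}^2=(\mathbb{R}/2\pi\mathbb{Z})^2$, $\hat f(k)$, $k\in\mathbb{Z}^2$, are the Fourier coefficients ($f=\sum_k\hat f(k)e^{ik\cdot x}$). Functions are real-valued with mean zero ($\hat f(0)=0$). $|\nabla|^a$ is the Fourier multiplier $|k|^a$; $A=|\nabla|^{2s}$, so $e^{cA^{1/2}}$ is the multiplier $e^{c|k|^s}$; $\|f\|_{\dot H^a}^2=\sum_{k\neq0}|k|^{2a}|\hat f(k)|^2$. $R^\perp=(-R_2,R_1)$ with $R_j$ the Riesz transforms (multiplier $-ik_j/|k|$). $W_t$, $t\ge0$, is a standard one-dimensional Wiener process (continuous paths, $W_0=0$) on a probability space, and $\Gamma(t)=e^{-\nu W_t|\nabla|^s}$ is the Fourier multiplier $e^{-\nu W_t|k|^s}$. For each fixed path the equation is deterministic; a solution is understood in the mild (Duhamel) sense $u(t)=e^{-\frac t2\nu^2A}u_0-\int_0^te^{-\frac{t-\tau}{2}\nu^2A}\,\Gamma(R^\perp\Gamma^{-1}u\cdot\nabla\Gamma^{-1}u)(\tau)\,d\tau$. Gevrey spaces: $\|w\|_{\mathcal G^\gamma_{c}}=\|e^{cA^{1/2}}w\|_{\dot H^{\gamma s}}$ for a real number $c$; for a continuous real function $\varphi$, $\|w(t)\|_{\mathcal G^\gamma_{\varphi}}=\|e^{\varphi(t)A^{1/2}}w(t)\|_{\dot H^{\gamma s}}$, and for an interval $J$, $C^0(J,\mathcal G^\gamma_\varphi)$ is the space of $w$ such that $t\mapsto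 e^{\varphi(t)A^{1/2}}w(t)$ is continuous from $J$ to $\dot H^{\gamma s}$ with $\sup_{t\in J}\|w(t)\|_{\mathcal G^\gamma_\varphi}<\infty$. ''Pathwise unique'' means that for each fixed path $t\mapsto W_t(\omega)$ (in the event in question) there is a unique solution; ''with probability at least $p$'' means that the assertion holds for all paths in an event of probability at least $p$. *)

(* Defs.v *)
From HB Require Import structures.
From mathcomp Require Import all_boot all_order all_algebra.
From mathcomp Require Import complex.
From mathcomp Require Import all_classical all_reals all_analysis.

Set Implicit Arguments.
Unset Strict Implicit.
Unset Printing Implicit Defensive.

Import Order.TTheory GRing.Theory Num.Theory.
Import numFieldNormedType.Exports.

Local Open Scope classical_set_scope.
Local Open Scope ring_scope.
Local Open Scope complex_scope.

(* A (generalized) function f on the torus (R / 2 pi Z)^2 is represented by the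
   family of its Fourier coefficients, f = \sum_k (f k) e^{i k.x}.  Since
   Gamma, Gamma^-1 and e^{c A^{1/2}} with c of either sign are unbounded, they
   act on formal Fourier series, not on functions. *)
Definition freq : Type := (int * int)%type.
Definition coefs (R : realType) : Type := freq -> R[i].

(* The Euclidean length |k|. *)
Definition kabs (R : realType) (k : freq) : R :=
  Num.sqrt (k.1%:~R ^+ 2 + k.2%:~R ^+ 2).

Definition real_mean_zero (R : realType) (f : coefs R) : Prop :=
  (forall k : freq, f (- k) = (f k)^*) /\ f 0 = 0.

Definition fmult (R : realType) (m : freq -> R[i]) (f : coefs R) : coefs R :=
  fun k => m k * f k.

(* e^{c A^{1/2}}, where A^{1/2} = |nabla|^s. *)
Definition expA (R : realType) (s c : R) : coefs R -> coefs R :=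
  fmult (fun k => (expR (c * kabs R k `^ s))%:C).

(* At k = 0 the Riesz symbols are 0, as 0 / 0 = 0. *)
Definition riesz1 (R : realType) : coefs R -> coefs R :=
  fmult (fun k => - (0 +i* 1) * (k.1%:~R / kabs R k)%:C).
Definition riesz2 (R : realType) : coefs R -> coefs R :=
  fmult (fun k => - (0 +i* 1) * (k.2%:~R / kabs R k)%:C).
Definition partial1 (R : realType) : coefs R -> coefs R :=
  fmult (fun k => (0 +i* 1) * (k.1%:~R)%:C).
Definition partial2 (R : realType) : coefs R -> coefs R :=
  fmult (fun k => (0 +i* 1) * (k.2%:~R)%:C).

(* Sum of an absolutely summable family (no meaning is attached to it
   otherwise). *)
Definition rsum (R : realType) (I : choiceType) (f : I -> R) : R :=
  fine (\esum_(i in [set: I]) ((EFin \o f)^\+ i)%E)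
  - fine (\esum_(i in [set: I]) ((EFin \o f)^\- i)%E).
Definition csum (R : realType) (I : choiceType) (f : I -> R[i]) : R[i] :=
  rsum (fun i => complex.Re (f i)) +i* rsum (fun i => complex.Im (f i)).
Definition csummable (R : realType) (I : choiceType) (f : I -> R[i]) : Prop :=
  summable [set: I] (fun i => (ComplexField.Normc.normc (f i))%:E).

(* The product of two functions on the torus: its k-th Fourier coefficient is
   \sum_j f_j g_(k-j).  It is well defined when all these sums converge
   absolutely, as they do for f and g in L^2. *)
Definition fsprod_defined (R : realType) (f g : coefs R) : Prop :=
  forall k : freq, csummable (fun j : freq => f j * g (k - j)).
Definition fsprod (R : realType) (f g : coefs R) : coefs R :=
  fun k => csum (fun j : freq => f j * g (k - j)).

(* R^\perp f . nabla g, where R^\perp = (- R_2, R_1). *)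
Definition transport_defined (R : realType) (f g : coefs R) : Prop :=
  fsprod_defined (\- riesz2 f) (partial1 g) /\
  fsprod_defined (riesz1 f) (partial2 g).
Definition transport (R : realType) (f g : coefs R) : coefs R :=
  fsprod (\- riesz2 f) (partial1 g) \+ fsprod (riesz1 f) (partial2 g).

(* Gamma and Gamma^-1 at a time where the Wiener path has the value b. *)
Definition Gam (R : realType) (s nu b : R) : coefs R -> coefs R :=
  expA s (- nu * b).
Definition Gaminv (R : realType) (s nu b : R) : coefs R -> coefs R :=
  expA s (nu * b).

(* The homogeneous Sobolev and Gevrey norms, possibly infinite. *)
Definition sobolev_norm (R : realType) (a : R) (f : coefs R) : \bar R :=
  ((\esum_(k in [set k : freq | k != 0%R])
      (kabs R k `^ (2 * a) * ComplexField.Normc.normc (f k) ^+ 2)%:E) `^ (2^-1)%R)%E.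
Definition gevrey_norm (R : realType) (s gam c : R) (f : coefs R) : \bar R :=
  sobolev_norm (gam * s) (expA s c f).

(* w \in C^0(J, G^gam_phi); functions are real-valued with mean zero. *)
Definition C0_gevrey (R : realType) (s gam : R) (J : set R) (phi : R -> R)
    (w : R -> coefs R) : Prop :=
  [/\ forall t : R, J t -> real_mean_zero (w t),
      forall t : R, J t ->
        sobolev_norm (gam * s)
          (expA s (phi t') (w t') \- expA s (phi t) (w t))
          @[t' --> within J (nbhs t)] --> 0%E &
      (ereal_sup [set gevrey_norm s gam (phi t) (w t) | t in J] < +oo)%E].

Definition cintegrable (R : realType) (D : set R) (f : R -> R[i]) : Prop :=
  (@lebesgue_measure R).-integrable D (fun t => (complex.Re (f t))%:E) /\
  (@lebesgue_measure R).-integrable D (fun t => (complex.Im (f t))%:E).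
Definition cintegral (R : realType) (D : set R) (f : R -> R[i]) : R[i] :=
  Rintegral (@lebesgue_measure R) D (fun t => complex.Re (f t)) +i*
  Rintegral (@lebesgue_measure R) D (fun t => complex.Im (f t)).

(* e^{- (t/2) nu^2 A}, where A = |nabla|^{2s}. *)
Definition heat (R : realType) (s nu t : R) : coefs R -> coefs R :=
  fmult (fun k => (expR (- (t / 2) * nu ^+ 2 * kabs R k `^ (2 * s)))%:C).

(* Global mild solutions for a fixed path b of the Wiener process; the time
   integral is taken in each Fourier coefficient, and all the terms of the
   equation are required to make sense. *)
Definition mild_solution (R : realType) (s nu : R) (b : R -> R)
    (u0 : coefs R) (u : R -> coefs R) : Prop :=
  let v t := Gaminv s nu (b t) (u t) in
  let N t := Gam s nu (b t) (transport (v t) (v t)) in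
  (forall t : R, 0 <= t -> transport_defined (v t) (v t)) /\
  (forall t : R, 0 <= t -> forall k : freq,
     cintegrable `[0, t] (fun tau => heat s nu (t - tau) (N tau) k) /\
     u t k = heat s nu t u0 k
             - cintegral `[0, t] (fun tau => heat s nu (t - tau) (N tau) k)).

(* Standard Wiener process, indexed by R of which only the times t >= 0 are
   relevant.  [normal_prob] takes the standard deviation as parameter. *)
Record wiener (R : realType) (d : measure_display) (T : measurableType d)
    (P : probability T R) (W : R -> T -> R) : Prop := Wiener {
  wiener_measurable : forall t : R, 0 <= t -> measurable_fun [set: T] (W t) ;
  wiener_start : forall x, W 0 x = 0 ;
  wiener_continuous : forall x,
    {within `[0, +oo[, continuous (fun t => W t x)} ;
  wiener_normal : forall t1 t2 : R, 0 <= t1 -> t1 < t2 ->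
    forall B : set R, measurable B ->
    P ((W t2 \- W t1) @^-1` B) = normal_prob 0 (Num.sqrt (t2 - t1)) B ;
  wiener_independent : forall (n : nat) (t : nat -> R), 0 <= t 0%N ->
    (forall i, (i < n)%N -> t i < t i.+1) ->
    forall B : nat -> set R, (forall i, measurable (B i)) ->
    P (\bigcap_(i in `I_n) ((W (t i.+1) \- W (t i)) @^-1` B i))
    = (\prod_(i < n) P (((W (t i.+1) \- W (t i))%R @^-1` B i)))%E }.

(* Main.v *)
(* In the variables U_k = e^(phi(t) |k|^s) u_k, and with psi = phi - nu W, the equation reads
   U_k' = - (nu^2/2 |k|^(2s) - beta |k|^s) U_k - N_k(U), where the quadratic term N carries the
   weights e^(psi (|k|^s - |j|^s - |k-j|^s)), which are at most 1 on the event psi >= 0.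
   Put a = sigma s.  Symmetrising over the triads j + l + m = 0 gives the estimate
   |< |nabla|^(2a) U, N(U) >| <= |U|_a |U|_(a+s)^2 with constant 1, whereas the dissipation is
   at least (nu^2/2 - beta) |U|_(a+s)^2; hence |U|_a decreases once it is at most nu^2/2 - beta.
   The same computation with psi + eps instead of psi bounds e^(eps |k|^s) U.  Galerkin
   approximations satisfy both bounds.  They converge by a Gronwall argument in L^2, in which
   one of the two solutions compared is smooth (thanks to eps), half a derivative falls on each
   factor, and truncation errors are beaten because a > 1; this argument also proves uniqueness.
   Finally, nu W_t > alpha + beta t for some t has probability at most e^(-2 alpha beta/nu^2),
   by decomposing according to the first such time on a dyadic grid and integrating the
   martingale e^(c W_t - c^2 t/2) with c = 2 beta/nu. *)
Require Import Defs.
From HB Require Import structures.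
From mathcomp Require Import all_boot all_order all_algebra.
From mathcomp Require Import complex.
From mathcomp Require Import all_classical all_reals all_analysis.
From mathcomp Require Import measurable_realfun.
From mathcomp Require Import ring lra zify.

Set Implicit Arguments.
Unset Strict Implicit.
Unset Printing Implicit Defensive.

Import Order.TTheory GRing.Theory Num.Theory.
Import numFieldNormedType.Exports.

Local Open Scope classical_set_scope.
Local Open Scope ring_scope.

Local Notation normc := ComplexField.Normc.normc.
Local Notation Re := complex.Re.
Local Notation Im := complex.Im.
Local Notation normcM := ComplexField.Normc.normcM.
Local Notation normc0 := ComplexField.Normc.normc0.
Local Notation eq0_normc := ComplexField.Normc.eq0_normc.

(** * Elementary inequalities *)

(** The smallness threshold nu^2/2 - beta equals the dissipation coefficient, so the trilinear
    estimate may not lose any factor; the constant 1 shapes everything up to [energy_trilinear]. It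
    arises as sqrt(2 * 1/2). On a triad sorted by |j| <= |l| <= |m| the symmetrised summand is at
    most (K_jl g_l)(f_j g_m), where f_k = |k|^a |U_k|, g_k = |k|^(a+s) |U_k| and K_jl = theta *
    sqrt(2 / (|j| |l|)) depends on the triangle only; Cauchy-Schwarz separates the two brackets. For
    fixed l, the squares K_jl^2 sum to at most 2: the sum of 1/|j| over |j| <= |l| is at most 8 |l|,
    and theta^2 for j and for -j together is at most 1/4, no more than for one of them alone. For
    fixed j and m, only one of j and -j can leave the triad sorted, whence the factor 1/2. Both
    facts about -j come from the parallelogram law. The weights e^(psi(...)) are no perturbation of
    the case psi = 0, since psi is unbounded; convexity of exp reduces them to two extreme cases
    that contain no psi. *)

Lemma expR_convex0 (R : realType) (th x : R) :
  0 <= th -> th <= 1 -> expR (th * x) <= th * expR x + (1 - th).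
Proof.
move=> th0 th1.
have h1 := expR_ge1Dx (x - th * x).
have h2 := expR_ge1Dx (- (th * x)).
have e0 := expR_gt0 (th * x).
have -> : expR x = expR (th * x) * expR (x - th * x) by rewrite -expRD; congr expR; ring.
have e1 : expR (th * x) * expR (- (th * x)) = 1 by rewrite -expRD subrr expR0.
rewrite -subr_ge0.
(* Chord minus curve, expressed by the remainders of the tangent line of exp at [th * x], evaluated
   at x and at 0; both remainders are nonnegative. *)
have -> : th * (expR (th * x) * expR (x - th * x)) + (1 - th) - expR (th * x)
  = expR (th * x) * (th * (expR (x - th * x) - (1 + (x - th * x)))
     + (1 - th) * (expR (- (th * x)) - (1 - th * x)))
    + (1 - th) * (1 - expR (th * x) * expR (- (th * x))) by ring.
rewrite e1 subrr mulr0 addr0.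
apply: mulr_ge0; first exact: ltW.
by apply: addr_ge0; apply: mulr_ge0; rewrite ?subr_ge0.
Qed.

Lemma powR_bernoulli_le (R : realType) (x y : R) :
  0 < x -> 0 <= y -> y <= 1 -> x `^ y <= 1 + y * (x - 1).
Proof.
move=> x0 y0 y1; rewrite /powR gt_eqF//.
by have := expR_convex0 (ln x) y0 y1; rewrite lnK ?posrE//; lra.
Qed.

Lemma powR_bernoulli_ge (R : realType) (x y : R) :
  0 < x -> 1 <= y -> 1 + y * (x - 1) <= x `^ y.
Proof.
move=> x0 y1; have y0 : 0 < y by lra.
have yi0 : 0 <= y^-1 by rewrite invr_ge0 ltW.
have yi1 : y^-1 <= 1 by rewrite invf_le1.
have h := powR_bernoulli_le (powR_gt0 y x0) yi0 yi1.
rewrite -powRrM divff ?(gt_eqF y0)// powRr1 ?(ltW x0)// in h.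
have : y * x <= y * (1 + y^-1 * (x `^ y - 1)) by rewrite ler_pM2l.
by rewrite mulrDr mulrA divff ?gt_eqF// mul1r; lra.
Qed.

Lemma powR_subadd (R : realType) (s p q : R) :
  0 <= s -> s <= 1 -> 0 < p -> 0 < q -> (p + q) `^ s <= p `^ s + q `^ s.
Proof.
move=> s0 s1 p0 q0; have pq0 : 0 < p + q by rewrite addr_gt0.
(* On (0, 1] a power with exponent s <= 1 is at least its base; this is used for the fractions
   p/(p+q) and q/(p+q), which add up to 1. *)
have H (u : R) : 0 < u -> u <= p + q -> u / (p + q) * (p + q) `^ s <= u `^ s.
  move=> u0 uq; have -> : u `^ s = (u / (p + q)) `^ s * (p + q) `^ s.
    by rewrite -powRM ?divr_ge0 ?(ltW pq0) ?(ltW u0)// divfK// gt_eqF.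
  rewrite ler_wpM2r ?powR_ge0//; apply: ger1_powR => //.
  by rewrite divr_gt0//= ler_pdivrMr// mul1r.
have := lerD (H p p0 _) (H q q0 _); rewrite !lerDl !lerDr.
move=> /(_ (ltW q0) (ltW p0)); rewrite -mulrDl -mulrDl divff ?gt_eqF//.
by rewrite mul1r.
Qed.

Lemma powR_div (R : realType) (a q r : R) :
  0 <= q -> 0 <= r -> (q / r) `^ a = q `^ a / r `^ a.
Proof.
move=> q0 r0; rewrite powRM ?invr_ge0//; congr (_ * _).
by rewrite -(powR_inv1 r0) -powRrM mulN1r powRN.
Qed.

(** Convexity: the graph of x^a lies above its tangent line at r. The concave counterpart below uses
    the tangent line at q. *)
Lemma powR_diff_le (R : realType) (a q r : R) :
  1 <= a -> 0 < q -> 0 < r -> r `^ a - q `^ a <= a * (r - q) * r `^ (a - 1).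
Proof.
move=> a1 q0 r0; have := @powR_bernoulli_ge R (q / r) a (divr_gt0 q0 r0) a1.
have er : r `^ a = r * r `^ (a - 1) by rewrite mulr_powRB1 ?ltW//; lra.
rewrite (powR_div _ (ltW q0) (ltW r0)).
rewrite ler_pdivlMr ?powR_gt0// er => h.
have -> : a * (r - q) * r `^ (a - 1) = - (a * (q / r - 1) * (r * r `^ (a - 1))).
  by field; rewrite gt_eqF.
by lra.
Qed.

Lemma powRDp (R : realType) (q x y : R) : 0 < q -> q `^ (x + y) = q `^ x * q `^ y.
Proof. by move=> q0; rewrite powRD// (gt_eqF q0) implybT. Qed.

Lemma powR_diff_le_concave (R : realType) (s q r : R) :
  0 <= s -> s <= 1 -> 0 < q -> 0 < r -> r `^ s - q `^ s <= s * (r - q) * q `^ (s - 1).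
Proof.
move=> s0 s1 q0 r0; have := @powR_bernoulli_le R (r / q) s (divr_gt0 r0 q0) s0 s1.
have eq : q `^ s = q * q `^ (s - 1).
  by rewrite -{2}(powRr1 (ltW q0)) -(powRDp _ _ q0) addrC subrK.
rewrite (powR_div _ (ltW r0) (ltW q0)).
rewrite ler_pdivrMr ?powR_gt0// => h.
have -> : s * (r - q) * q `^ (s - 1) = (1 + s * (r / q - 1)) * q `^ s - q `^ s.
  by rewrite eq; field; rewrite gt_eqF.
by lra.
Qed.

(** Numerical margin of [triad_low], with x = p/q. The maximum is just below 1.9, near x = 1/2,
    which is why the squares are centred there. *)
Lemma poly_low_bound (R : realType) (x : R) : 0 <= x -> x <= 1 ->
  (x + 1 / 2) * ((1 - x ^+ 2) * (2 + x)) <= 2.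
Proof.
move=> x0 x1.
have h1 : 0 <= (x - 1 / 2) ^+ 2 * (x + 1) by rewrite mulr_ge0 ?sqr_ge0//; lra.
have h2 : 0 <= (x - 1 / 2) ^+ 2 * (x ^+ 2 + x + 3 / 4).
  by rewrite mulr_ge0 ?sqr_ge0//; nra.
lra.
Qed.

(** Numerical margin of [triad_exp], with x = p/q and y = s - 1/2. The value 7/5 is a rational lower
    bound of sqrt 2, the constant in [triad_M]. *)
Lemma poly_exp_bound (R : realType) (x y : R) :
  0 <= x -> x <= 1 -> 0 <= y -> y <= 1 / 2 ->
  (1 / 2 + y) * (1 - (1 - x) * y) * (2 - x ^+ 2 - x ^+ 3) <= 7 / 5.
Proof.
move=> x0 x1 y0 y1.
(* The left side is affine in x. At x = 0 it is at most 9/16, attained at y = 1/4; at x = 1 it is at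
   most 1. *)
have h : (1 / 2 + y) * (1 - (1 - x) * y) <= 9 / 16 + 7 / 16 * x.
  have h1 : 0 <= (1 - x) * (y - 1 / 4) ^+ 2 by rewrite mulr_ge0 ?sqr_ge0//; lra.
  have h2 : 0 <= x * (1 / 2 - y) by rewrite mulr_ge0//; lra.
  lra.
have h2 : 0 <= 2 - x ^+ 2 - x ^+ 3 by nra.
have : (9 / 16 + 7 / 16 * x) * (2 - x ^+ 2 - x ^+ 3) <= 7 / 5.
  have h1 : 0 <= x * (x - 2 / 5) ^+ 2 by rewrite mulr_ge0 ?sqr_ge0.
  have h3 : 0 <= x ^+ 2 * (x - 2 / 5) ^+ 2 by rewrite mulr_ge0 ?sqr_ge0.
  have h4 : 0 <= (x - 2 / 5) ^+ 2 by rewrite sqr_ge0.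
  nra.
by apply: le_trans; rewrite ler_wpM2r.
Qed.

Lemma powR_ratio_le1 (R : realType) (q r e : R) :
  0 < q -> q <= r -> 0 <= e -> e <= 1 -> q * r `^ e <= r * q `^ e.
Proof.
move=> q0 qr e0 e1; have r0 := lt_le_trans q0 qr.
have := @ler1_powR R (r / q) e _ e1; rewrite ler_pdivlMr// mul1r => /(_ qr).
rewrite (powR_div _ (ltW r0) (ltW q0)) ler_pdivrMr ?powR_gt0//.
by rewrite mulrAC ler_pdivlMr// mulrC.
Qed.

Lemma powR_ratio_le2 (R : realType) (q r e : R) :
  0 < q -> q <= r -> e <= 2 -> q ^+ 2 * r `^ e <= r ^+ 2 * q `^ e.
Proof.
move=> q0 qr e1; have r0 := lt_le_trans q0 qr.
have /ler_powR/(_ _ _ e1) : 1 <= r / q by rewrite ler_pdivlMr// mul1r.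
rewrite powR_mulrn ?divr_ge0 ?(ltW q0) ?(ltW r0)//.
rewrite (powR_div _ (ltW r0) (ltW q0)) ler_pdivrMr ?powR_gt0// expr_div_n.
by rewrite mulrAC ler_pdivlMr ?exprn_gt0// mulrC.
Qed.

(** Sorted side lengths of a triangle of nonzero lattice vectors. With a = sigma s, the conditions
    on s and a are those that 1/s < sigma < 2 implies. *)
Notation triad_hyp s a p q r :=
  ([/\ 1 / 2 < s, s <= 1, 1 < a & a < 2 * s] /\ [/\ 1 <= p, p <= q, q <= r & r <= p + q]).
(** The square 2/(p q) can be summed over all lattice vectors of length p <= q with a result
    independent of q, because the sum of 1/p is of order q. *)
Notation triad_M p q := (Num.sqrt (2 / (p * q))).
Notation triad_Z s a p q r := (p `^ a * q `^ (a + s) * r `^ (a + s)).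

Lemma triad_facts (R : realType) (s a p q r : R) : triad_hyp s a p q r ->
  exists x, [/\ x = p / q, 0 < x, x <= 1 & p = x * q] /\
    ([/\ 0 < p, 0 < q & 0 < r] /\ [/\ 0 <= p, 0 <= q & 0 <= r]).
Proof.
move=> [[s0 s1 a1 a2] [p1 pq qr rpq]].
have p0 : 0 < p by lra.
have q0 : 0 < q by lra.
have r0 : 0 < r by lra.
exists (p / q); split; split; rewrite ?(ltW p0) ?(ltW q0) ?(ltW r0) ?divr_gt0//.
  by rewrite ler_pdivrMr// mul1r.
by rewrite divfK// gt_eqF.
Qed.

(** Discreteness of the lattice enters through p >= 1: negative powers of p q become powers of the
    ratio x = p/q, which leaves inequalities in x alone. *)
Lemma inv_pq_le (R : realType) (s a p q r : R) : triad_hyp s a p q r ->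
  (p * q)^-1 <= (p / q).
Proof.
move=> H; have [[s0 s1 a1 a2] [p1 pq qr rpq]] := H.
have [x [[xE x0 x1 pE] [[p0 q0 r0] [p0' q0' r0']]]] := triad_facts H; rewrite -?xE.
rewrite xE invfM ler_wpM2r ?invr_ge0// (le_trans _ p1)// invf_le1//.
Qed.

(** Arithmetic-geometric mean for 2 p and q. Equality holds at x = 1/2, close to the point where
    [poly_low_bound] is tightest. *)
Lemma triad_M_ge_low (R : realType) (s a p q r : R) : triad_hyp s a p q r ->
  4 / (2 * p + q) <= triad_M p q.
Proof.
move=> H; have [[s0 s1 a1 a2] [p1 pq qr rpq]] := H.
have [x [[xE x0 x1 pE] [[p0 q0 r0] [p0' q0' r0']]]] := triad_facts H; rewrite -?xE.
have h : 0 <= 2 / (p * q) by rewrite divr_ge0// mulr_ge0.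
rewrite -[leLHS]ger0_norm ?divr_ge0//; last by lra.
rewrite -sqrtr_sqr ler_sqrt// expr_div_n ler_pdivrMr ?exprn_gt0//; last by lra.
rewrite mulrAC ler_pdivlMr ?mulr_gt0//.
have := sqr_ge0 (2 * p - q); nra.
Qed.

Lemma triad_M_ge_exp (R : realType) (s a p q r : R) : triad_hyp s a p q r ->
  7 / 5 * (p * q) `^ (- (1 / 2)) <= triad_M p q.
Proof.
move=> H; have [[s0 s1 a1 a2] [p1 pq qr rpq]] := H.
have [x [[xE x0 x1 pE] [[p0 q0 r0] [p0' q0' r0']]]] := triad_facts H; rewrite -?xE.
have pq0 : 0 < p * q by rewrite mulr_gt0.
have e : (p * q) `^ (- (1 / 2)) = Num.sqrt (p * q)^-1.
  by rewrite div1r -powR12_sqrt ?invr_ge0 ?(ltW pq0)// -(powR_inv1 (ltW pq0)) -powRrM mulN1r.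
rewrite e sqrtrM// ler_wpM2r ?sqrtr_ge0//.
rewrite -[leLHS]ger0_norm; last by lra.
by rewrite -sqrtr_sqr ler_sqrt//; lra.
Qed.

Lemma triad_ratio_a (R : realType) (s a p q r : R) : triad_hyp s a p q r ->
  (p * q) `^ (1 - a) <= 1 - (1 - (p / q)) * (a - 1).
Proof.
move=> H; have [[s0 s1 a1 a2] [p1 pq qr rpq]] := H.
have [x [[xE x0 x1 pE] [[p0 q0 r0] [p0' q0' r0']]]] := triad_facts H; rewrite -?xE.
have ax : a - 1 <= 1 by lra.
have := @powR_bernoulli_le R x (a - 1) x0 _ ax; rewrite subr_ge0 => /(_ (ltW a1)).
have -> : 1 + (a - 1) * (x - 1) = 1 - (1 - x) * (a - 1) by ring.
apply: le_trans.
have -> : (p * q) `^ (1 - a) = ((p * q)^-1) `^ (a - 1).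
  by rewrite -(powR_inv1 (mulr_ge0 p0' q0')) -powRrM mulN1r opprB.
have i0 : 0 <= (p * q)^-1 by rewrite invr_ge0 mulr_ge0.
apply: ge0_ler_powR; [by lra|by rewrite nnegrE|by rewrite nnegrE ltW|].
by rewrite xE (inv_pq_le H).
Qed.

Lemma triad_ratio_s (R : realType) (s a p q r : R) : triad_hyp s a p q r ->
  (p * q) `^ (1 / 2 - s) <= 1 - (1 - (p / q)) * (s - 1 / 2).
Proof.
move=> H; have [[s0 s1 a1 a2] [p1 pq qr rpq]] := H.
have [x [[xE x0 x1 pE] [[p0 q0 r0] [p0' q0' r0']]]] := triad_facts H; rewrite -?xE.
have sx : s - 1 / 2 <= 1 by lra.
have := @powR_bernoulli_le R x (s - 1 / 2) x0 _ sx; rewrite subr_ge0 => /(_ (ltW s0)).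
have -> : 1 + (s - 1 / 2) * (x - 1) = 1 - (1 - x) * (s - 1 / 2) by ring.
apply: le_trans.
have -> : (p * q) `^ (1 / 2 - s) = ((p * q)^-1) `^ (s - 1 / 2).
  by rewrite -(powR_inv1 (mulr_ge0 p0' q0')) -powRrM mulN1r opprB.
have i0 : 0 <= (p * q)^-1 by rewrite invr_ge0 mulr_ge0.
apply: ge0_ler_powR; [by lra|by rewrite nnegrE|by rewrite nnegrE ltW|].
by rewrite xE (inv_pq_le H).
Qed.

(** * The multiplier of a triad *)

(** The extreme case psi = 0 of [triad_bound], where the weights are pure powers. Writing r^(2a) -
    q^(2a) as (r^a - q^a)(r^a + q^a) and using convexity on the first factor extracts r - q; the
    remaining factor is controlled by x alone. *)
Lemma triad_low (R : realType) (s a p q r : R) : triad_hyp s a p q r ->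
  (p^-1 - q^-1) * (r `^ (2 * a) - q `^ (2 * a)) * (p ^+ 2 * r) <= (r - q) * (triad_M p q * triad_Z s a p q r).
Proof.
move=> H; have [[s0 s1 a1 a2] [p1 pq qr rpq]] := H.
have [x [[xE x0 x1 pE] [[p0 q0 r0] [p0' q0' r0']]]] := triad_facts H; rewrite -?xE.
have h1 : r `^ a * (r `^ a + q `^ a) <= r `^ (a + s) * q `^ (a - s) * (2 + x).
  have -> : r `^ a = r `^ s * r `^ (a - s) by rewrite -powRDp// addrC subrK.
  have -> : r `^ (a + s) = r `^ s * (r `^ s * r `^ (a - s)).
    by rewrite -!powRDp//; congr powR; ring.
  rewrite -!mulrA ler_wpM2l ?powR_ge0//.
  have e1 : r `^ (a - s) <= q `^ (a - s) * (1 + x).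
    have := @powR_ratio_le1 R q r (a - s) q0 qr; rewrite subr_ge0.
    move=> /(_ _ _)/wrap[]; [lra|lra|] => h.
    rewrite -(ler_pM2l q0) (le_trans h)// mulrCA [leRHS]mulrC ler_wpM2r ?powR_ge0//.
    by rewrite mulrDr mulr1 mulrC -pE addrC.
  have e2 : q `^ a <= r `^ s * q `^ (a - s).
    have -> : q `^ a = q `^ s * q `^ (a - s) by rewrite -powRDp// addrC subrK.
    rewrite ler_wpM2r ?powR_ge0//; apply: ge0_ler_powR; rewrite ?nnegrE//; lra.
  have := powR_ge0 r s; have := powR_ge0 r (a - s); have := powR_ge0 q (a - s).
  set A := r `^ (a - s) in e1 *; set B := r `^ s in e2 *; set C := q `^ (a - s) in e1 e2 *.
  move=> C0 A0 B0.
  apply: (@le_trans _ _ (A * (B * (C * (1 + x)) + B * C))).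
    by rewrite ler_wpM2l// lerD// ler_wpM2l.
  by rewrite le_eqVlt; apply/orP; left; apply/eqP; ring.
have h2 : (1 - x) * a * p * q `^ (a - s) * (2 + x) <= (triad_M p q) * (p `^ a * q `^ (a + s)).
  have e1 : q `^ (a - s) = q `^ (a + s) * q `^ (- (2 * s)).
    by rewrite -powRDp//; congr powR; ring.
  have e2 : q `^ (- (2 * s)) <= q `^ (- a) by apply: ler_powR; lra.
  have e3 : p * q `^ (- a) = p `^ a * ((p * q) `^ (1 - a) / q).
    rewrite powRM// mulrA mulrA -powRDp// addrC subrK powRr1// -mulrA; congr (_ * _).
    by rewrite (powRDp _ _ q0) powRr1// mulrAC divff ?gt_eqF// mul1r.
  have e4 := triad_ratio_a H; rewrite -xE in e4.
  have e5 : a * (p * q) `^ (1 - a) <= 1 + x.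
    apply: (@le_trans _ _ (a * (1 - (1 - x) * (a - 1)))); first by apply: ler_wpM2l => //; lra.
    have g1 : 0 <= (1 - x) * (a - 1) ^+ 2 by rewrite mulr_ge0 ?sqr_ge0//; lra.
    have g2 : 0 <= x * (2 - a) by rewrite mulr_ge0//; lra.
    lra.
  have e6 : (1 - x) * (2 + x) * (1 + x) / q <= (triad_M p q).
    apply: le_trans (triad_M_ge_low H).
    rewrite ler_pdivlMr; last by lra.
    have := @poly_low_bound R x (ltW x0) x1 => h.
    rewrite mulrAC ler_pdivrMr// pE.
    have -> : (1 - x) * (2 + x) * (1 + x) * (2 * (x * q) + q)
      = 2 * ((x + 1 / 2) * ((1 - x ^+ 2) * (2 + x))) * q by field.
    by rewrite ler_pM2r//; lra.
  apply: (@le_trans _ _ ((1 - x) * (2 + x) * (1 + x) / q * (p `^ a * q `^ (a + s)))); last first.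
    by rewrite ler_wpM2r// mulr_ge0// powR_ge0.
  have -> : (1 - x) * a * p * q `^ (a - s) * (2 + x)
    = (1 - x) * (2 + x) * q `^ (a + s) * (a * (p * q `^ (- (2 * s)))) by rewrite e1; ring.
  have -> : (1 - x) * (2 + x) * (1 + x) / q * (p `^ a * q `^ (a + s))
    = (1 - x) * (2 + x) * q `^ (a + s) * ((1 + x) * (p `^ a / q)) by ring.
  apply: ler_wpM2l.
    by rewrite !mulr_ge0 ?powR_ge0//; lra.
  apply: (@le_trans _ _ (a * (p * q `^ (- a)))).
    by apply: ler_wpM2l; [lra|apply: ler_wpM2l].
  rewrite e3.
  have -> : a * (p `^ a * ((p * q) `^ (1 - a) / q)) = (a * (p * q) `^ (1 - a)) * (p `^ a / q).
    by ring.
  by apply: ler_wpM2r => //; rewrite divr_ge0// powR_ge0.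
have h3 : r `^ (2 * a) - q `^ (2 * a) <= a * (r - q) * r `^ (a - 1) * (r `^ a + q `^ a).
  have E (u : R) : 0 < u -> u `^ (2 * a) = u `^ a * u `^ a.
    by move=> u0; rewrite -powRDp//; congr powR; ring.
  rewrite !E//.
  apply: (@le_trans _ _ ((r `^ a - q `^ a) * (r `^ a + q `^ a))).
    by rewrite le_eqVlt; apply/orP; left; apply/eqP; ring.
  apply: ler_wpM2r; first by rewrite addr_ge0 ?powR_ge0.
  by apply: powR_diff_le => //; lra.
have px : 0 <= (p^-1 - q^-1) by rewrite subr_ge0 lef_pV2 ?posrE.
apply: (@le_trans _ _ ((p^-1 - q^-1) * (a * (r - q) * r `^ (a - 1) * (r `^ a + q `^ a)) * (p ^+ 2 * r))).
  by rewrite ler_wpM2r ?mulr_ge0 ?sqr_ge0// ler_wpM2l.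
have -> : (p^-1 - q^-1) * (a * (r - q) * r `^ (a - 1) * (r `^ a + q `^ a)) * (p ^+ 2 * r)
  = (r - q) * ((1 - x) * a * p * ((r * r `^ (a - 1)) * (r `^ a + q `^ a))).
  by rewrite xE; field; rewrite !gt_eqF.
rewrite mulr_powRB1//; last by lra.
apply: ler_wpM2l; first by rewrite subr_ge0.
apply: (@le_trans _ _ ((1 - x) * a * p * (r `^ (a + s) * q `^ (a - s) * (2 + x)))).
  by rewrite ler_wpM2l// !mulr_ge0//; lra.
have -> : (1 - x) * a * p * (r `^ (a + s) * q `^ (a - s) * (2 + x))
  = ((1 - x) * a * p * q `^ (a - s) * (2 + x)) * r `^ (a + s) by ring.
by rewrite !mulrA -(mulrA (triad_M p q)) ler_wpM2r ?powR_ge0.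
Qed.

(** The opposite extreme of [triad_bound], e^(-psi p^s) = 0. There the difference of powers is
    replaced by their sum, and the factor r - q has to come from r^s - q^s by concavity. *)
Lemma triad_exp (R : realType) (s a p q r : R) : triad_hyp s a p q r ->
  (p^-1 - q^-1) * ((r `^ s - q `^ s) / p `^ s * (r `^ (2 * a) + q `^ (2 * a)))
    * (p ^+ 2 * r) <= (r - q) * (triad_M p q * triad_Z s a p q r).
Proof.
move=> H; have [[s0 s1 a1 a2] [p1 pq qr rpq]] := H.
have [x [[xE x0 x1 pE] [[p0 q0 r0] [p0' q0' r0']]]] := triad_facts H.
have E (u : R) : 0 < u -> u * u `^ (2 * a) = u `^ (a + s) * u `^ (a + 1 - s).
  move=> u0; rewrite -[X in X * _](powRr1 (ltW u0)) -!(powRDp _ _ u0).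
  by congr (_ `^ _); ring.
have h1 : r * (r `^ (2 * a) + q `^ (2 * a)) <=
    r `^ (a + s) * q `^ (a + 1 - s) * (1 + (1 + x) ^+ 2).
  have e1 : r `^ (a + 1 - s) <= q `^ (a + 1 - s) * (1 + x) ^+ 2.
    have e2 : a + 1 - s <= 2 by lra.
    have := powR_ratio_le2 q0 qr e2 => h.
    rewrite -(ler_pM2l (exprn_gt0 2 q0)) (le_trans h)// mulrCA [leRHS]mulrC.
    apply: ler_wpM2r; first exact: powR_ge0.
    rewrite -exprMn; apply: lerXn2r; rewrite ?nnegrE ?mulr_ge0//; first lra.
    by rewrite mulrDr mulr1 (mulrC q x) -pE addrC.
  have e2 : r * q `^ (2 * a) <= r `^ (a + s) * q `^ (a + 1 - s).
    have -> : r * q `^ (2 * a) = r * q `^ (a + s - 1) * q `^ (a + 1 - s).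
      by rewrite -mulrA -(powRDp _ _ q0); congr (_ * _ `^ _); ring.
    apply: ler_wpM2r; first exact: powR_ge0.
    have -> : r `^ (a + s) = r * r `^ (a + s - 1).
      by rewrite mulr_powRB1//; lra.
    apply: ler_wpM2l => //; apply: ge0_ler_powR; rewrite ?nnegrE//; lra.
  rewrite mulrDr E//.
  have -> : r `^ (a + s) * q `^ (a + 1 - s) * (1 + (1 + x) ^+ 2)
    = r `^ (a + s) * (q `^ (a + 1 - s) * (1 + x) ^+ 2) + r `^ (a + s) * q `^ (a + 1 - s).
    by ring.
  by apply: lerD => //; apply: ler_wpM2l => //; exact: powR_ge0.
have tau : (r `^ s - q `^ s) / p `^ s <= s * (r - q) * q `^ (s - 1) / p `^ s.
  apply: ler_wpM2r; first by rewrite invr_ge0 powR_ge0.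
  by apply: powR_diff_le_concave => //; lra.
have h2 : (1 - x) * s * q `^ (s - 1) * (p / p `^ s) * q `^ (a + 1 - s) * (1 + (1 + x) ^+ 2)
    <= triad_M p q * (p `^ a * q `^ (a + s)).
  have e1 : q `^ (s - 1) * q `^ (a + 1 - s) = q `^ (a + s) * q `^ (- s).
    by rewrite -!(powRDp _ _ q0); congr (_ `^ _); ring.
  have e2 : p / p `^ s * q `^ (- s) <= p `^ a * (p * q) `^ (- s).
    rewrite powRM// mulrA -powRN; apply: ler_wpM2r; first exact: powR_ge0.
    apply: ler_wpM2r; first exact: powR_ge0.
    by rewrite -[leLHS](powRr1 p0'); apply: ler_powR => //; exact: ltW.
  have e3 : (p * q) `^ (- s) = (p * q) `^ (- (1 / 2)) * (p * q) `^ (1 / 2 - s).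
    by rewrite -powRDp ?mulr_gt0//; congr (_ `^ _); ring.
  have e4 := triad_ratio_s H; rewrite -xE in e4.
  have e5 : (1 - x) * (1 + (1 + x) ^+ 2) * s * (p * q) `^ (- s) <= triad_M p q.
    apply: le_trans (triad_M_ge_exp H).
    rewrite e3 mulrCA mulrC [leRHS]mulrC.
    rewrite mulrC; apply: ler_wpM2l; first exact: powR_ge0.
    have g0 : 0 <= s - 1 / 2 by lra.
    have g1 : s - 1 / 2 <= 1 / 2 by lra.
    apply: le_trans (poly_exp_bound (ltW x0) x1 g0 g1).
    have -> : (1 - x) * (1 + (1 + x) ^+ 2) * s * (p * q) `^ (1 / 2 - s)
      = (2 - x ^+ 2 - x ^+ 3) * (s * (p * q) `^ (1 / 2 - s)) by ring.
    rewrite [leRHS]mulrC; apply: ler_wpM2l.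
      have x2 : x ^+ 2 <= 1 by rewrite expr_le1// ltW.
      have x3 : x ^+ 3 <= 1 by rewrite expr_le1// ltW.
      by lra.
    have -> : 1 / 2 + (s - 1 / 2) = s by ring.
    by apply: ler_wpM2l => //; lra.
  have -> : (1 - x) * s * q `^ (s - 1) * (p / p `^ s) * q `^ (a + 1 - s) * (1 + (1 + x) ^+ 2)
    = (1 - x) * (1 + (1 + x) ^+ 2) * s * ((p / p `^ s) * (q `^ (s - 1) * q `^ (a + 1 - s))).
    by ring.
  have c0 : 0 <= (1 - x) * (1 + (1 + x) ^+ 2) * s.
    have := sqr_ge0 (1 + x) => h; rewrite !mulr_ge0//; lra.
  have c1 := powR_ge0 p a; have c2 := powR_ge0 q (a + s).
  apply: (@le_trans _ _ ((1 - x) * (1 + (1 + x) ^+ 2) * s *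
      (p `^ a * (p * q) `^ (- s) * q `^ (a + s)))).
    apply: ler_wpM2l => //; rewrite e1 mulrCA mulrC.
    by apply: ler_wpM2r.
  have -> : (1 - x) * (1 + (1 + x) ^+ 2) * s * (p `^ a * (p * q) `^ (- s) * q `^ (a + s))
    = (1 - x) * (1 + (1 + x) ^+ 2) * s * (p * q) `^ (- s) * (p `^ a * q `^ (a + s)) by ring.
  by apply: ler_wpM2r => //; exact: mulr_ge0.
have px : 0 <= (p^-1 - q^-1) by rewrite subr_ge0 lef_pV2 ?posrE.
have rr := powR_ge0 r (2 * a); have qq := powR_ge0 q (2 * a).
apply: (@le_trans _ _ ((p^-1 - q^-1) * (s * (r - q) * q `^ (s - 1) / p `^ s *
    (r `^ (2 * a) + q `^ (2 * a))) * (p ^+ 2 * r))).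
  apply: ler_wpM2r; first by rewrite mulr_ge0 ?sqr_ge0.
  apply: ler_wpM2l => //; apply: ler_wpM2r => //; exact: addr_ge0.
have pss : p `^ s != 0 by rewrite gt_eqF ?powR_gt0.
have -> : (p^-1 - q^-1) * (s * (r - q) * q `^ (s - 1) / p `^ s *
    (r `^ (2 * a) + q `^ (2 * a))) * (p ^+ 2 * r)
  = (r - q) * ((1 - x) * s * q `^ (s - 1) * (p / p `^ s) *
     (r * (r `^ (2 * a) + q `^ (2 * a)))).
  by rewrite xE; field; rewrite pss !gt_eqF.
apply: ler_wpM2l; first by rewrite subr_ge0.
have c0 : 0 <= (1 - x) * s * q `^ (s - 1) * (p / p `^ s).
  by rewrite !mulr_ge0 ?invr_ge0 ?powR_ge0//; lra.
apply: (@le_trans _ _ ((1 - x) * s * q `^ (s - 1) * (p / p `^ s) *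
   (r `^ (a + s) * q `^ (a + 1 - s) * (1 + (1 + x) ^+ 2)))).
  exact: ler_wpM2l.
have -> : (1 - x) * s * q `^ (s - 1) * (p / p `^ s) *
   (r `^ (a + s) * q `^ (a + 1 - s) * (1 + (1 + x) ^+ 2))
  = ((1 - x) * s * q `^ (s - 1) * (p / p `^ s) * q `^ (a + 1 - s) * (1 + (1 + x) ^+ 2))
    * r `^ (a + s) by ring.
rewrite (mulrA (triad_M p q)); apply: ler_wpM2r => //; exact: powR_ge0.
Qed.

(** Here 1/q - 1/r = (r - q)/(q r) already supplies the factor r - q, so no difference of weights
    has to be exploited. *)
Lemma triad_high (R : realType) (s a p q r : R) : triad_hyp s a p q r ->
  (q^-1 - r^-1) * q `^ (2 * a) * (p ^+ 2 * r) <= (r - q) * (triad_M p q * triad_Z s a p q r).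
Proof.
move=> H; have [[s0 s1 a1 a2] [p1 pq qr rpq]] := H.
have [x [[xE x0 x1 pE] [[p0 q0 r0] [p0' q0' r0']]]] := triad_facts H.
have -> : (q^-1 - r^-1) * q `^ (2 * a) * (p ^+ 2 * r)
  = (r - q) * (q `^ (2 * a) / q * p ^+ 2) by field; rewrite !gt_eqF.
apply: ler_wpM2l; first by rewrite subr_ge0.
have h1 : 1 / q <= triad_M p q.
  apply: le_trans (triad_M_ge_low H).
  by rewrite ler_pdivlMr ?mul1r; last lra; rewrite mulrC ler_pdivrMr//; lra.
have h2 : q `^ (a + s) <= r `^ (a + s).
  by apply: ge0_ler_powR; rewrite ?nnegrE//; lra.
have h3 : q `^ (2 * a) * p ^+ 2 <= p `^ a * q `^ (a + s) * q `^ (a + s).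
  have -> : q `^ (2 * a) = q `^ (a + s) * q `^ (a + s) * q `^ (- (2 * s)).
    by rewrite -!(powRDp _ _ q0); congr (_ `^ _); ring.
  have -> : p ^+ 2 = p `^ a * p `^ (2 - a).
    by rewrite -(powRDp _ _ p0) -powR_mulrn//; congr (_ `^ _); ring.
  have h : p `^ (2 - a) * q `^ (- (2 * s)) <= 1.
    apply: (@le_trans _ _ (q `^ 1 * q `^ (- 1))).
      apply: ler_pM; rewrite ?powR_ge0//; last by apply: ler_powR; lra.
      apply: (@le_trans _ _ (p `^ 1)); first by apply: ler_powR; lra.
      by rewrite !powRr1.
    by rewrite -(powRDp _ _ q0) subrr powRr0.
  have c1 := powR_ge0 p a; have c2 := powR_ge0 q (a + s).
  have -> : q `^ (a + s) * q `^ (a + s) * q `^ (- (2 * s)) * (p `^ a * p `^ (2 - a))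
   = p `^ a * q `^ (a + s) * q `^ (a + s) * (p `^ (2 - a) * q `^ (- (2 * s))) by ring.
  by rewrite ler_piMr// !mulr_ge0.
have c1 := powR_ge0 p a; have c2 := powR_ge0 q (a + s).
apply: (@le_trans _ _ (1 / q * (p `^ a * q `^ (a + s) * r `^ (a + s)))).
  rewrite mulrAC mulrC div1r; apply: ler_wpM2l; first by rewrite invr_ge0.
  by apply: le_trans h3 _; apply: ler_wpM2l => //; exact: mulr_ge0.
by apply: ler_wpM2r => //; rewrite !mulr_ge0// powR_ge0.
Qed.

(** With S the sum of the s-th powers of the three lengths, 2 m^s - S is m^s minus the other two, so
    this is |m|^(2a) times the weight [wexp] for output frequency m. *)
Definition triad_w (R : realType) (s a psi S m : R) : R :=
  m `^ (2 * a) * expR (psi * (2 * m `^ s - S)).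

Lemma triad_w_mono (R : realType) (s a psi S m n : R) :
  0 <= s -> 0 <= a -> 0 <= psi -> 0 <= m -> m <= n ->
  triad_w s a psi S m <= triad_w s a psi S n.
Proof.
move=> s0 a0 psi0 m0 mn; have n0 := le_trans m0 mn.
apply: ler_pM; [exact: powR_ge0|exact: expR_ge0| |].
  by apply: ge0_ler_powR; rewrite ?nnegrE// mulr_ge0.
rewrite ler_expR ler_wpM2l// lerD2r ler_wpM2l//.
by apply: ge0_ler_powR.
Qed.

Lemma norm_diff_le (R : realDomainType) (x y z : R) :
  0 <= x -> 0 <= y -> x <= z -> y <= z -> `|x - y| <= z.
Proof. by move=> *; rewrite ler_norml; apply/andP; split; lra. Qed.

(** The weights increase with the length, so both products are nonnegative and their difference is
    at most the larger one; each is estimated separately. *)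
Lemma triad_bound (R : realType) (s a psi p q r : R) : triad_hyp s a p q r -> 0 <= psi ->
  let W := triad_w s a psi (p `^ s + q `^ s + r `^ s) in
  is_true (`|(p^-1 - q^-1) * (W r - W q) - (q^-1 - r^-1) * (W q - W p)| * (p ^+ 2 * r)
  <= (r - q) * (triad_M p q * triad_Z s a p q r)).
Proof.
move=> H psi0 W.
have HL := triad_low H; have HE := triad_exp H; have HH := triad_high H.
have [[s0 s1 a1 a2] [p1 pq qr rpq]] := H.
have [x [[xE x0 x1 pE] [[p0 q0 r0] [p0' q0' r0']]]] := triad_facts H.
have s0' : 0 <= s by lra.
have a0' : 0 <= a by lra.
have a20 : 0 <= 2 * a by lra.
set Bd := (r - q) * _ in HL HE HH *.
have i1 : 0 <= p^-1 - q^-1 by rewrite subr_ge0 lef_pV2 ?posrE.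
have i2 : 0 <= q^-1 - r^-1 by rewrite subr_ge0 lef_pV2 ?posrE.
have w1 : 0 <= W r - W q by rewrite subr_ge0 triad_w_mono.
have w2 : 0 <= W q - W p by rewrite subr_ge0 triad_w_mono.
have pr0 : 0 <= p ^+ 2 * r by rewrite mulr_ge0 ?sqr_ge0.
have ps := powR_gt0 s p0; have qs := powR_gt0 s q0.
have qrs : q `^ s <= r `^ s by apply: ge0_ler_powR; rewrite ?nnegrE.
have prs : p `^ s <= r `^ s.
  by apply: ge0_ler_powR; rewrite ?nnegrE//; exact: le_trans pq qr.
have rsub : r `^ s <= p `^ s + q `^ s.
  apply: le_trans (powR_subadd s0' s1 p0 q0).
  by apply: ge0_ler_powR; rewrite ?nnegrE ?addr_ge0.
(* tau locates r^s between q^s and p^s + q^s. The exponents in W r and W q are -(1 - tau) and -(1 +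
   tau) times psi p^s, so convexity of exp compares both with the single number y = e^(-psi p^s). *)
pose tau := (r `^ s - q `^ s) / p `^ s.
have tau0 : 0 <= tau by rewrite divr_ge0 ?subr_ge0// ltW.
have tau1 : tau <= 1 by rewrite ler_pdivrMr// mul1r lerBlDr.
have tauE : tau * p `^ s = r `^ s - q `^ s by rewrite divfK ?gt_eqF.
pose y := expR (- (psi * p `^ s)).
have y0 : 0 <= y by exact: expR_ge0.
have y1 : y <= 1 by rewrite expR_le1 oppr_le0 mulr_ge0// ltW.
have Wr : W r <= r `^ (2 * a) * ((1 - tau) * y + tau).
  rewrite /W /triad_w; apply: ler_wpM2l; first exact: powR_ge0.
  have -> : psi * (2 * r `^ s - (p `^ s + q `^ s + r `^ s)) = (1 - tau) * - (psi * p `^ s).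
    by rewrite mulrN mulrBl mul1r (mulrCA tau) tauE; ring.
  have := @expR_convex0 R (1 - tau) (- (psi * p `^ s)).
  rewrite subr_ge0 lerBlDr lerDl => /(_ tau1 tau0).
  by rewrite (_ : 1 - (1 - tau) = tau)//; ring.
have Wq : q `^ (2 * a) * ((1 + tau) * y - tau) <= W q.
  rewrite /W /triad_w; apply: ler_wpM2l; first exact: powR_ge0.
  have -> : psi * (2 * q `^ s - (p `^ s + q `^ s + r `^ s)) = (1 + tau) * - (psi * p `^ s).
    have -> : (1 + tau) * - (psi * p `^ s) = - (psi * p `^ s) - psi * (tau * p `^ s) by ring.
    by rewrite tauE; ring.
  have t1 : 0 < 1 + tau by exact: ltr_wpDr.
  have := @expR_convex0 R (1 + tau)^-1 ((1 + tau) * - (psi * p `^ s)).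
  rewrite invr_ge0 mulKf ?gt_eqF// invf_le1// lerDl => /(_ (ltW t1) tau0).
  set E := expR ((1 + tau) * _); rewrite -/y => h.
  have := ler_wpM2l (ltW t1) h.
  have -> : (1 + tau) * ((1 + tau)^-1 * E + (1 - (1 + tau)^-1)) = E + tau.
    by field; rewrite gt_eqF.
  by rewrite lerBlDr.
have Wqq : W q <= q `^ (2 * a).
  rewrite /W /triad_w ler_piMr ?powR_ge0// expR_le1 mulr_ge0_le0//.
  have -> : 2 * q `^ s - (p `^ s + q `^ s + r `^ s) = (q `^ s - r `^ s) - p `^ s by ring.
  by rewrite subr_le0 (le_trans _ (ltW ps))// subr_le0.
have Wp0 : 0 <= W p by rewrite mulr_ge0 ?powR_ge0 ?expR_ge0.
move: (W r) (W q) (W p) w1 w2 Wr Wq Wqq Wp0 => wr wq wp w1 w2 Wr Wq Wqq Wp0.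
rewrite -/tau in HE.
move: tau tau0 tau1 tauE y y0 y1 HE Wr Wq => tau tau0 tau1 tauE y y0 y1 HE Wr Wq.
move: (r `^ (2 * a)) (q `^ (2 * a)) HL HE HH Wr Wq Wqq => ra qa HL HE HH Wr Wq Wqq.
clearbody Bd; clear -HL HE HH Wr Wq Wqq i1 i2 w1 w2 pr0 tau0 tau1 y0 y1 Wp0.
(* A convex combination, with weights y and 1 - y, of the quantities bounded in [triad_low] and
   [triad_exp]. *)
have dW : wr - wq <= y * (ra - qa) + (1 - y) * (tau * (ra + qa)).
  apply: le_trans (lerB Wr Wq) _; rewrite le_eqVlt; apply/orP; left; apply/eqP; ring.
have B1 : (p^-1 - q^-1) * (wr - wq) * (p ^+ 2 * r) <= Bd.
  have := ler_wpM2r pr0 (ler_wpM2l i1 dW).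
  move=> /le_trans; apply.
  have -> : (p^-1 - q^-1) * (y * (ra - qa) + (1 - y) * (tau * (ra + qa))) * (p ^+ 2 * r)
    = y * ((p^-1 - q^-1) * (ra - qa) * (p ^+ 2 * r))
     + (1 - y) * ((p^-1 - q^-1) * (tau * (ra + qa)) * (p ^+ 2 * r)).
    by ring.
  have g1 := ler_wpM2l y0 HL.
  have y1' : 0 <= 1 - y by rewrite subr_ge0.
  have g2 := ler_wpM2l y1' HE.
  apply: le_trans (lerD g1 g2) _; rewrite le_eqVlt; apply/orP; left; apply/eqP; ring.
have B2 : (q^-1 - r^-1) * (wq - wp) * (p ^+ 2 * r) <= Bd.
  apply: le_trans HH; apply: ler_wpM2r => //; apply: ler_wpM2l => //.
  by apply: le_trans Wqq; rewrite lerBlDr lerDl.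
rewrite -{1}(ger0_norm pr0) -normrM mulrBl; apply: norm_diff_le => //.
  by apply: mulr_ge0 => //; exact: mulr_ge0.
by apply: mulr_ge0 => //; exact: mulr_ge0.
Qed.

Lemma square_frac_le (R : realFieldType) (w z : R) :
  0 <= z -> z <= w -> w <= 2 -> z / (2 + z) ^+ 2 <= w / (2 + w) ^+ 2.
Proof.
move=> z0 zw w2.
rewrite ler_pdivrMr; last by rewrite exprn_gt0//; lra.
rewrite mulrAC ler_pdivlMr; last by rewrite exprn_gt0//; lra.
rewrite -subr_ge0.
have -> : w * (2 + z) ^+ 2 - z * (2 + w) ^+ 2 = (w - z) * (4 - w * z) by ring.
by apply: mulr_ge0; nra.
Qed.

(* The Heron relation expresses that [chi] is twice the area of the triangle with sides p, q, r. *)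
Definition heron (R : realType) (chi p q r : R) : Prop :=
  chi ^+ 2 = p ^+ 2 * q ^+ 2 - ((r ^+ 2 - p ^+ 2 - q ^+ 2) / 2) ^+ 2.

(** As chi is twice the area, theta is (r - q)/p times the sine of the angle between the sides p and
    r. *)
Definition theta (R : realType) (chi p q r : R) : R := chi * (r - q) / (p ^+ 2 * r).

(** The triangle inequality makes (r - q)/p at most the cosine of the angle between the sides p and
    r, so theta <= sin cos <= 1/2. *)
Lemma theta_le_half (R : realType) (chi p q r : R) :
  0 < p -> 0 < q -> q <= r -> r <= p + q -> 0 <= chi -> heron chi p q r ->
  theta chi p q r ^+ 2 <= 1 / 4.
Proof.
move=> p0 q0 qr rpq chi0 hc; have r0 := lt_le_trans q0 qr.
have D : r * (r - q) <= (p ^+ 2 + r ^+ 2 - q ^+ 2) / 2 by nra.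
have hc2 : chi ^+ 2 + ((p ^+ 2 + r ^+ 2 - q ^+ 2) / 2) ^+ 2 = p ^+ 2 * r ^+ 2.
  by rewrite hc; field.
have h : chi * (r - q) <= 1 / 2 * (p ^+ 2 * r).
  rewrite -(ler_pM2l r0).
  have h1 : chi * (r * (r - q)) <= chi * ((p ^+ 2 + r ^+ 2 - q ^+ 2) / 2).
    by rewrite ler_wpM2l.
  have := sqr_ge0 (chi - (p ^+ 2 + r ^+ 2 - q ^+ 2) / 2); nra.
have pr0 : 0 < p ^+ 2 * r by rewrite mulr_gt0 ?exprn_gt0.
have t0 : 0 <= theta chi p q r by rewrite divr_ge0 ?(ltW pr0)// mulr_ge0 ?subr_ge0.
have t1 : theta chi p q r <= 1 / 2 by rewrite ler_pdivrMr.
by have := ler_pM t0 t0 t1 t1; rewrite expr2; lra.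
Qed.

(** Two applications of [theta_le_half] would give 1/2. With chi <= p q, theta is at most (q/p) z/(2
    + z) for z = r^2/q^2 - 1, and the parallelogram law ties the two values of z: they sum to 2
    (p/q)^2. *)
Lemma theta_pair (R : realType) (chi p q r r' : R) :
  0 < p -> p <= q -> q <= r -> q <= r' -> 0 <= chi -> chi <= p * q ->
  r ^+ 2 + r' ^+ 2 = 2 * p ^+ 2 + 2 * q ^+ 2 ->
  theta chi p q r ^+ 2 + theta chi p q r' ^+ 2 <= 1 / 4.
Proof.
move=> p0 pq qr qr' chi0 chiq rr.
have q0 := lt_le_trans p0 pq.
have key (u : R) : q <= u -> theta chi p q u ^+ 2 <=
    (q / p) ^+ 2 * ((u ^+ 2 / q ^+ 2 - 1) / (2 + (u ^+ 2 / q ^+ 2 - 1))) ^+ 2.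
  move=> qu; have u0 := lt_le_trans q0 qu.
  rewrite -exprMn ler_sqr ?nnegrE; last 2 first.
  - by apply: divr_ge0; apply: mulr_ge0; rewrite ?subr_ge0 ?sqr_ge0// ltW.
  - have h : 0 <= u ^+ 2 / q ^+ 2 - 1.
      by rewrite subr_ge0 ler_pdivlMr ?exprn_gt0// mul1r ler_sqr ?nnegrE// ltW.
    by rewrite mulr_ge0 ?divr_ge0 ?(ltW p0) ?(ltW q0)//; lra.
  have pu0 : 0 < p ^+ 2 * u by rewrite mulr_gt0 ?exprn_gt0.
  have d0 : 0 < q ^+ 2 + u ^+ 2 by rewrite addr_gt0 ?exprn_gt0.
  have -> : q / p * ((u ^+ 2 / q ^+ 2 - 1) / (2 + (u ^+ 2 / q ^+ 2 - 1)))
     = q * (u ^+ 2 - q ^+ 2) / (p * (q ^+ 2 + u ^+ 2)).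
    by field; rewrite !gt_eqF//= (_ : 2 * q ^+ 2 + (u ^+ 2 - q ^+ 2) = q ^+ 2 + u ^+ 2)//; ring.
  rewrite /theta ler_pdivrMr// mulrAC ler_pdivlMr ?mulr_gt0//.
  apply: (@le_trans _ _ (p * q * (u - q) * (p * (q ^+ 2 + u ^+ 2)))).
    by rewrite ler_wpM2r ?mulr_ge0 ?(ltW p0) ?(ltW d0)// ler_wpM2r// subr_ge0.
  have -> : q * (u ^+ 2 - q ^+ 2) * (p ^+ 2 * u) = p * q * (u - q) * (p * ((u + q) * u)) by ring.
  rewrite ler_wpM2l ?mulr_ge0 ?subr_ge0 ?(ltW p0) ?(ltW q0)// ler_wpM2l ?(ltW p0)//; nra.
have z0 (u : R) : q <= u -> 0 <= u ^+ 2 / q ^+ 2 - 1.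
  move=> qu.
  by rewrite subr_ge0 ler_pdivlMr ?exprn_gt0// mul1r ler_sqr ?nnegrE// ltW// (lt_le_trans q0).
have := lerD (key r qr) (key r' qr').
have zr := z0 r qr; have zr' := z0 r' qr'.
have zz : (r ^+ 2 / q ^+ 2 - 1) + (r' ^+ 2 / q ^+ 2 - 1) = 2 * (p / q) ^+ 2.
  have -> : r' ^+ 2 = 2 * p ^+ 2 + 2 * q ^+ 2 - r ^+ 2 by lra.
  by field; rewrite gt_eqF.
move: zr zr' zz; set z := r ^+ 2 / q ^+ 2 - 1; set z' := r' ^+ 2 / q ^+ 2 - 1.
set x := p / q; have x0 : 0 < x by rewrite divr_gt0.
have x1 : x <= 1 by rewrite ler_pdivrMr// mul1r.
have -> : q / p = x^-1 by rewrite invf_div.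
move=> zr zr' zz /le_trans; apply.
have x2 : x ^+ 2 <= 1 by rewrite expr_le1// ltW.
(* Since v/(2 + v)^2 increases on [0, 2], one factor v stays linear and the rest is taken at v = 2
   x^2. Summing the linear factors gives (x/(1 + x^2))^2 <= 1/4. *)
have B (v : R) : 0 <= v -> v <= 2 * x ^+ 2 -> (v / (2 + v)) ^+ 2 <= v * (2 * x ^+ 2 / (2 + 2 * x ^+ 2) ^+ 2).
  move=> v0 vw; rewrite expr_div_n expr2 -mulrA ler_wpM2l//.
  by apply: square_frac_le => //; lra.
have b1 := B z zr ltac:(lra); have b2 := B z' zr' ltac:(lra).
rewrite -mulrDr; apply: (@le_trans _ _ (x^-1 ^+ 2 * (2 * x ^+ 2 * (2 * x ^+ 2 / (2 + 2 * x ^+ 2) ^+ 2)))).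
  by apply: ler_wpM2l; [exact: sqr_ge0|have := lerD b1 b2; rewrite -mulrDl zz].
have xs : 0 < 1 + x ^+ 2 by rewrite addr_gt0// exprn_gt0.
have -> : x^-1 ^+ 2 * (2 * x ^+ 2 * (2 * x ^+ 2 / (2 + 2 * x ^+ 2) ^+ 2)) = (x / (1 + x ^+ 2)) ^+ 2.
  by field; rewrite !gt_eqF//= (_ : 2 + 2 * x ^+ 2 = 2 * (1 + x ^+ 2)) ?mulr_gt0//; ring.
have : x / (1 + x ^+ 2) <= 1 / 2 by rewrite ler_pdivrMr//; have := sqr_ge0 (1 - x); lra.
have : 0 <= x / (1 + x ^+ 2) by rewrite divr_ge0// ltW.
by move=> t0 t1; have := ler_pM t0 t0 t1 t1; rewrite expr2; lra.
Qed.

(** * Lattice boxes *)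

Lemma sum_uniq_subset (R : numDomainType) (I : eqType) (r1 r2 : seq I) (F : I -> R) :
  uniq r1 -> uniq r2 -> {subset r1 <= r2} -> (forall i, i \in r2 -> 0 <= F i) ->
  \sum_(i <- r1) F i <= \sum_(i <- r2) F i.
Proof.
move=> u1 u2 sub F0.
rewrite [leRHS](bigID (mem r1))/= -[leRHS]addrC -[leLHS]add0r.
apply: lerD; first by rewrite big_seq_cond sumr_ge0// => i /andP[/F0].
rewrite -[leRHS]big_filter; rewrite le_eqVlt; apply/orP; left; apply/eqP.
apply/perm_big/uniq_perm => //; first exact: filter_uniq.
by move=> i; rewrite mem_filter; case: (boolP (i \in r1)) => // /sub ->.
Qed.

Definition irange (N : nat) : seq int := [seq k%:Z - N%:Z | k <- iota 0 N.*2.+1].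

(** Square boxes without the origin: symmetric under k -> -k, exhausting the lattice, and with
    (2N+1)^2 - 1 points, so that shells can be counted exactly. *)
Definition modes (N : nat) : seq freq :=
  [seq k <- [seq (i, j) | i <- irange N, j <- irange N] | k != 0].

Lemma mem_irange (N : nat) (i : int) : (i \in irange N) = (`|i| <= N)%N.
Proof.
apply/mapP/idP => [[k]|h].
  by rewrite mem_iota add0n => /andP[_ k1] ->; lia.
exists (absz (i + N%:Z)); last by lia.
by rewrite mem_iota add0n/=; lia.
Qed.

Lemma irange_uniq (N : nat) : uniq (irange N).
Proof. by rewrite map_inj_uniq ?iota_uniq// => i j; lia. Qed.

Definition msup (k : freq) : nat := maxn `|k.1| `|k.2|.

Lemma mem_modes (N : nat) (k : freq) : (k \in modes N) = (k != 0) && (msup k <= N)%N.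
Proof.
rewrite mem_filter; congr (_ && _); rewrite /msup geq_max.
apply/allpairsP/andP => [[[i j] [/= ii jj ->]]|[k1 k2]].
  by rewrite -!mem_irange.
by exists k; rewrite !mem_irange; case: k k1 k2.
Qed.

Lemma modes_uniq (N : nat) : uniq (modes N).
Proof.
apply: filter_uniq; apply: allpairs_uniq; rewrite ?irange_uniq//.
by move=> [i j] [i' j'].
Qed.

Lemma size_modes (N : nat) : ((size (modes N)).+1 = (N.*2.+1) ^ 2)%N.
Proof.
pose bx := [seq (i, j) | i <- irange N, j <- irange N].
have -> : (N.*2.+1 ^ 2 = size bx)%N.
  by rewrite size_allpairs !size_map !size_iota.
have ub : uniq bx by apply: allpairs_uniq; rewrite ?irange_uniq// => -[i j] [i' j'].
rewrite -(count_predC (fun k : freq => k != 0) bx) -size_filter -/(modes N) -addn1.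
congr addn; rewrite (eq_count (a2 := pred1 (0 : freq))); last by move=> k /=; rewrite negbK.
rewrite count_uniq_mem//; have -> //: (0 : freq) \in bx.
by apply/allpairsP; exists (0, 0); rewrite !mem_irange.
Qed.

Lemma modes_sub (N M : nat) : (N <= M)%N -> {subset modes N <= modes M}.
Proof. by move=> NM k; rewrite !mem_modes => /andP[-> /=] h; exact: leq_trans NM. Qed.

Lemma msupN (k : freq) : msup (- k) = msup k.
Proof. by rewrite /msup /= !abszN. Qed.

Lemma mem_modesN (N : nat) (k : freq) : (- k \in modes N) = (k \in modes N).
Proof. by rewrite !mem_modes msupN oppr_eq0. Qed.

Lemma sum_modes_opp (V : nmodType) (N : nat) (F : freq -> V) :
  \sum_(k <- modes N) F (- k) = \sum_(k <- modes N) F k.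
Proof.
rewrite -(big_map (fun k : freq => - k) xpredT F); apply/perm_big/uniq_perm.
- by rewrite map_inj_uniq ?modes_uniq//; exact: oppr_inj.
- exact: modes_uniq.
move=> k; apply/mapP/idP => [[j jN ->]|kN]; first by rewrite mem_modesN.
by exists (- k); rewrite ?opprK ?mem_modesN.
Qed.

(** * Euclidean geometry of lattice vectors and the lattice sum of 1/|k| *)

Section kabs_theory.
Variable R : realType.
Implicit Types j k l : freq.
Local Notation kabs := (@kabs R).

Lemma kabs_sqr k : kabs k ^+ 2 = k.1%:~R ^+ 2 + k.2%:~R ^+ 2.
Proof. by rewrite sqr_sqrtr// addr_ge0 ?sqr_ge0. Qed.

Lemma kabs_ge0 k : 0 <= kabs k.
Proof. exact: sqrtr_ge0. Qed.

Lemma kabs0 : kabs 0 = 0.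
Proof. by rewrite /Defs.kabs/= expr0n/= addr0 sqrtr0. Qed.

Lemma kabsN k : kabs (- k) = kabs k.
Proof. by rewrite /Defs.kabs/= !mulrNz !sqrrN. Qed.

Lemma msup_le_kabs k : (msup k)%:R <= kabs k.
Proof.
have h (i j : int) : `|i|%N%:R <= Num.sqrt (i%:~R ^+ 2 + j%:~R ^+ 2) :> R.
  have -> : `|i|%N%:R = `|i%:~R| :> R by rewrite natr_absz intr_norm.
  by rewrite -sqrtr_sqr ler_sqrt ?addr_ge0 ?sqr_ge0// lerDl sqr_ge0.
rewrite /msup /maxn; case: ifP => _; last exact: h.
by rewrite /Defs.kabs addrC; exact: h.
Qed.

Lemma msup_gt0 k : k != 0 -> (0 < msup k)%N.
Proof.
case: k => i j; rewrite /msup/= leq_max !absz_gt0 => ij.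
by apply: contraNT ij; rewrite negb_or !negbK => /andP[/eqP -> /eqP ->].
Qed.

Lemma kabs_ge1 k : k != 0 -> 1 <= kabs k.
Proof.
by move=> /msup_gt0 k0; apply: le_trans (msup_le_kabs k); rewrite ler1n.
Qed.

Lemma kabs_gt0 k : k != 0 -> 0 < kabs k.
Proof. by move=> /kabs_ge1; apply: lt_le_trans. Qed.

Definition kdot j k : R := j.1%:~R * k.1%:~R + j.2%:~R * k.2%:~R.
Definition cross j k : R := j.1%:~R * k.2%:~R - j.2%:~R * k.1%:~R.

Lemma kabsD_sqr j k : kabs (j + k) ^+ 2 = kabs j ^+ 2 + kabs k ^+ 2 + 2 * kdot j k.
Proof. by rewrite !kabs_sqr/= !intrD /kdot; ring. Qed.

Lemma lagrange_cross j k : cross j k ^+ 2 + kdot j k ^+ 2 = kabs j ^+ 2 * kabs k ^+ 2.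
Proof. by rewrite !kabs_sqr /cross /kdot; ring. Qed.

Lemma heron_cross j k : heron `|cross j k| (kabs j) (kabs k) (kabs (j + k)).
Proof.
rewrite /heron real_normK ?num_real// kabsD_sqr -lagrange_cross.
by field.
Qed.

Lemma cross_le j k : `|cross j k| <= kabs j * kabs k.
Proof.
rewrite -ler_sqr ?nnegrE ?mulr_ge0 ?kabs_ge0// real_normK ?num_real// exprMn.
by rewrite -lagrange_cross lerDl sqr_ge0.
Qed.

Lemma kdot_le j k : kdot j k <= kabs j * kabs k.
Proof.
apply: le_trans (ler_norm _) _.
rewrite -ler_sqr ?nnegrE ?mulr_ge0 ?kabs_ge0// real_normK ?num_real// exprMn.
by rewrite -lagrange_cross lerDr sqr_ge0.
Qed.

Lemma kabs_triangle j k : kabs (j + k) <= kabs j + kabs k.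
Proof.
rewrite -ler_sqr ?nnegrE ?addr_ge0 ?kabs_ge0// kabsD_sqr sqrrD.
have := kdot_le j k; rewrite -mulr_natl; lra.
Qed.

Lemma kabs_parallelogram j k :
  kabs (j + k) ^+ 2 + kabs (- j + k) ^+ 2 = 2 * kabs j ^+ 2 + 2 * kabs k ^+ 2.
Proof. by rewrite !kabsD_sqr kabsN /kdot/= !intrN; ring. Qed.

(** The shell [msup k = n] has 8 n points of weight 1/n and contributes 8; induction on N adds one
    shell. *)
Lemma sum_inv_msup (N : nat) : \sum_(k <- modes N) (msup k)%:R^-1 <= 8 * N%:R :> R.
Proof.
elim: N => [|N IHN].
  rewrite mulr0 big_seq big1// => k; rewrite mem_modes leqn0 => /andP[/msup_gt0].
rewrite (bigID (fun k => (msup k <= N)%N))/= -(natr1 N) mulrDr.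
apply: lerD.
  apply: le_trans IHN; rewrite -big_filter.
  apply: sum_uniq_subset; rewrite ?modes_uniq ?(filter_uniq _ (modes_uniq _))//.
  by move=> k; rewrite mem_filter !mem_modes => /andP[-> /andP[->]].
rewrite big_seq_cond.
under eq_bigr => k /andP[+ kN].
  rewrite mem_modes -ltnNge in kN * => /andP[_ kN1].
  have -> : msup k = N.+1 by apply/eqP; rewrite eqn_leq kN1.
over.
rewrite -big_seq_cond big_const_seq iter_addr_0 -[X in _ <= X](mulfK (_ : N.+1%:R != 0)) ?pnatr_eq0//.
rewrite -[leLHS]mulr_natl mulr1 ler_wpM2r ?invr_ge0//.
have -> : (count (fun k => ~~ (msup k <= N)%N) (modes N.+1) = 8 * N.+1)%N.
  have h1 : (count (fun k => (msup k <= N)%N) (modes N.+1) = size (modes N))%N.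
    rewrite -size_filter; apply/perm_size/uniq_perm; rewrite ?modes_uniq ?(filter_uniq _ (modes_uniq _))//.
    move=> k; rewrite mem_filter !mem_modes; case: (k != 0) => //=; last by rewrite andbF.
    by case: leqP => // h; rewrite (leq_trans h).
  have := count_predC (fun k => (msup k <= N)%N) (modes N.+1).
  have := size_modes N; have := size_modes N.+1.
  rewrite h1 -!addnn /= => e1 e2 e3.
  by move: e1 e2 e3; rewrite (eq_count (a2 := fun k => ~~ (msup k <= N)%N))//; nia.
by rewrite natrM.
Qed.

Lemma sum_inv_kabs (N : nat) (q : R) : 0 <= q ->
  \sum_(k <- modes N | kabs k <= q) (kabs k)^-1 <= 8 * q.
Proof.
move=> q0; set n := Num.truncn q.
apply: (@le_trans _ _ (8 * n%:R)); last first.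
  by rewrite ler_wpM2l// truncn_le.
apply: le_trans (sum_inv_msup n).
apply: (@le_trans _ _ (\sum_(k <- modes N | kabs k <= q) (msup k)%:R^-1)).
  rewrite big_seq_cond [leRHS]big_seq_cond; apply: ler_sum => k /andP[+ _].
  rewrite mem_modes => /andP[k0 _].
  by rewrite lef_pV2 ?posrE ?kabs_gt0 ?ltr0n ?msup_gt0// msup_le_kabs.
rewrite -big_filter; apply: sum_uniq_subset; rewrite ?modes_uniq ?(filter_uniq _ (modes_uniq _))//.
move=> k; rewrite mem_filter !mem_modes => /andP[kq /andP[-> _]]/=.
by rewrite truncn_ge_nat// (le_trans (msup_le_kabs k)).
Qed.

End kabs_theory.

(** * The energy estimate *)

Lemma normc_sqr (R : realType) (z : R[i]) : normc z ^+ 2 = Re z ^+ 2 + Im z ^+ 2.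
Proof. by case: z => x y /=; rewrite sqr_sqrtr// addr_ge0 ?sqr_ge0. Qed.

Lemma normc_ge0 (R : realType) (z : R[i]) : 0 <= normc z.
Proof. by case: z => x y /=; rewrite sqrtr_ge0. Qed.

Lemma normcJ (R : realType) (z : R[i]) : normc (conjc z) = normc z.
Proof. by case: z => x y /=; rewrite sqrrN. Qed.

Lemma Re_le_normc (R : realType) (z : R[i]) : `|Re z| <= normc z.
Proof.
rewrite -ler_sqr ?nnegrE ?normc_ge0// real_normK ?num_real// normc_sqr.
by rewrite lerDl sqr_ge0.
Qed.

Lemma Im_le_normc (R : realType) (z : R[i]) : `|Im z| <= normc z.
Proof.
rewrite -ler_sqr ?nnegrE ?normc_ge0// real_normK ?num_real// normc_sqr.
by rewrite lerDr sqr_ge0.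
Qed.

Lemma Re_realM (R : realType) (x : R) (z : R[i]) : Re (x%:C%C * z) = x * Re z.
Proof. by case: z => u v /=; rewrite mul0r subr0. Qed.

Lemma Im_realM (R : realType) (x : R) (z : R[i]) : Im (x%:C%C * z) = x * Im z.
Proof. by case: z => u v /=; rewrite mul0r addr0. Qed.

Lemma normc_real (R : realType) (x : R) : normc (x%:C%C : R[i]) = `|x|.
Proof. by rewrite /= expr0n/= addr0 sqrtr_sqr. Qed.

Lemma powR_sqr (R : realType) (x b : R) : (x `^ b) ^+ 2 = x `^ (2 * b).
Proof. by rewrite -powR_mulrn ?powR_ge0// -powRrM (mulrC b). Qed.

(** Symbol of the bilinear form R^perp f . grad g, where j is the frequency of f and l that of g;
    see [transport_expA]. *)
Definition csym (R : realType) (j l : freq) : R := cross R j l / kabs R j.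

Definition wexp (R : realType) (s psi : R) (k j l : freq) : R :=
  expR (psi * (kabs R k `^ s - kabs R j `^ s - kabs R l `^ s)).

(* The nonlinearity, truncated to modes N, in terms of e^{phi |k|^s} u_k; the weight
   wexp is what the multipliers e^{phi |k|^s} and Gamma leave behind when psi = phi - nu W. *)
Definition nlin (R : realType) (N : nat) (s psi : R) (U V : coefs R) : coefs R :=
  fun k => \sum_(j <- modes N | k - j \in modes N)
    (csym R j (k - j) * wexp s psi k j (k - j))%:C%C * (U j * V (k - j)).

Definition hsum (R : realType) (N : nat) (a : R) (U : coefs R) : R :=
  \sum_(k <- modes N) kabs R k `^ (2 * a) * normc (U k) ^+ 2.

(** * Sums over triads j + l + m = 0 and their symmetrisation *)

Section tsum.
Variables (R : realType) (N : nat).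
Implicit Types F G : freq -> freq -> freq -> R.

Definition tsum F : R :=
  \sum_(j <- modes N) \sum_(l <- modes N) \sum_(m <- modes N)
    if j + l + m == 0 then F j l m else 0.

Lemma tsum12 F : tsum F = tsum (fun j l m => F l j m).
Proof.
rewrite /tsum exchange_big/=; apply: eq_bigr => j _; apply: eq_bigr => l _.
by apply: eq_bigr => m _; rewrite (addrC l).
Qed.

Lemma tsum23 F : tsum F = tsum (fun j l m => F j m l).
Proof.
rewrite /tsum; apply: eq_bigr => j _; rewrite exchange_big/=.
by apply: eq_bigr => l _; apply: eq_bigr => m _; rewrite addrAC.
Qed.

Lemma tsumD F G : tsum F + tsum G = tsum (fun j l m => F j l m + G j l m).
Proof.
rewrite /tsum -big_split; apply: eq_bigr => j _; rewrite -big_split; apply: eq_bigr => l _.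
by rewrite -big_split; apply: eq_bigr => m _; case: ifP; rewrite /= ?addr0.
Qed.

Lemma tsumZ c F : tsum (fun j l m => c * F j l m) = c * tsum F.
Proof.
rewrite /tsum mulr_sumr; apply: eq_bigr => j _; rewrite mulr_sumr; apply: eq_bigr => l _.
by rewrite mulr_sumr; apply: eq_bigr => m _; case: ifP; rewrite ?mulr0.
Qed.

Lemma tsum_perm F : 6 * tsum F = tsum (fun j l m =>
  F j l m + F l j m + F j m l + F l m j + F m j l + F m l j).
Proof.
rewrite -!tsumD -!/(tsum _).
have e1 := tsum12 F; have e2 := tsum23 F.
have e3 := tsum12 (fun j l m => F j m l).
have e4 := tsum23 (fun j l m => F l j m).
have e5 := tsum12 (fun j l m => F m j l).
rewrite /= in e1 e2 e3 e4 e5.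
by rewrite -e5 -e4 -e3 -e2 -e1; ring.
Qed.

Lemma le_tsum F G :
  (forall j l m, j \in modes N -> l \in modes N -> m \in modes N ->
    j + l + m = 0 -> F j l m <= G j l m) ->
  tsum F <= tsum G.
Proof.
move=> FG; rewrite /tsum big_seq [leRHS]big_seq; apply: ler_sum => j jN.
rewrite big_seq [leRHS]big_seq; apply: ler_sum => l lN.
rewrite big_seq [leRHS]big_seq; apply: ler_sum => m mN.
by case: ifP => // /eqP; exact: FG.
Qed.

Lemma norm_tsum F : `|tsum F| <= tsum (fun j l m => `|F j l m|).
Proof.
rewrite /tsum; apply: le_trans (ler_norm_sum _ _ _) _; apply: ler_sum => j _.
apply: le_trans (ler_norm_sum _ _ _) _; apply: ler_sum => l _.
apply: le_trans (ler_norm_sum _ _ _) _; apply: ler_sum => m _.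
by case: ifP => //; rewrite normr0.
Qed.

Lemma tsum_third F : tsum F =
  \sum_(j <- modes N) \sum_(l <- modes N | j + l \in modes N) F j l (- (j + l)).
Proof.
rewrite /tsum; apply: eq_bigr => j _; rewrite [RHS]big_mkcond; apply: eq_bigr => l _.
rewrite -big_mkcond/=; case: ifP => jl.
  rewrite (eq_bigl (fun m => m == - (j + l))) => [|m]; last by rewrite addrC addr_eq0.
  by rewrite -big_filter filter_pred1_uniq ?modes_uniq ?mem_modesN// big_seq1.
rewrite big_seq_cond big1// => m /andP[mN]; rewrite addrC addr_eq0 => /eqP mE.
by move: mN; rewrite mE mem_modesN jl.
Qed.

Lemma tsum_le_third F : (forall j l m, 0 <= F j l m) ->
  tsum F <= \sum_(j <- modes N) \sum_(l <- modes N) F j l (- (j + l)).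
Proof.
move=> F0; rewrite tsum_third; apply: ler_sum => j _; rewrite big_mkcond/=.
by apply: ler_sum => l _; case: ifP.
Qed.
End tsum.

Lemma sum3_perms (R : comPzRingType) (x y z : R) : [/\ x + y + z = y + x + z,
  x + y + z = x + z + y, x + y + z = y + z + x, x + y + z = z + x + y &
  x + y + z = z + y + x].
Proof. by split; ring. Qed.

(** One of the six orders is sorted, and ties only add nonnegative terms. This lets a
    permutation-invariant summand be replaced by its restriction to sorted triads. *)
Lemma le_sorted_perms (R : realDomainType) (x y z h : R) : 0 <= h ->
  let f x y z := if (x <= y) && (y <= z) then h else 0 in
  is_true (h <= f x y z + f y x z + f x z y + f y z x + f z x y + f z y x).
Proof.
move=> h0 f.
have f0 u v w : 0 <= f u v w by rewrite /f; case: ifP.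
have f1 u v w : u <= v -> v <= w -> f u v w = h by rewrite /f => -> ->.
have := f0 x y z; have := f0 y x z; have := f0 x z y; have := f0 y z x.
have := f0 z x y; have := f0 z y x.
case: (leP x y) => [xy|/ltW yx]; case: (leP y z) => [yz|/ltW zy];
  case: (leP x z) => [xz|/ltW zx]; last first;
  try (rewrite (f1 x y z)//; lra); try (rewrite (f1 y x z)//; lra);
  try (rewrite (f1 x z y)//; lra); try (rewrite (f1 y z x)//; lra);
  try (rewrite (f1 z x y)//; lra); rewrite (f1 z y x)//; lra.
Qed.

(** * The trilinear estimate with constant 1 *)

Section energy_trilinear.
Variables (R : realType) (N : nat) (s a psi : R) (U : coefs R).
Hypotheses (hs0 : 1 / 2 < s) (hs1 : s <= 1) (ha1 : 1 < a) (ha2 : a < 2 * s).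
Hypothesis hpsi : 0 <= psi.
Hypothesis hU : forall k, U (- k) = conjc (U k).
Implicit Types j k l m : freq.
Local Notation kabs := (@kabs R).

(** The coefficient left after adding the six permutations of a triad. It is antisymmetric, as is
    the cross product, so the modulus of their product is permutation invariant and only sorted
    triads have to be estimated. *)
Definition triad_Q (p q r : R) : R :=
  let W := triad_w s a psi (p `^ s + q `^ s + r `^ s) in
  (W r - W q) / p + (W p - W r) / q + (W q - W p) / r.

Lemma triad_Q12 p q r : triad_Q q p r = - triad_Q p q r.
Proof. by rewrite /triad_Q (addrC (q `^ s)); move: (triad_w _ _ _ _) => W /=; ring. Qed.

Lemma triad_Q23 p q r : triad_Q p r q = - triad_Q p q r.
Proof. by rewrite /triad_Q (addrAC (p `^ s)); move: (triad_w _ _ _ _) => W /=; ring. Qed.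

Let rho j l m : R := Re (U m * (U j * U l)).
Let G j l m : R := kabs m `^ (2 * a) * (csym R j l * wexp s psi m j l * rho j l m).

(** Reality of U turns the conjugate at the output frequency -m into U_m, so the pairing becomes a
    sum over triads of zero sum. *)
Lemma trilinear_tsum :
  \sum_(k <- modes N) kabs k `^ (2 * a) * Re (conjc (U k) * nlin N s psi U U k)
  = tsum N G.
Proof.
have -> : tsum N G = tsum N (fun j l m => G l m j).
  by rewrite tsum23 tsum12.
rewrite tsum_third -[LHS]sum_modes_opp; apply: eq_bigr => k _.
rewrite kabsN hU conjcK /nlin mulr_sumr raddf_sum mulr_sumr.
apply: eq_big => [j|j _].
  by rewrite -mem_modesN opprB opprK addrC.
by rewrite [U k * _]mulrCA [LHS]/= Re_realM /G /rho /wexp kabsN opprD.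
Qed.

Lemma cross_swap j l : cross R l j = - cross R j l.
Proof. by rewrite /cross; ring. Qed.

Lemma cross_third j l m : j + l + m = 0 -> cross R l m = cross R j l.
Proof.
move=> e; have -> : m = - (j + l) by apply/eqP; rewrite -addr_eq0 addrC e.
by rewrite /cross/= !intrN !intrD; ring.
Qed.

Let H j l m : R := `|cross R j l| * `|triad_Q (kabs j) (kabs l) (kabs m)| * `|rho j l m|.

Lemma rho12 j l m : rho l j m = rho j l m.
Proof. by rewrite /rho (mulrC (U l)). Qed.

Lemma rho23 j l m : rho j m l = rho j l m.
Proof. by rewrite /rho; congr Re; ring. Qed.

Lemma G_weight j l m S : S = kabs j `^ s + kabs l `^ s + kabs m `^ s ->
  G j l m = triad_w s a psi S (kabs m) * (cross R j l / kabs j) * rho j l m.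
Proof.
move=> ->; rewrite /G /triad_w /csym /wexp.
have -> : kabs m `^ s - kabs j `^ s - kabs l `^ s =
    2 * kabs m `^ s - (kabs j `^ s + kabs l `^ s + kabs m `^ s).
  by move: (_ `^ _) (_ `^ _) (_ `^ _) => u v w; ring.
by move: (cross R j l / kabs j) (kabs m `^ (2 * a)) (rho j l m) (expR _) => c A r E; ring.
Qed.

(** The product of the three coefficients is symmetric, and the cross product of any two sides of
    the triangle is the same up to sign; only the factors 1/|j| and the weights change with the
    permutation. *)
Lemma G_symm j l m : j + l + m = 0 ->
  G j l m + G l j m + G j m l + G l m j + G m j l + G m l j
  = cross R j l * triad_Q (kabs j) (kabs l) (kabs m) * rho j l m.
Proof.
move=> e; have c1 := cross_third e.
have c2 : cross R m j = cross R j l by rewrite (@cross_third l m j) ?c1// addrC addrA.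
have [S2 S3 S4 S5 S6] := sum3_perms (kabs j `^ s) (kabs l `^ s) (kabs m `^ s).
rewrite (G_weight (erefl : _ = kabs j `^ s + kabs l `^ s + kabs m `^ s)).
rewrite (G_weight S2) (G_weight S3) (G_weight S4) (G_weight S5) (G_weight S6).
have -> : rho l j m = rho j l m by exact: rho12.
have -> : rho j m l = rho j l m by exact: rho23.
have -> : rho l m j = rho j l m by rewrite rho23 rho12.
have -> : rho m j l = rho j l m by rewrite rho12 rho23.
have -> : rho m l j = rho j l m by rewrite rho12 rho23 rho12.
rewrite (cross_swap j l) (cross_swap m j) (cross_swap l m) c1 c2 /triad_Q.
move: (triad_w s a psi _) (rho j l m) (cross R j l) => W r c /=; ring.
Qed.

Let sorted j l m := (kabs j <= kabs l) && (kabs l <= kabs m).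

Lemma H12 j l m : j + l + m = 0 -> H l j m = H j l m.
Proof. by move=> e; rewrite /H cross_swap triad_Q12 rho12 !normrN. Qed.

Lemma H23 j l m : j + l + m = 0 -> H j m l = H j l m.
Proof.
move=> e; rewrite /H triad_Q23 rho23 !normrN.
have e' : m + j + l = 0 by rewrite -addrA addrC.
by rewrite (cross_swap m j) (cross_third e') normrN.
Qed.

Lemma H_le_sorted j l m : j + l + m = 0 ->
  H j l m <= let Hs j l m := if sorted j l m then H j l m else 0 in
    Hs j l m + Hs l j m + Hs j m l + Hs l m j + Hs m j l + Hs m l j.
Proof.
move=> e /=; have H0 u v w : 0 <= H u v w by rewrite !mulr_ge0.
have e23 : j + m + l = 0 by rewrite addrAC.
have e12 : l + j + m = 0 by rewrite (addrC l).
have h1 := H12 e; have h2 := H23 e.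
have h3 : H l m j = H j l m by rewrite (H23 e12) h1.
have h4 : H m j l = H j l m by rewrite (H12 e23) h2.
have e23' : l + m + j = 0 by rewrite addrAC.
have h5 : H m l j = H j l m by rewrite (H12 e23') h3.
rewrite h1 h2 h3 h4 h5; exact: (le_sorted_perms _ _ _ (H0 j l m)).
Qed.

Let f j := kabs j `^ a * normc (U j).
Let g j := kabs j `^ (a + s) * normc (U j).
Let K j l := theta `|cross R j l| (kabs j) (kabs l) (kabs (j + l))
             * Num.sqrt (2 / (kabs j * kabs l)).

Lemma H_bound j l m : j != 0 -> l != 0 -> m != 0 -> j + l + m = 0 -> sorted j l m ->
  H j l m <= K j l * g l * (f j * g m).
Proof.
move=> j0 l0 m0 e /andP[pq qr].
have mE : kabs (j + l) = kabs m.
  by rewrite -(kabsN _ m); congr Defs.kabs; apply/eqP; rewrite -addr_eq0 e.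
have rpq : kabs m <= kabs j + kabs l by rewrite -mE kabs_triangle.
have hy : triad_hyp s a (kabs j) (kabs l) (kabs m).
  by split; split => //; exact: kabs_ge1.
have := triad_bound hy hpsi.
rewrite /H /K mE /theta /f /g /triad_Q.
have p0 := kabs_gt0 R j0; have q0 := kabs_gt0 R l0; have r0 := kabs_gt0 R m0.
have hr : `|rho j l m| <= normc (U j) * normc (U l) * normc (U m).
  apply: le_trans (Re_le_normc _) _.
  by rewrite !normcM mulrC.
have n0 : 0 <= normc (U j) * normc (U l) * normc (U m) by rewrite !mulr_ge0 ?normc_ge0.
have c0 := normr_ge0 (cross R j l).
move: (triad_w s a psi _) hr c0 => W.
set M := Num.sqrt _.
move: (kabs j `^ a) (kabs l `^ (a + s)) (kabs m `^ (a + s)) => Pj Pl Pm.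
move: p0 q0 r0 n0; move: (`|cross R j l|) (kabs j) (kabs l) (kabs m) M.
move: (normc (U j)) (normc (U l)) (normc (U m)) (rho j l m).
move=> nj nl nm r c p q t M p0 q0 t0 n0 hr c0 h.
have Qe : (W t - W q) / p + (W p - W t) / q + (W q - W p) / t =
   (p^-1 - q^-1) * (W t - W q) - (q^-1 - t^-1) * (W q - W p) by ring.
rewrite Qe; set Q := _ - _ in h *.
have pt0 : 0 < p ^+ 2 * t by rewrite mulr_gt0// exprn_gt0.
have -> : c * (t - q) / (p ^+ 2 * t) * M * (Pl * nl) * (Pj * nj * (Pm * nm))
  = c * ((t - q) * (M * (Pj * Pl * Pm)) / (p ^+ 2 * t)) * (nj * nl * nm) by ring.
apply: ler_pM => //; first by rewrite mulr_ge0.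
by rewrite ler_wpM2l// ler_pdivlMr.
Qed.

Lemma sum_K_le l : l != 0 ->
  \sum_(j <- modes N) (if sorted j l (- (j + l)) then K j l ^+ 2 else 0) <= 2.
Proof.
move=> l0; have q0 := kabs_gt0 R l0.
set A := fun j => if sorted j l (- (j + l)) then K j l ^+ 2 else 0.
(* Averaging over j and -j brings in [theta_pair]. Each pair gives 1/4 * 2/(|j| |l|), and the
   lattice sum 8 |l| leads to 1/2 * 1/(2 |l|) * 8 |l| = 2. *)
have -> : \sum_(j <- modes N) A j = 1 / 2 * \sum_(j <- modes N) (A j + A (- j)).
  by rewrite big_split/= sum_modes_opp; field.
have key j : j \in modes N -> A j + A (- j) <=
    1 / (2 * kabs l) * if kabs j <= kabs l then (kabs j)^-1 else 0.
  rewrite mem_modes => /andP[j0 _]; have p0 := kabs_gt0 R j0.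
  rewrite /A /sorted !kabsN; case: (leP (kabs j) (kabs l)) => pq /=; last by rewrite addr0 mulr0.
  have M0 : 0 <= 2 / (kabs j * kabs l) by rewrite divr_ge0// mulr_ge0// ltW.
  have cN : `|cross R (- j) l| = `|cross R j l|.
    by rewrite -normrN /cross/= !mulrNz; congr `|_|; ring.
  have KE i : kabs i = kabs j -> K i l ^+ 2 =
      theta `|cross R i l| (kabs j) (kabs l) (kabs (i + l)) ^+ 2 * (2 / (kabs j * kabs l)).
    by move=> ij; rewrite /K ij exprMn sqr_sqrtr.
  rewrite (KE j erefl) (KE (- j) (kabsN _ _)) cN.
  have hj := heron_cross R j l.
  have hj' := heron_cross R (- j) l; rewrite cN kabsN in hj'.
  have tj := kabs_triangle R j l.
  have tj' := kabs_triangle R (- j) l; rewrite kabsN in tj'.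
  have -> : 1 / (2 * kabs l) * (kabs j)^-1 = 1 / 4 * (2 / (kabs j * kabs l)).
    by field; rewrite !gt_eqF.
  case: (leP (kabs l) (kabs (j + l))) => r1; case: (leP (kabs l) (kabs (- j + l))) => r2.
  - rewrite -mulrDl ler_wpM2r//; apply: theta_pair => //; first exact: cross_le.
    exact: kabs_parallelogram.
  - by rewrite addr0 ler_wpM2r//; apply: theta_le_half.
  - by rewrite add0r ler_wpM2r//; apply: theta_le_half.
  - by rewrite addr0 mulr_ge0.
apply: (@le_trans _ _ (1 / 2 * \sum_(j <- modes N)
    (1 / (2 * kabs l) * if kabs j <= kabs l then (kabs j)^-1 else 0))).
  by rewrite ler_wpM2l// big_seq [leRHS]big_seq; apply: ler_sum => j; exact: key.
rewrite -mulr_sumr -big_mkcond/=.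
have c0 : 0 <= 1 / 2 * (1 / (2 * kabs l)) by rewrite mulr_ge0// divr_ge0// mulr_ge0// ltW.
rewrite [leLHS]mulrA; apply: le_trans (ler_wpM2l c0 (sum_inv_kabs N (ltW q0))) _.
by rewrite le_eqVlt; apply/orP; left; apply/eqP; field; rewrite gt_eqF.
Qed.

Lemma f_sqr j : f j ^+ 2 = kabs j `^ (2 * a) * normc (U j) ^+ 2.
Proof. by rewrite /f exprMn powR_sqr. Qed.

Lemma g_sqr j : g j ^+ 2 = kabs j `^ (2 * (a + s)) * normc (U j) ^+ 2.
Proof. by rewrite /g exprMn powR_sqr. Qed.

Lemma sum_fg_le :
  \sum_(j <- modes N) \sum_(m <- modes N)
    (if sorted j (- (j + m)) m then f j ^+ 2 * g m ^+ 2 else 0)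
  <= 1 / 2 * (hsum N a U * hsum N (a + s) U).
Proof.
set A := fun j m => if sorted j (- (j + m)) m then f j ^+ 2 * g m ^+ 2 else 0.
have -> : \sum_(j <- modes N) \sum_(m <- modes N) A j m =
   1 / 2 * \sum_(j <- modes N) \sum_(m <- modes N) (A j m + A (- j) m).
  under [in RHS]eq_bigr do rewrite big_split/=.
  by rewrite big_split/= (sum_modes_opp N (fun j => \sum_(m <- modes N) A j m)); field.
rewrite ler_wpM2l// /hsum mulr_suml big_seq [leRHS]big_seq; apply: ler_sum => j.
rewrite mem_modes => /andP[j0 _]; have p0 := kabs_gt0 R j0.
rewrite mulr_sumr; apply: ler_sum => m _.
rewrite -f_sqr -g_sqr /A.
have -> : f (- j) = f j by rewrite /f kabsN hU normcJ.
have F0 : 0 <= f j ^+ 2 * g m ^+ 2 by rewrite mulr_ge0 ?sqr_ge0.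
rewrite /sorted !kabsN.
case: ifP => [/andP[_ h1]|_]; case: ifP => [/andP[_ h2]|_]; rewrite ?addr0 ?add0r//.
(* If j and -j both qualified, |j + m| and |-j + m| would be at most |m|, against the parallelogram
   law since |j| > 0. *)
exfalso.
have := kabs_parallelogram R j m.
rewrite -ler_sqr ?nnegrE ?kabs_ge0// in h1; rewrite -ler_sqr ?nnegrE ?kabs_ge0// in h2.
have : 0 < kabs j ^+ 2 by rewrite exprn_gt0.
move: h1 h2; move: (kabs _ ^+ 2) (kabs _ ^+ 2) (kabs _ ^+ 2) (kabs _ ^+ 2) => x y z t; lra.
Qed.

Lemma energy_trilinear :
  `|\sum_(k <- modes N) kabs k `^ (2 * a) * Re (conjc (U k) * nlin N s psi U U k)|
  <= Num.sqrt (hsum N a U) * hsum N (a + s) U.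
Proof.
rewrite trilinear_tsum; set F2 := hsum N a U; set G2 := hsum N (a + s) U.
have F20 : 0 <= F2 by rewrite sumr_ge0// => k _; rewrite mulr_ge0 ?powR_ge0 ?sqr_ge0.
have G20 : 0 <= G2 by rewrite sumr_ge0// => k _; rewrite mulr_ge0 ?powR_ge0 ?sqr_ge0.
pose Hs j l m := if sorted j l m then H j l m else 0.
have s1 : `|tsum N G| <= tsum N Hs.
  rewrite -(ler_pM2l (_ : 0 < 6))//.
  rewrite -{1}(ger0_norm (_ : 0 <= 6))// -normrM !tsum_perm.
  apply: le_trans (norm_tsum _ _) _; apply: le_tsum => j l m _ _ _ e.
  apply: le_trans (H_le_sorted e) => /=; rewrite G_symm// /H.
  by rewrite -!normrM.
(* Cauchy-Schwarz in the form of Young's inequality with a free parameter. The optimum lam =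
   sqrt(F2)/2 may vanish, so it is approached below through (S + d)/2. *)
have s2 lam : 0 < lam -> tsum N Hs <= lam * G2 + (4 * lam)^-1 * (F2 * G2).
  move=> lam0.
  apply: (@le_trans _ _ (tsum N (fun j l m =>
     lam / 2 * (if sorted j l m then K j l ^+ 2 * g l ^+ 2 else 0) +
     (2 * lam)^-1 * (if sorted j l m then f j ^+ 2 * g m ^+ 2 else 0)))).
    apply: le_tsum => j l m; rewrite !mem_modes => /andP[j0 _] /andP[l0 _] /andP[m0 _] e.
    rewrite /Hs; case: ifP => srt; last by rewrite !mulr0 addr0.
    apply: le_trans (H_bound j0 l0 m0 e srt) _.
    rewrite -!exprMn; move: (K j l * g l) (f j * g m) => u v.
    have -> : lam / 2 * u ^+ 2 + (2 * lam)^-1 * v ^+ 2 =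
      u * v + (lam * u - v) ^+ 2 / (2 * lam) by field; rewrite gt_eqF.
    by rewrite lerDl divr_ge0 ?sqr_ge0// mulr_ge0// ltW.
  rewrite -tsumD !tsumZ; apply: lerD.
    have -> : lam * G2 = lam / 2 * (2 * G2) by field.
    rewrite ler_wpM2l ?divr_ge0 ?(ltW lam0)//.
    apply: le_trans (tsum_le_third _ _) _ => [j l m|].
      by case: ifP => // _; rewrite mulr_ge0 ?sqr_ge0.
    rewrite exchange_big/= /G2 /hsum mulr_sumr big_seq [leRHS]big_seq.
    apply: ler_sum => l; rewrite mem_modes => /andP[l0 _].
    rewrite -g_sqr; apply: le_trans (ler_wpM2r (sqr_ge0 (g l)) (sum_K_le l0)).
    rewrite mulr_suml; apply: ler_sum => j _.
    by case: ifP; rewrite ?mul0r.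
  have -> : (4 * lam)^-1 * (F2 * G2) = (2 * lam)^-1 * (1 / 2 * (F2 * G2)).
    by field; rewrite gt_eqF.
  rewrite ler_wpM2l ?invr_ge0 ?mulr_ge0 ?(ltW lam0)//.
  rewrite tsum23; apply: le_trans (tsum_le_third _ _) _ => [j l m|].
    by case: ifP => // _; rewrite mulr_ge0 ?sqr_ge0.
  exact: sum_fg_le.
apply: (le_trans s1); apply/ler_addgt0Pr => e e0.
have G21 : 0 < G2 + 1 by rewrite ltr_wpDl.
set S := Num.sqrt F2; have S0 : 0 <= S by exact: sqrtr_ge0.
have SE : F2 = S ^+ 2 by rewrite sqr_sqrtr.
pose d := e / (G2 + 1); have d0 : 0 < d by rewrite divr_gt0.
have Sd : 0 < S + d by rewrite ltr_wpDl.
have := s2 ((S + d) / 2) _; rewrite divr_gt0// => /(_ isT)/le_trans; apply.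
have h1 : (4 * ((S + d) / 2))^-1 * (F2 * G2) <= S / 2 * G2.
  rewrite [leLHS]mulrA; apply: ler_wpM2r => //; rewrite {1}SE.
  have -> : (4 * ((S + d) / 2))^-1 * S ^+ 2 = S / 2 * (S / (S + d)).
    by field; rewrite gt_eqF.
  by rewrite ler_piMr ?divr_ge0// ler_pdivrMr// mul1r lerDl ltW.
have h2 : d * G2 <= e.
  by rewrite /d mulrAC ler_pdivrMr// ler_wpM2l ?(ltW e0)// lerDl.
apply: le_trans (lerD (lexx _) h1) _.
have -> : (S + d) / 2 * G2 + S / 2 * G2 = S * G2 + d * G2 / 2 by field.
by rewrite lerD2l ler_pdivrMr//; apply: le_trans h2 _; rewrite ler_pMr// ler1n.
Qed.
End energy_trilinear.

(** * Differential inequalities on a half-line *)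

(** Functions of time are extended to t < 0 by their value at 0, which destroys differentiability at
    0 but not continuity; hence the derivative is required for t > 0 only. *)
Definition ders (R : realType) (f df : R -> R) : Prop :=
  continuous f /\ forall t : R, 0 < t -> is_derive t (1 : R) f (df t).

Section ders_theory.
Variable R : realType.
Implicit Types f g df dg : R -> R.

Lemma ders_cst (c : R) : ders (fun=> c) (fun=> 0).
Proof. by split=> [t|t _]; [exact: cst_continuous|exact: is_derive_cst]. Qed.

Lemma ders_id : ders (@id R) (fun=> 1).
Proof. by split=> [t|t _]; [exact: cvg_id|exact: is_derive_id]. Qed.

Lemma ders_ext f df dg : ders f df -> (forall t, 0 < t -> df t = dg t) -> ders f dg.
Proof. by move=> [cf hf] e; split=> // t t0; rewrite -e//; exact: hf. Qed.

Lemma ders_add f df g dg : ders f df -> ders g dg ->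
  ders (fun t => f t + g t) (fun t => df t + dg t).
Proof.
move=> [cf hf] [cg hg]; split=> [t|t t0]; first by apply: cvgD; [exact: cf|exact: cg].
exact: (is_deriveD (hf t t0) (hg t t0)).
Qed.

Lemma ders_opp f df : ders f df -> ders (fun t => - f t) (fun t => - df t).
Proof.
move=> [cf hf]; split=> [t|t t0]; first by apply: cvgN; exact: cf.
exact: (is_deriveN (hf t t0)).
Qed.

Lemma ders_sub f df g dg : ders f df -> ders g dg ->
  ders (fun t => f t - g t) (fun t => df t - dg t).
Proof. by move=> hf hg; apply: ders_add => //; exact: ders_opp. Qed.

Lemma ders_mul f df g dg : ders f df -> ders g dg ->
  ders (fun t => f t * g t) (fun t => df t * g t + f t * dg t).
Proof.
move=> [cf hf] [cg hg]; split=> [t|t t0]; first by apply: cvgM; [exact: cf|exact: cg].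
have := is_deriveM (hf t t0) (hg t t0).
have -> // : f t *: dg t + g t *: df t = df t * g t + f t * dg t.
by rewrite addrC /GRing.scale/= mulrC.
Qed.

Lemma ders_scale (c : R) f df : ders f df -> ders (fun t => c * f t) (fun t => c * df t).
Proof.
move=> hf; apply: ders_ext (ders_mul (ders_cst c) hf) _ => t _.
by rewrite mul0r add0r.
Qed.

Lemma ders_sqr f df : ders f df -> ders (fun t => f t ^+ 2) (fun t => 2 * (f t * df t)).
Proof.
move=> hf; rewrite (_ : (fun t => f t ^+ 2) = fun t => f t * f t)//.
by apply: ders_ext (ders_mul hf hf) _ => t _; ring.
Qed.

Lemma ders_sum (I : Type) (r : seq I) (P : pred I) (f df : I -> R -> R) :
  (forall i, P i -> ders (f i) (df i)) ->
  ders (fun t => \sum_(i <- r | P i) f i t) (fun t => \sum_(i <- r | P i) df i t).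
Proof.
move=> h; elim: r => [|i r IH].
  under eq_fun do rewrite big_nil; under [X in ders _ X]eq_fun do rewrite big_nil.
  exact: ders_cst.
under eq_fun do rewrite big_cons; under [X in ders _ X]eq_fun do rewrite big_cons.
by case: (boolP (P i)) => // Pi; apply: ders_add => //; exact: h.
Qed.

Lemma ders_expR (c d : R) :
  ders (fun t => expR (c + d * t)) (fun t => d * expR (c + d * t)).
Proof.
have h : ders (fun t : R => c + d * t) (fun=> d).
  apply: ders_ext (ders_add (ders_cst c) (ders_scale d ders_id)) _ => t _.
  by rewrite add0r mulr1.
split=> [t|t t0].
  by apply: continuous_comp; [exact: h.1|exact: continuous_expR].
have := @is_derive1_comp R expR (fun t => c + d * t) t _ _ (is_derive_expR _) (h.2 t t0).
by rewrite mulrC.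
Qed.

Lemma ders_nincr f df : ders f df -> (forall t, 0 < t -> df t <= 0) ->
  forall t u, 0 <= t -> t <= u -> f u <= f t.
Proof.
move=> [cf hf] h t u t0; rewrite le_eqVlt => /predU1P[->//|tu].
have hf' (x : R) : x \in `]t, u[ -> is_derive x (1 : R) f (df x).
  by move=> xtu; apply: hf; apply: le_lt_trans t0 _; rewrite (itvP xtu).
have [c ctu e] := MVT tu hf' (continuous_subspaceT cf).
 rewrite -subr_le0 e pmulr_lle0 ?subr_gt0//.
by apply: h; apply: le_lt_trans t0 _; rewrite (itvP ctu).
Qed.

Lemma ders_le f df g dg : ders f df -> ders g dg ->
  (forall t, 0 < t -> df t <= dg t) ->
  forall t, 0 <= t -> f t - f 0 <= g t - g 0.
Proof.
move=> hf hg h t t0.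
have d0 u : 0 < u -> df u - dg u <= 0 by rewrite subr_le0; exact: h.
by have := ders_nincr (ders_sub hf hg) d0 (lexx 0) t0; lra.
Qed.

Lemma ders_norm_le f df g dg : ders f df -> ders g dg -> f 0 = 0 -> 0 <= g 0 ->
  (forall t, 0 < t -> `|df t| <= dg t) ->
  forall t, 0 <= t -> `|f t| <= g t.
Proof.
move=> hf hg f0 g0 h t t0; rewrite ler_norml; apply/andP; split.
  have := ders_le (ders_opp hf) hg _ t0; rewrite f0 oppr0.
  have hh u : 0 < u -> - df u <= dg u.
    by move=> u0; apply: le_trans (h u u0); rewrite -normrN ler_norm.
  by move=> /(_ hh); lra.
have := ders_le hf hg _ t0; rewrite f0.
have hh u : 0 < u -> df u <= dg u.
  by move=> u0; apply: le_trans (h u u0); rewrite ler_norm.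
by move=> /(_ hh); lra.
Qed.

Lemma ders_unique0 f : ders f (fun=> 0) -> forall t, 0 <= t -> f t = f 0.
Proof.
move=> hf t t0; apply/eqP; rewrite eq_le.
rewrite (ders_nincr hf _ (lexx 0) t0)//=.
have N0 (u : R) : 0 < u -> - 0 <= 0 :> R by rewrite oppr0.
by have := ders_nincr (ders_opp hf) N0 (lexx 0) t0; rewrite lerN2.
Qed.

(** The integral of f over [0, max t 0]. Integrating from -1 makes 0 an interior point for the
    fundamental theorem, and the maximum freezes the primitive at negative times. *)
Definition prim f (t : R) : R :=
  let A x := \int[@lebesgue_measure R]_(u in `[-1, x]) f u in
  A (Num.max t 0) - A 0.

Lemma ders_prim f : continuous f -> ders (prim f) f.
Proof.
move=> cf; pose A (x : R) := \int[@lebesgue_measure R]_(u in `[(-1 : R), x]) f u.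
have dA (x : R) : -1 < x -> is_derive x (1 : R) A (f x).
  move=> x1; have xx : x < x + 1 by rewrite ltrDl.
  have intf : (@lebesgue_measure R).-integrable `[(-1 : R), x + 1] (EFin \o f).
    apply: continuous_compact_integrable; first exact: segment_compact.
    exact: continuous_subspaceT.
  have [dF <-] := continuous_FTC1_closed xx intf x1 (cf x).
  by apply: DeriveDef; [exact: dF|rewrite -derive1E].
have m0 (x : R) : -1 < Num.max x 0 by rewrite lt_max ltrN10 orbT.
split=> [t|t t0].
  apply: cvgB; last exact: cvg_cst.
  apply: (@continuous_comp _ _ _ (fun x : R => Num.max x 0) A).
    by apply: continuous_max; [exact: cvg_id|exact: cst_continuous].
  apply: differentiable_continuous; apply/derivable1_diffP.
  by have [] := dA _ (m0 t).
have h : is_derive t (1 : R) (fun u => A u - A 0) (f t).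
  have := is_deriveB (dA t (lt_trans (ltrN10 R) t0)) (is_derive_cst (A 0) t (1 : R)).
  by rewrite subr0.
apply: near_eq_is_derive h.
near=> u; rewrite /prim max_l//.
by apply: ltW; near: u; exact: lt_nbhsr.
Unshelve. all: by end_near. Qed.

Lemma prim0 f : prim f 0 = 0.
Proof. by rewrite /prim maxxx subrr. Qed.

Lemma prim_le f (C L t : R) : continuous f -> 0 <= C -> 0 < L ->
  (forall u, 0 < u -> `|f u| <= C * expR (L * u)) -> 0 <= t ->
  `|prim f t| <= C / L * expR (L * t).
Proof.
move=> cf C0 L0 h t0.
have d := ders_scale (C / L) (ders_expR 0 L).
have := ders_norm_le (ders_prim cf) d (prim0 f); rewrite mulr0 addr0 expR0 mulr1.
move=> /(_ (divr_ge0 C0 (ltW L0))) H.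
have := H _ t t0; rewrite add0r; apply=> u u0.
by rewrite add0r mulrA divfK ?gt_eqF//; exact: h.
Qed.

Lemma prim_sub_le f g (C L t : R) : continuous f -> continuous g -> 0 <= C -> 0 < L ->
  (forall u, 0 < u -> `|f u - g u| <= C * expR (L * u)) -> 0 <= t ->
  `|prim f t - prim g t| <= C / L * expR (L * t).
Proof.
move=> cf cg C0 L0 h t0.
have d := ders_scale (C / L) (ders_expR 0 L).
have dd := ders_sub (ders_prim cf) (ders_prim cg).
have := ders_norm_le dd d; rewrite !prim0 subrr mulr0 addr0 expR0 mulr1.
move=> /(_ erefl (divr_ge0 C0 (ltW L0))) H.
have := H _ t t0; rewrite add0r; apply=> u u0.
by rewrite add0r mulrA divfK ?gt_eqF//; exact: h.
Qed.

Lemma uniform_limit_cont f :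
  (forall T e : R, 0 < T -> 0 < e -> exists2 g : R -> R, continuous g &
     forall t, `|t| <= T -> `|f t - g t| <= e) -> continuous f.
Proof.
move=> h t; apply/cvgrPdist_le => e e0.
have T0 : 0 < `|t| + 1 by rewrite ltr_wpDl.
have e3 : 0 < e / 3 by rewrite divr_gt0.
have [g cg hg] := h _ _ T0 e3.
have /cvgrPdist_le/(_ _ e3) := cg t; apply: filter_app; near=> u.
have u1 : `|u| <= `|t| + 1.
  have : `|t - u| <= 1 by near: u; apply: (@cvgr_dist_le _ _ _ (nbhs t) _ id t cvg_id).
  by have := ler_normB t (t - u); rewrite subKr; lra.
move=> gtu; have h1 := hg t _; have h2 := hg u u1.
have -> : f t - f u = (f t - g t) + (g t - g u) + (g u - f u) by ring.
have := h1 _; rewrite lerDl => /(_ ler01) h1'.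
apply: le_trans (ler_normD _ _) _.
rewrite (distrC (g u)); apply: le_trans (lerD (ler_normD _ _) (lexx _)) _; lra.
Unshelve. all: by end_near. Qed.

(** Any lower end u n - e n lies below any upper end u m + e m, so the supremum of the lower ends
    belongs to all the intervals; the limit comes with the explicit error e n. *)
Lemma sup_limit (u e : nat -> R) : (forall n, 0 <= e n) ->
  (forall n m, (n <= m)%N -> `|u n - u m| <= e n) ->
  exists l, forall n, `|u n - l| <= e n.
Proof.
move=> e0 h.
have lu n m : u n - e n <= u m + e m.
  case/orP: (leq_total n m) => nm; have := h _ _ nm; rewrite ler_norml => /andP[].
    by have := e0 m; lra.
  by have := e0 n; lra.
pose S := [set u n - e n | n in [set: nat]].
have S0 : S !=set0 by exists (u 0%N - e 0%N), 0%N.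
have ub m : ubound S (u m + e m) by move=> _ [n _ <-]; exact: lu.
exists (sup S) => n; rewrite ler_distl; apply/andP; split.
  have : sup S <= u n + e n by apply: ge_sup => //; exact: ub.
  by lra.
have : u n - e n <= sup S by apply: sup_upper_bound; [split=> //; exists (u 0%N + e 0%N); exact: ub|exists n].
by lra.
Qed.
End ders_theory.

(** * Picard iteration *)

Lemma le_geometric0 (R : realType) (z C : R) :
  (forall n, z <= C * (1 / 2) ^+ n) -> z <= 0.
Proof.
move=> h; have cv : C * (1 / 2 : R) ^+ n @[n --> \oo] --> 0.
  rewrite -[X in _ --> X](mulr0 C); apply: cvgMr; apply: cvg_expr.
  by rewrite ger0_norm ?divr_ge0// ltr_pdivrMr// mul1r ltr1n.
by apply: cvgr_to_ge cv _; apply: nearW => n; exact: h.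
Qed.

Lemma prim_max (R : realType) (f : R -> R) t : prim f t = prim f (Num.max t 0).
Proof. by rewrite /prim -maxA maxxx. Qed.

Lemma prim_eqZ (R : realType) (c : R) (f g : R -> R) t : continuous f -> continuous g ->
  (forall u, 0 < u -> f u = c * g u) -> 0 <= t -> prim f t = c * prim g t.
Proof.
move=> cf cg fg t0; apply/eqP; rewrite -subr_eq0; apply/eqP.
have d := ders_sub (ders_prim cf) (ders_scale c (ders_prim cg)).
rewrite (ders_unique0 (ders_ext d _) t0) ?prim0 ?mulr0 ?subrr// => u u0.
by rewrite fg// subrr.
Qed.

Section picard.
Variables (R : realType) (I : finType) (F : R -> (I -> R) -> I -> R) (x0 : I -> R).
Variables (L B : R) (sig : I -> I) (sg : I -> R).
Hypotheses (L0 : 0 < L) (B0 : 0 <= B).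
Hypothesis F_lip : forall t x y i, `|F t x i - F t y i| <= L * \sum_j `|x j - y j|.
Hypothesis F_x0 : forall t i, `|F t x0 i| <= B.
Hypothesis F_cont : forall x : R -> I -> R, (forall i, continuous (x ^~ i)) ->
  forall i, continuous (fun t => F t (x t) i).
(** The symmetry to be carried through the iteration is that of the Fourier coefficients of a real
    function: [sig] sends k to -k, and [sg] is -1 on imaginary parts. *)
Hypothesis x0_sym : forall i, x0 (sig i) = sg i * x0 i.
Hypothesis F_sym : forall t x, (forall i, x (sig i) = sg i * x i) ->
  forall i, F t x (sig i) = sg i * F t x i.

Fixpoint picard_iter (n : nat) : R -> I -> R :=
  if n is n'.+1 then fun t i => x0 i + prim (fun u => F u (picard_iter n' u) i) t
  else fun=> x0.
Local Notation X := picard_iter.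

Lemma picard_iter_cont n i : continuous (X n ^~ i).
Proof.
elim: n i => [|n IH] i; first exact: cst_continuous.
have [ct _] := ders_add (ders_cst (x0 i)) (ders_prim (@F_cont _ IH i)).
exact: ct.
Qed.

Let c : R := #|I|%:R + 1.
(** In the norm weighted by e^(-Lam t) the Picard map contracts by c L / Lam = 1/2 on the whole
    half-line, so no continuation of local solutions is needed. *)
Let Lam := 2 * c * L.

Let c0 : 0 < c. Proof. by rewrite ltr_wpDl. Qed.
Let Lam0 : 0 < Lam. Proof. by rewrite !mulr_gt0. Qed.

Lemma picard_sum_le (y z : R -> I -> R) (C t : R) : 0 <= C ->
  (forall u i, 0 < u -> `|y u i - z u i| <= C * expR (Lam * u)) -> 0 < t ->
  L * \sum_j `|y t j - z t j| <= L * (c * C) * expR (Lam * t).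
Proof.
move=> C0 h t0; rewrite -mulrA ler_wpM2l ?(ltW L0)//.
apply: (@le_trans _ _ (\sum_(j : I) C * expR (Lam * t))).
  by apply: ler_sum => j _; exact: h.
rewrite sumr_const -mulr_natl -mulrA ler_wpM2r ?mulr_ge0 ?expR_ge0//.
by rewrite lerDl.
Qed.

Lemma picard_contraction (y z : R -> I -> R) (C : R) : 0 <= C ->
  (forall i, continuous (y ^~ i)) -> (forall i, continuous (z ^~ i)) ->
  (forall u i, 0 < u -> `|y u i - z u i| <= C * expR (Lam * u)) ->
  forall t i, 0 <= t -> `|prim (fun u => F u (y u) i) t - prim (fun u => F u (z u) i) t|
     <= C / 2 * expR (Lam * t).
Proof.
move=> C0 cy cz h t i t0.
have -> : C / 2 = L * (c * C) / Lam by rewrite /Lam; field; rewrite !gt_eqF.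
apply: prim_sub_le => //; [exact: F_cont|exact: F_cont| |].
  by rewrite !mulr_ge0// ltW.
move=> u u0; apply: le_trans (F_lip _ _ _ _) _; exact: picard_sum_le.
Qed.

Lemma picard_step n t i : 0 <= t ->
  `|X n.+1 t i - X n t i| <= B / Lam * (1 / 2) ^+ n * expR (Lam * t).
Proof.
elim: n t i => [|n IH] t i t0.
  rewrite expr0 mulr1 /= addrAC subrr add0r; apply: prim_le => //.
    exact: (@F_cont _ (@picard_iter_cont 0)).
  move=> u u0; apply: le_trans (F_x0 _ _) _; rewrite ler_peMr// -expR0 ler_expR.
  by rewrite mulr_ge0// ltW.
have -> : X n.+2 t i - X n.+1 t i = prim (fun u => F u (X n.+1 u) i) t
    - prim (fun u => F u (X n u) i) t by rewrite /=; ring.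
rewrite exprSr mulrA mulrA mulr1; apply: picard_contraction => //.
- by rewrite mulr_ge0 ?divr_ge0 ?exprn_ge0// ltW.
- exact: picard_iter_cont.
- exact: picard_iter_cont.
by move=> u j u0; apply: IH; exact: ltW.
Qed.

Let E n t : R := 2 * (B / Lam) * (1 / 2) ^+ n * expR (Lam * t).

Lemma picard_dist n m t i : 0 <= t -> (n <= m)%N -> `|X n t i - X m t i| <= E n t.
Proof.
move=> t0 nm; have BL : 0 <= B / Lam * expR (Lam * t).
  by rewrite mulr_ge0 ?expR_ge0// divr_ge0// ltW.
suff : `|X n t i - X m t i| <= B / Lam * expR (Lam * t) *
    (2 * (1 / 2) ^+ n - 2 * (1 / 2) ^+ m).
  move=> /le_trans; apply.
  have -> : E n t = B / Lam * expR (Lam * t) * (2 * (1 / 2) ^+ n) by rewrite /E; ring.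
  by rewrite ler_wpM2l// lerBlDr lerDl mulr_ge0// exprn_ge0.
move: nm => /subnK <-; elim: (m - n)%N => [|d IH]; first by rewrite add0n !subrr normr0 mulr0.
rewrite addSn; have -> : X n t i - X (d + n).+1 t i =
  (X n t i - X (d + n) t i) - (X (d + n).+1 t i - X (d + n) t i) by ring.
apply: le_trans (ler_normB _ _) _; apply: le_trans (lerD IH (picard_step _ _ t0)) _.
by rewrite exprS le_eqVlt; apply/orP; left; apply/eqP; field; rewrite gt_eqF.
Qed.

Theorem picard_exists : exists x : R -> I -> R,
  [/\ forall i, ders (x ^~ i) (fun t => F t (x t) i), forall i, x 0 i = x0 i &
      forall t i, 0 <= t -> x t (sig i) = sg i * x t i].
Proof.
have E0 n t : 0 <= E n t.
  by rewrite !mulr_ge0 ?expR_ge0 ?exprn_ge0// ?invr_ge0 ltW.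
have /choice[l lE] : forall u : R, exists f : I -> R, 0 <= u ->
    forall i n, `|X n u i - f i| <= E n u.
  move=> u; have [u0|_] := boolP (0 <= u); last by exists x0.
  have /choice[f fE] : forall i, exists l, forall n, `|X n u i - l| <= E n u.
    by move=> i; apply: sup_limit => [n|n m nm]; [exact: E0|exact: picard_dist].
  by exists f => _ i n; exact: fE.
pose x t i := l (Num.max t 0) i.
have m0 (t : R) : 0 <= Num.max t 0 by rewrite le_max lexx orbT.
have Xmax n t i : X n t i = X n (Num.max t 0) i.
  case: n => //= n; congr (_ + _); exact: prim_max.
have xE t i n : `|X n t i - x t i| <= E n (Num.max t 0) by rewrite Xmax; exact: lE.
have x_cont i : continuous (x ^~ i).
  apply: uniform_limit_cont => T e T0 e0.
  have [n En] : exists n, E n T <= e.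
    apply: contrapT => /forallNP h.
    have : e <= 0.
      apply: (@le_geometric0 R e (2 * (B / Lam) * expR (Lam * T))) => n.
      have /negP := h n; rewrite -ltNge => /ltW; rewrite /E => /le_trans; apply.
      (* Both sides agree up to the order of the factors. *)
      by rewrite le_eqVlt; apply/orP; left; apply/eqP; ring.
    by rewrite leNgt e0.
  exists (X n ^~ i) => [|t tT]; first exact: picard_iter_cont.
  rewrite distrC; apply: le_trans (xE t i n) _; apply: le_trans En.
  rewrite /E ler_wpM2l//; first by rewrite !mulr_ge0 ?exprn_ge0// ?invr_ge0 ltW.
  rewrite ler_expR ler_wpM2l ?(ltW Lam0)// ge_max (ltW T0) andbT.
  exact: le_trans (ler_norm _) tT.
have x_eq t i : 0 <= t -> x t i = x0 i + prim (fun u => F u (x u) i) t.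
  move=> t0; apply/eqP; rewrite -subr_eq0 -normr_le0.
  apply: (@le_geometric0 _ _ (2 * (2 * (B / Lam)) * expR (Lam * t))) => n.
  have -> : x t i - (x0 i + prim (fun u => F u (x u) i) t) =
     - (X n.+1 t i - x t i) + (prim (fun u => F u (X n u) i) t - prim (fun u => F u (x u) i) t).
    by rewrite /=; ring.
  apply: le_trans (ler_normD _ _) _; rewrite normrN.
  have h1 := xE t i n.+1; rewrite max_l// in h1.
  have h2 : `|prim (fun u => F u (X n u) i) t - prim (fun u => F u (x u) i) t|
      <= 2 * (B / Lam) * (1 / 2) ^+ n / 2 * expR (Lam * t).
    apply: picard_contraction => //; last 2 first.
    - exact: picard_iter_cont.
    - by move=> u j u0; have := xE u j n; rewrite max_l ?(ltW u0).
    - by rewrite !mulr_ge0 ?exprn_ge0// ?invr_ge0 ltW.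
  apply: le_trans (lerD h1 h2) _; rewrite /E exprS.
  have g0 : 0 <= B / Lam * (1 / 2) ^+ n * expR (Lam * t).
    by rewrite !mulr_ge0 ?expR_ge0 ?exprn_ge0 ?invr_ge0 ?(ltW Lam0).
  move: g0; move: (B / Lam) ((1 / 2) ^+ n) (expR _) => u v w; lra.
have x_eq' t i : x t i = x0 i + prim (fun u => F u (x u) i) t.
  have -> : x t i = x (Num.max t 0) i by rewrite /x (max_l (m0 t)).
  by rewrite prim_max; exact: x_eq.
exists x; split=> [i|i|t i t0].
- rewrite (_ : x ^~ i = fun t => x0 i + prim (fun u => F u (x u) i) t); last first.
    by apply/funext => t; exact: x_eq'.
  apply: ders_ext (ders_add (ders_cst (x0 i)) (ders_prim (@F_cont _ x_cont i))) _ => t _.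
  by rewrite add0r.
- by rewrite x_eq' prim0 addr0.
have X_sym n u j : 0 <= u -> X n u (sig j) = sg j * X n u j.
  elim: n u j => [|n IH] u j u0 //=.
  rewrite x0_sym mulrDr; congr (_ + _).
  apply: prim_eqZ => //; [exact: (@F_cont _ (@picard_iter_cont n))
    |exact: (@F_cont _ (@picard_iter_cont n))|move=> v v0].
  by apply: F_sym => k; apply: IH; exact: ltW.
apply/eqP; rewrite -subr_eq0 -normr_le0.
apply: (@le_geometric0 _ _ ((1 + `|sg i|) * (2 * (B / Lam) * expR (Lam * t)))) => n.
have -> : x t (sig i) - sg i * x t i =
  - (X n t (sig i) - x t (sig i)) + sg i * (X n t i - x t i).
  by rewrite X_sym//; ring.
apply: le_trans (ler_normD _ _) _; rewrite normrN normrM.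
have h1 := xE t (sig i) n; have h2 := ler_wpM2l (normr_ge0 (sg i)) (xE t i n).
rewrite max_l// in h1 h2.
apply: le_trans (lerD h1 h2) _.
by rewrite /E le_eqVlt; apply/orP; left; apply/eqP; ring.
Qed.
End picard.

(** * Truncated Sobolev norms *)

Lemma sum_cauchy_schwarz (R : realType) (I : Type) (r : seq I) (P : pred I) (x y : I -> R) :
  (\sum_(i <- r | P i) x i * y i) ^+ 2 <=
  (\sum_(i <- r | P i) x i ^+ 2) * (\sum_(i <- r | P i) y i ^+ 2).
Proof.
set A := \sum_(i <- r | P i) x i ^+ 2; set B := \sum_(i <- r | P i) y i ^+ 2.
set C := \sum_(i <- r | P i) x i * y i.
have A0 : 0 <= A by apply: sumr_ge0 => i _; exact: sqr_ge0.
have B0 : 0 <= B by apply: sumr_ge0 => i _; exact: sqr_ge0.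
have key (t u : R) : 0 <= t ^+ 2 * A + 2 * (t * u * C) + u ^+ 2 * B.
  have -> : t ^+ 2 * A + 2 * (t * u * C) + u ^+ 2 * B = \sum_(i <- r | P i) (t * x i + u * y i) ^+ 2.
    rewrite /A /B /C !mulr_sumr -!big_split/=; apply: eq_bigr => i _; ring.
  by apply: sumr_ge0 => i _; exact: sqr_ge0.
(* For B = 0 the usual coefficients (B, -C) carry no information; the first substitute settles A =
   0, the second A > 0. *)
have [B1|B1] := eqVneq B 0.
  have := key 1 (- (A + 1) / 2 * C); rewrite B1 !mulr0 addr0 expr1n !mul1r => h.
  have h2 : A * C ^+ 2 + C ^+ 2 <= A by rewrite -subr_ge0; lra.
  have : 0 <= A * C ^+ 2 by rewrite mulr_ge0 ?sqr_ge0.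
  have [A1|A1] := eqVneq A 0; first by rewrite A1 in h2 *; lra.
  have Ap : 0 < A by rewrite lt_neqAle eq_sym A1.
  have := key (C ^+ 2) (- A * C); rewrite B1 mulr0 addr0.
  have -> : C ^+ 2 ^+ 2 * A + 2 * (C ^+ 2 * (- A * C) * C) = - (A * (C ^+ 2) ^+ 2) by ring.
  rewrite oppr_ge0 => h3 _; have : (C ^+ 2) ^+ 2 <= 0 by rewrite -(ler_pM2l Ap) mulr0.
  have -> : (C ^+ 2) ^+ 2 = C ^+ 2 * C ^+ 2 by [].
  have : 0 <= C ^+ 2 by exact: sqr_ge0.
  by move: (C ^+ 2) => c c0 cc; nra.
have Bp : 0 < B by rewrite lt_neqAle eq_sym B1.
have := key B (- C).
have -> : B ^+ 2 * A + 2 * (B * - C * C) + (- C) ^+ 2 * B = B * (A * B - C ^+ 2) by ring.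
by rewrite pmulr_rge0// subr_ge0.
Qed.

Lemma sum_minkowski (R : realType) (I : Type) (r : seq I) (P : pred I) (x y : I -> R) :
  Num.sqrt (\sum_(i <- r | P i) (x i + y i) ^+ 2) <=
  Num.sqrt (\sum_(i <- r | P i) x i ^+ 2) + Num.sqrt (\sum_(i <- r | P i) y i ^+ 2).
Proof.
have cs := sum_cauchy_schwarz r P x y.
set A := \sum_(i <- r | P i) x i ^+ 2 in cs *; set B := \sum_(i <- r | P i) y i ^+ 2 in cs *.
have A0 : 0 <= A by apply: sumr_ge0 => i _; exact: sqr_ge0.
have B0 : 0 <= B by apply: sumr_ge0 => i _; exact: sqr_ge0.
have -> : \sum_(i <- r | P i) (x i + y i) ^+ 2 = A + B + 2 * \sum_(i <- r | P i) x i * y i.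
  by rewrite /A /B mulr_sumr -!big_split/=; apply: eq_bigr => i _; ring.
set C := \sum_(i <- r | P i) x i * y i in cs *.
have s0 : 0 <= Num.sqrt A + Num.sqrt B by rewrite addr_ge0 ?sqrtr_ge0.
rewrite -(ger0_norm s0) -sqrtr_sqr ler_sqrt ?sqr_ge0// sqrrD !sqr_sqrtr//.
have : C <= Num.sqrt A * Num.sqrt B.
  apply: le_trans (ler_norm _) _; rewrite -sqrtrM// -sqrtr_sqr ler_sqrt//.
  exact: mulr_ge0.
by rewrite -mulr_natl; lra.
Qed.

Lemma sqrt_sum_le (R : realType) (I : Type) (r : seq I) (x : I -> R) :
  (forall i, 0 <= x i) -> Num.sqrt (\sum_(i <- r) x i ^+ 2) <= \sum_(i <- r) x i.
Proof.
move=> x0; elim: r => [|i r IH]; first by rewrite !big_nil sqrtr0.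
have s0 : 0 <= \sum_(j <- r) x j by rewrite sumr_ge0.
rewrite !big_cons -[leRHS]ger0_norm ?addr_ge0// -sqrtr_sqr ler_sqrt ?sqr_ge0//.
have h : \sum_(j <- r) x j ^+ 2 <= (\sum_(j <- r) x j) ^+ 2.
  rewrite -[leLHS]sqr_sqrtr ?ler_sqr ?nnegrE ?sqrtr_ge0//.
  by rewrite sumr_ge0// => j _; exact: sqr_ge0.
rewrite sqrrD; apply: le_trans (lerD (lexx _) h) _.
by rewrite lerD2r lerDl mulrn_wge0// mulr_ge0.
Qed.

Definition hnorm (R : realType) (N : nat) (a : R) (U : coefs R) : R := Num.sqrt (hsum N a U).

Section hnorm_theory.
Variables (R : realType) (N : nat) (a : R).
Implicit Types U V : coefs R.

Lemma hsumE U : hsum N a U = \sum_(k <- modes N) (kabs R k `^ a * normc (U k)) ^+ 2.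
Proof. by apply: eq_bigr => k _; rewrite exprMn powR_sqr. Qed.

Lemma hsum_ge0 U : 0 <= hsum N a U.
Proof. by rewrite hsumE sumr_ge0// => k _; exact: sqr_ge0. Qed.

Lemma hnorm_ge0 U : 0 <= hnorm N a U.
Proof. exact: sqrtr_ge0. Qed.

Lemma hnorm_sqr U : hnorm N a U ^+ 2 = hsum N a U.
Proof. by rewrite sqr_sqrtr ?hsum_ge0. Qed.

Lemma normcD_le (x y : R[i]) : normc (x + y) <= normc x + normc y.
Proof. exact: le_normcD. Qed.

Lemma normc_opp (x : R[i]) : normc (- x) = normc x.
Proof. by case: x => u v /=; rewrite !sqrrN. Qed.

Lemma hnormD U V : hnorm N a (fun k => U k + V k) <= hnorm N a U + hnorm N a V.
Proof.
rewrite /hnorm !hsumE; apply: le_trans (sum_minkowski _ _ _ _).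
rewrite ler_sqrt; last by rewrite sumr_ge0// => k _; exact: sqr_ge0.
apply: ler_sum => k _; rewrite -mulrDr ler_sqr ?nnegrE ?mulr_ge0 ?addr_ge0 ?powR_ge0 ?normc_ge0//.
by rewrite ler_wpM2l ?powR_ge0// normcD_le.
Qed.

Lemma hnorm_dist U V : `|hnorm N a U - hnorm N a V| <= hnorm N a (fun k => U k - V k).
Proof.
have h (A B : coefs R) : hnorm N a A <= hnorm N a B + hnorm N a (fun k => A k - B k).
  apply: le_trans (hnormD _ _); rewrite le_eqVlt; apply/orP; left; apply/eqP.
  by congr hnorm; apply/funext => k; rewrite addrC subrK.
rewrite ler_norml; apply/andP; split; last by have := h U V; lra.
have := h V U; have -> : hnorm N a (fun k => V k - U k) = hnorm N a (fun k => U k - V k).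
  by rewrite /hnorm /hsum; under eq_bigr do rewrite -normc_opp opprB.
by lra.
Qed.

Lemma hnorm_le_sum U : hnorm N a U <= \sum_(k <- modes N) kabs R k `^ a * normc (U k).
Proof.
by rewrite /hnorm hsumE; apply: sqrt_sum_le => k; rewrite mulr_ge0 ?powR_ge0 ?normc_ge0.
Qed.

Lemma normc_le_hnorm U k : 0 <= a -> k \in modes N -> normc (U k) <= hnorm N a U.
Proof.
move=> a0 kN; have k0 : k != 0 by move: kN; rewrite mem_modes => /andP[].
apply: (@le_trans _ _ (kabs R k `^ a * normc (U k))).
  by rewrite ler_peMl ?normc_ge0// -(powRr0 (kabs R k)) ler_powR// kabs_ge1.
rewrite -[leLHS]ger0_norm ?mulr_ge0 ?powR_ge0 ?normc_ge0//.
rewrite -sqrtr_sqr ler_sqrt ?hsum_ge0// hsumE.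
rewrite (big_rem k)//= lerDl sumr_ge0// => j _; exact: sqr_ge0.
Qed.
End hnorm_theory.

Lemma Re_conjM (R : realType) (z w : R[i]) : Re (conjc z * w) = Re z * Re w + Im z * Im w.
Proof. by case: z w => x y [u v] /=; ring. Qed.

Definition cders (R : realType) (f df : R -> R[i]) : Prop :=
  ders (fun t => Re (f t)) (fun t => Re (df t)) /\
  ders (fun t => Im (f t)) (fun t => Im (df t)).

Lemma cders_normc_sqr (R : realType) (f df : R -> R[i]) : cders f df ->
  ders (fun t => normc (f t) ^+ 2) (fun t => 2 * Re (conjc (f t) * df t)).
Proof.
move=> [hr hi]; under eq_fun do rewrite normc_sqr.
apply: ders_ext (ders_add (ders_sqr hr) (ders_sqr hi)) _ => t _.
by rewrite Re_conjM mulrDr.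
Qed.

Lemma cders_ext (R : realType) (f df dg : R -> R[i]) : cders f df ->
  (forall t, 0 < t -> df t = dg t) -> cders f dg.
Proof.
by move=> [hr hi] e; split; [apply: ders_ext hr _|apply: ders_ext hi _] => t t0; rewrite e.
Qed.

Lemma cders_sub (R : realType) (f df g dg : R -> R[i]) : cders f df -> cders g dg ->
  cders (fun t => f t - g t) (fun t => df t - dg t).
Proof.
move=> [fr fi] [gr gi]; split.
  have e (z w : R[i]) : Re (z - w) = Re z - Re w by rewrite raddfB.
  by under eq_fun do rewrite e; under [X in ders _ X]eq_fun do rewrite e; exact: ders_sub.
have e (z w : R[i]) : Im (z - w) = Im z - Im w by rewrite raddfB.
by under eq_fun do rewrite e; under [X in ders _ X]eq_fun do rewrite e; exact: ders_sub.
Qed.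

Lemma cders_realM (R : realType) (c dc : R -> R) (f df : R -> R[i]) : ders c dc -> cders f df ->
  cders (fun t => (c t)%:C%C * f t) (fun t => (dc t)%:C%C * f t + (c t)%:C%C * df t).
Proof.
move=> hc [fr fi]; split.
  under eq_fun do rewrite Re_realM.
  under [X in ders _ X]eq_fun do rewrite raddfD/= !Re_realM.
  exact: ders_mul.
under eq_fun do rewrite Im_realM.
under [X in ders _ X]eq_fun do rewrite raddfD/= !Im_realM.
exact: ders_mul.
Qed.

Lemma hsum_ders (R : realType) (N : nat) (a : R) (V dV : R -> coefs R) :
  (forall k, k \in modes N -> cders (V ^~ k) (dV ^~ k)) ->
  ders (fun t => hsum N a (V t))
    (fun t => 2 * \sum_(k <- modes N) kabs R k `^ (2 * a) * Re (conjc (V t k) * dV t k)).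
Proof.
move=> h; rewrite /hsum; under eq_fun do rewrite big_seq.
apply: (@ders_ext _ _ (fun t => \sum_(k <- modes N | k \in modes N)
   kabs R k `^ (2 * a) * (2 * Re (conjc (V t k) * dV t k)))).
  by apply: ders_sum => k kN; apply: ders_scale; apply: cders_normc_sqr; exact: h.
move=> t _; rewrite mulr_sumr [RHS]big_seq; apply: eq_bigr => k _; ring.
Qed.

(** * Monotonicity of the truncated Sobolev norm *)

Section energy_decay.
Variables (R : realType) (N : nat) (s a mu : R) (D : freq -> R) (psi th : R -> R).
Variable V : R -> coefs R.
Hypotheses (s0 : 1 / 2 < s) (s1 : s <= 1) (a1 : 1 < a) (a2 : a < 2 * s).
Hypothesis D_ge : forall k, k \in modes N -> mu * kabs R k `^ (2 * s) <= D k.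
Hypothesis psi0 : forall t, 0 < t -> 0 <= psi t.
Hypothesis th0 : forall t, 0 < t -> 0 <= th t.
(** [th] is [cut]^2 for the modified Galerkin system and 1 for the true one. The condition makes th
    |V|_a |V|_(a+s)^2 at most mu |V|_(a+s)^2, which the dissipation absorbs. *)
Hypothesis th_mu : forall t, 0 < t -> th t * hnorm N a (V t) <= mu.
Hypothesis V_conj : forall t k, 0 < t -> V t (- k) = conjc (V t k).
Hypothesis V_eq : forall k, k \in modes N -> cders (V ^~ k)
  (fun t => - ((D k)%:C%C * V t k) - (th t)%:C%C * nlin N s (psi t) (V t) (V t) k).

Theorem energy_decay t u : 0 <= t -> t <= u -> hsum N a (V u) <= hsum N a (V t).
Proof.
apply: (ders_nincr (hsum_ders a V_eq)) => {}t t0.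
rewrite pmulr_rle0//.
have e (z w : R[i]) (d c : R) : Re (conjc z * (- (d%:C%C * z) - c%:C%C * w))
    = - (d * normc z ^+ 2) - c * Re (conjc z * w).
  rewrite normc_sqr; case: z w => x y [p q] /=; ring.
under eq_bigr do rewrite e mulrBr mulrN mulrCA.
rewrite sumrB sumrN /=.
have -> : \sum_(k <- modes N) kabs R k `^ (2 * a) *
      (th t * Re (conjc (V t k) * nlin N s (psi t) (V t) (V t) k))
    = th t * \sum_(k <- modes N) kabs R k `^ (2 * a) *
       Re (conjc (V t k) * nlin N s (psi t) (V t) (V t) k).
  by rewrite mulr_sumr; apply: eq_bigr => k _; rewrite mulrCA.
have T := energy_trilinear N s0 s1 a1 a2 (psi0 t0) (fun k => V_conj k t0).
set S := \sum_(k <- modes N) _ * Re _ in T *.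
rewrite -/(hnorm N a (V t)) in T.
have h1 : mu * hsum N (a + s) (V t) <=
    \sum_(k <- modes N) D k * (kabs R k `^ (2 * a) * normc (V t k) ^+ 2).
  rewrite /hsum mulr_sumr big_seq [leRHS]big_seq; apply: ler_sum => k kN.
  have k0 : 0 < kabs R k by rewrite kabs_gt0//; move: kN; rewrite mem_modes => /andP[].
  have -> : 2 * (a + s) = 2 * s + 2 * a by ring.
  rewrite powRDp// -mulrA mulrA ler_wpM2r ?D_ge//.
  by rewrite mulr_ge0 ?powR_ge0 ?sqr_ge0.
have h2 : - (th t * S) <= mu * hsum N (a + s) (V t).
  apply: le_trans (ler_norm _) _; rewrite normrN normrM (ger0_norm (th0 t0)).
  apply: le_trans (ler_wpM2l (th0 t0) T) _; rewrite mulrA ler_wpM2r ?hsum_ge0//.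
  exact: th_mu.
by rewrite -opprD oppr_le0 -lerBlDr sub0r; exact: le_trans h2 h1.
Qed.
End energy_decay.

(** * Galerkin approximations *)

Section continuity.
Variable R : realType.
Implicit Types f g : R -> R.

Lemma cont_add f g : continuous f -> continuous g -> continuous (fun t => f t + g t).
Proof. by move=> cf cg t; apply: cvgD; [exact: cf|exact: cg]. Qed.

Lemma cont_opp f : continuous f -> continuous (fun t => - f t).
Proof. by move=> cf t; apply: cvgN; exact: cf. Qed.

Lemma cont_mul f g : continuous f -> continuous g -> continuous (fun t => f t * g t).
Proof. by move=> cf cg t; apply: cvgM; [exact: cf|exact: cg]. Qed.

Lemma cont_cst (c : R) : continuous (fun _ : R => c).
Proof. by move=> t; exact: cvg_cst. Qed.

Lemma cont_sum (I : Type) (r : seq I) (P : pred I) (f : I -> R -> R) :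
  (forall i, P i -> continuous (f i)) -> continuous (fun t => \sum_(i <- r | P i) f i t).
Proof.
move=> h; elim: r => [|i r IH].
  by under eq_fun do rewrite big_nil; exact: cont_cst.
under eq_fun do rewrite big_cons.
by case: (boolP (P i)) => // Pi; apply: cont_add => //; exact: h.
Qed.

Lemma cont_comp f g : continuous f -> continuous g -> continuous (fun t => g (f t)).
Proof. by move=> cf cg t; apply: continuous_comp; [exact: cf|exact: cg]. Qed.

Lemma cont_expR f : continuous f -> continuous (fun t => expR (f t)).
Proof. by move=> cf; apply: cont_comp cf (@continuous_expR R). Qed.

Lemma cont_sqrt f : continuous f -> continuous (fun t => Num.sqrt (f t)).
Proof. by move=> cf; apply: cont_comp cf (@sqrt_continuous R). Qed.

Lemma cont_maxr (c : R) f : continuous f -> continuous (fun t => Num.max c (f t)).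
Proof. by move=> cf t; apply: continuous_max; [exact: cst_continuous|exact: cf]. Qed.

Lemma cont_inv f : (forall t, f t != 0) -> continuous f -> continuous (fun t => (f t)^-1).
Proof. by move=> f0 cf t; apply: cvgV; [exact: f0|exact: cf]. Qed.

Definition ccont (f : R -> R[i]) : Prop :=
  continuous (fun t => Re (f t)) /\ continuous (fun t => Im (f t)).

Lemma ccont_add (f g : R -> R[i]) : ccont f -> ccont g -> ccont (fun t => f t + g t).
Proof.
move=> [fr fi] [gr gi]; split; under eq_fun do rewrite raddfD/=; exact: cont_add.
Qed.

Lemma ccont_opp (f : R -> R[i]) : ccont f -> ccont (fun t => - f t).
Proof. by move=> [fr fi]; split; under eq_fun do rewrite raddfN/=; exact: cont_opp. Qed.

Lemma ccont_sum (I : Type) (r : seq I) (P : pred I) (f : I -> R -> R[i]) :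
  (forall i, P i -> ccont (f i)) -> ccont (fun t => \sum_(i <- r | P i) f i t).
Proof.
move=> h; split; under eq_fun do rewrite raddf_sum/=; apply: cont_sum => i /h[] //.
Qed.

Lemma ccont_mul (f g : R -> R[i]) : ccont f -> ccont g -> ccont (fun t => f t * g t).
Proof.
have eR (z w : R[i]) : Re (z * w) = Re z * Re w + - (Im z * Im w) by case: z w => x y [u v].
have eI (z w : R[i]) : Im (z * w) = Re z * Im w + Im z * Re w by case: z w => x y [u v].
move=> [fr fi] [gr gi]; split.
  under eq_fun do rewrite eR; apply: cont_add; first exact: cont_mul.
  by apply: cont_opp; exact: cont_mul.
by under eq_fun do rewrite eI; apply: cont_add; exact: cont_mul.
Qed.

Lemma ccont_realM (c : R -> R) (f : R -> R[i]) : continuous c -> ccont f ->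
  ccont (fun t => (c t)%:C%C * f t).
Proof.
move=> cc [fr fi]; split.
  by under eq_fun do rewrite Re_realM; exact: cont_mul.
by under eq_fun do rewrite Im_realM; exact: cont_mul.
Qed.

Lemma ccont_normc_sqr (f : R -> R[i]) : ccont f -> continuous (fun t => normc (f t) ^+ 2).
Proof.
move=> [fr fi]; under eq_fun do rewrite normc_sqr !expr2.
by apply: cont_add; exact: cont_mul.
Qed.
End continuity.

Lemma conjcM_eq (R : realType) (z w : R[i]) : conjc (z * w) = conjc z * conjc w.
Proof. by case: z w => x y [u v]; congr (_ +i* _)%C; ring. Qed.

Lemma conjc_realE (R : realType) (x : R) : conjc x%:C%C = x%:C%C :> R[i].
Proof. by rewrite /= oppr0. Qed.

Lemma normc_sum (R : realType) (I : Type) (r : seq I) (P : pred I) (f : I -> R[i]) :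
  normc (\sum_(i <- r | P i) f i) <= \sum_(i <- r | P i) normc (f i).
Proof.
apply: (big_ind2 (fun x y => normc x <= y)) => //.
  by rewrite normc0.
move=> x1 x2 y1 y2 h1 h2; apply: le_trans (normcD_le _ _) _; exact: lerD.
Qed.

(** * Bounds on the symbol and the weights of the nonlinearity *)

Section coefficients.
Variables (R : realType) (s : R).
Hypotheses (s0 : 0 < s) (s1 : s <= 1).
Local Notation kabs := (@kabs R).

(** The cross product of j with itself vanishes, so l may be replaced by j + l: the derivative can
    be placed on the output frequency. *)
Lemma csym_le_sum (j l : freq) : `|csym R j l| <= kabs (j + l).
Proof.
have -> : csym R j l = cross R j (j + l) / kabs j.
  by rewrite /csym /cross/= !intrD; congr (_ / _); ring.
have [->|j0] := eqVneq j 0.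
  by rewrite kabs0 invr0 mulr0 normr0 kabs_ge0.
rewrite normrM [`|_^-1|]ger0_norm ?invr_ge0 ?kabs_ge0// ler_pdivrMr ?kabs_gt0//.
by rewrite mulrC; exact: cross_le.
Qed.

Lemma csym_le (k j : freq) : `|csym R j (k - j)| <= kabs k.
Proof. by have := csym_le_sum j (k - j); rewrite (addrC j) subrK. Qed.

Lemma csym_le_r (j l : freq) : `|csym R j l| <= kabs l.
Proof.
have [->|j0] := eqVneq j 0.
  by rewrite /csym kabs0 invr0 mulr0 normr0 kabs_ge0.
rewrite /csym normrM [`|_^-1|]ger0_norm ?invr_ge0 ?kabs_ge0// ler_pdivrMr ?kabs_gt0//.
by rewrite mulrC; exact: cross_le.
Qed.

Lemma kabs_powR_subadd (j l : freq) : kabs (j + l) `^ s <= kabs j `^ s + kabs l `^ s.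
Proof.
have s_neq0 : s != 0 by rewrite gt_eqF.
have [->|j0] := eqVneq j 0; first by rewrite add0r kabs0 powR0// add0r.
have [->|l0] := eqVneq l 0; first by rewrite addr0 kabs0 powR0// addr0.
apply: le_trans (powR_subadd (ltW s0) s1 (kabs_gt0 R j0) (kabs_gt0 R l0)).
by apply: ge0_ler_powR; rewrite ?nnegrE ?addr_ge0 ?kabs_ge0 ?kabs_triangle// ltW.
Qed.

Lemma wexp_le1 (psi : R) (k j : freq) : 0 <= psi -> wexp s psi k j (k - j) <= 1.
Proof.
move=> p0; rewrite expR_le1 mulr_ge0_le0// -addrA -opprD subr_le0.
by have := kabs_powR_subadd j (k - j); rewrite addrC subrK.
Qed.

Lemma wexp_ge0 (psi : R) (k j l : freq) : 0 <= wexp s psi k j l.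
Proof. exact: expR_ge0. Qed.

Lemma nlin_conj (N : nat) (psi : R) (U V : coefs R) (k : freq) :
  (forall j, U (- j) = conjc (U j)) -> (forall j, V (- j) = conjc (V j)) ->
  nlin N s psi U V (- k) = conjc (nlin N s psi U V k).
Proof.
move=> hU hV; pose P (j : freq) := - k - j \in modes N.
pose F j := (csym R j (- k - j) * wexp s psi (- k) j (- k - j))%:C%C * (U j * V (- k - j)).
have -> : nlin N s psi U V (- k) = \sum_(j <- modes N | P (- j)) F (- j).
  by rewrite [RHS]big_mkcond/= (sum_modes_opp N (fun j => if P j then F j else 0)) -big_mkcond.
rewrite /nlin rmorph_sum/= /P /F; apply: eq_big => [j|j _]; first by rewrite -opprD mem_modesN.
have -> : - k - - j = - (k - j) by rewrite opprD.
have -> : csym R (- j) (- (k - j)) * wexp s psi (- k) (- j) (- (k - j)) =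
    csym R j (k - j) * wexp s psi k j (k - j).
  rewrite /wexp !kabsN; congr (_ * _).
  by rewrite /csym !kabsN; congr (_ / _); rewrite /cross/= !intrN; ring.
by rewrite hU hV !conjcM_eq conjc_realE.
Qed.

Lemma nlin_diff_le (N : nat) (psi mu d : R) (V W : coefs R) (k : freq) :
  0 <= psi -> 0 <= mu -> 0 <= d ->
  (forall j, j \in modes N -> normc (V j) <= mu) ->
  (forall j, j \in modes N -> normc (W j) <= mu) ->
  (forall j, j \in modes N -> normc (V j - W j) <= d) ->
  normc (nlin N s psi V V k - nlin N s psi W W k)
    <= (size (modes N))%:R * (kabs k * (2 * mu * d)).
Proof.
move=> p0 mu0 d0 hV hW hd; rewrite /nlin -sumrB.
apply: le_trans (normc_sum _ _ _) _.
apply: (@le_trans _ _ (\sum_(j <- modes N) kabs k * (2 * mu * d))); last first.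
  by rewrite big_const_seq count_predT iter_addr_0 [leRHS]mulr_natl.
rewrite big_mkcond big_seq [leRHS]big_seq; apply: ler_sum => j jN.
case: ifP => kj; last by rewrite !mulr_ge0 ?kabs_ge0.
rewrite -mulrBr normcM normc_real; apply: ler_pM; rewrite ?normc_ge0//.
  rewrite normrM [`|wexp _ _ _ _ _|]ger0_norm ?wexp_ge0//.
  by rewrite -[leRHS]mulr1; apply: ler_pM; rewrite ?wexp_ge0 ?wexp_le1 ?csym_le.
have -> : V j * V (k - j) - W j * W (k - j) =
   (V j - W j) * V (k - j) + W j * (V (k - j) - W (k - j)) by ring.
apply: le_trans (normcD_le _ _) _; rewrite !normcM.
have -> : 2 * mu * d = d * mu + mu * d by ring.
by apply: lerD; apply: ler_pM; rewrite ?normc_ge0 ?hd ?hV ?hW.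
Qed.
End coefficients.

Section galerkin.
Variables (R : realType) (N : nat) (s a mu : R) (D : freq -> R) (psi : R -> R).
Variable V0 : coefs R.
Hypotheses (s0 : 1 / 2 < s) (s1 : s <= 1) (a1 : 1 < a) (a2 : a < 2 * s) (mu0 : 0 < mu).
Hypothesis D_ge : forall k, k \in modes N -> mu * kabs R k `^ (2 * s) <= D k.
Hypothesis D_even : forall k, D (- k) = D k.
Hypothesis psi_ge0 : forall t, 0 <= psi t.
Hypothesis psi_cont : continuous psi.
Hypothesis V0_conj : forall k, V0 (- k) = conjc (V0 k).
Hypothesis V0_small : hsum N a V0 <= mu ^+ 2.

Let I : finType := (seq_sub (modes N) * bool)%type.

Definition part (b : bool) (z : R[i]) : R := if b then Im z else Re z.

Definition ext (x : I -> R) : coefs R := fun k =>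
  if insub k : option (seq_sub (modes N)) is Some k' then (x (k', false) +i* x (k', true))%C else 0.

(* Multiplying U by cut U makes the field globally Lipschitz; since cut U * |U|_a <= mu, the
   energy estimate holds for the modified equation, so that the cut-off is never active. *)
Definition cut (U : coefs R) : R := mu / Num.max mu (hnorm N a U).

Definition gfield (t : R) (x : I -> R) (i : I) : R :=
  let U := ext x in let V k := (cut U)%:C%C * U k in
  part i.2 (- ((D (ssval i.1))%:C%C * U (ssval i.1)) - nlin N s (psi t) V V (ssval i.1)).

Lemma ext_in (x : I -> R) (k : seq_sub (modes N)) :
  ext x (ssval k) = (x (k, false) +i* x (k, true))%C.
Proof. by rewrite /ext -[ssval k]/(val k) valK. Qed.

Lemma ext_out (x : I -> R) (k : freq) : k \notin modes N -> ext x k = 0.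
Proof. by move=> kN; rewrite /ext insubN. Qed.

Lemma part_le (b : bool) (z : R[i]) : `|part b z| <= normc z.
Proof. by case: b; [exact: Im_le_normc|exact: Re_le_normc]. Qed.

Lemma part_sub (b : bool) (z w : R[i]) : part b (z - w) = part b z - part b w.
Proof. by case: b; rewrite /part raddfB. Qed.

Lemma normc_le_parts (z : R[i]) : normc z <= `|Re z| + `|Im z|.
Proof.
rewrite -ler_sqr ?nnegrE ?normc_ge0 ?addr_ge0// normc_sqr sqrrD !real_normK ?num_real//.
by rewrite -addrA [_ *+ 2 + _]addrC addrA lerDl mulrn_wge0// mulr_ge0.
Qed.

Lemma ext_diff (x y : I -> R) (k : freq) :
  normc (ext x k - ext y k) <= \sum_j `|x j - y j|.
Proof.
rewrite /ext; case: insubP => [k' _ _|_]; last first.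
  by rewrite subrr normc0 sumr_ge0.
apply: le_trans (normc_le_parts _) _ => /=.
rewrite (bigD1 (k', false))//= lerD2l (bigD1 (k', true)); last by rewrite xpair_eqE andbF.
by rewrite lerDl sumr_ge0.
Qed.

Lemma hnorm_ext_diff (x y : I -> R) :
  hnorm N a (fun k => ext x k - ext y k) <=
  (\sum_(k <- modes N) kabs R k `^ a) * \sum_j `|x j - y j|.
Proof.
apply: le_trans (hnorm_le_sum _ _ _) _; rewrite mulr_suml; apply: ler_sum => k _.
by rewrite ler_wpM2l ?powR_ge0// ext_diff.
Qed.

Lemma maxmu_gt0 (U : coefs R) : 0 < Num.max mu (hnorm N a U).
Proof. by rewrite lt_max mu0. Qed.

Lemma cut_ge0 (U : coefs R) : 0 <= cut U.
Proof. by rewrite divr_ge0 ?ltW// maxmu_gt0. Qed.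

Lemma cut_le1 (U : coefs R) : cut U <= 1.
Proof. by rewrite ler_pdivrMr ?maxmu_gt0// mul1r le_max lexx. Qed.

Lemma cut_hnorm (U : coefs R) : cut U * hnorm N a U <= mu.
Proof.
by rewrite /cut mulrAC ler_pdivrMr ?maxmu_gt0// ler_wpM2l ?(ltW mu0)// le_max lexx orbT.
Qed.

Lemma cut_small (U : coefs R) : hnorm N a U <= mu -> cut U = 1.
Proof. by move=> h; rewrite /cut max_l// divff// gt_eqF. Qed.

Lemma cut_bound (U : coefs R) (j : freq) : j \in modes N -> normc ((cut U)%:C%C * U j) <= mu.
Proof.
move=> jN; rewrite normcM normc_real ger0_norm ?cut_ge0//.
apply: le_trans (cut_hnorm U); rewrite ler_wpM2l ?cut_ge0// normc_le_hnorm//.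
exact: le_trans (ltW a1).
Qed.

(** One unit of the constant 2 comes from U_j - V_j. The other comes from the change of [cut]: x ->
    max mu x is 1-Lipschitz, and |V_j| is at most the denominator max mu |V|_a. *)
Lemma cut_diff (U V : coefs R) (j : freq) : j \in modes N ->
  normc ((cut U)%:C%C * U j - (cut V)%:C%C * V j) <= 2 * hnorm N a (fun k => U k - V k).
Proof.
move=> jN; have a0 : 0 <= a by exact: le_trans (ltW a1).
have -> : (cut U)%:C%C * U j - (cut V)%:C%C * V j =
    (cut U)%:C%C * (U j - V j) + (cut U - cut V)%:C%C * V j :> R[i].
  by rewrite rmorphB/= mulrBr mulrBl; ring.
apply: le_trans (normcD_le _ _) _; rewrite !normcM !normc_real.
rewrite mulr_natl mulr2n; apply: lerD.
  rewrite -[leRHS]mul1r; apply: ler_pM; rewrite ?normc_ge0//.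
    by rewrite ger0_norm ?cut_ge0 ?cut_le1.
  exact: (normc_le_hnorm (fun k => U k - V k)).
have hV := normc_le_hnorm V a0 jN; have hd := hnorm_dist N a U V.
have mU := maxmu_gt0 U; have mV := maxmu_gt0 V.
set u := hnorm N a U in hd mU *; set v := hnorm N a V in hV hd mV *.
set d := hnorm N a _ in hd *.
have -> : cut U - cut V = mu * (Num.max mu v - Num.max mu u) / (Num.max mu u * Num.max mu v).
  by rewrite /cut -/u -/v; field; rewrite !gt_eqF.
have hm : `|Num.max mu v - Num.max mu u| <= d.
  apply: le_trans hd; case: (leP mu v) => hv; case: (leP mu u) => hu.
  - by rewrite distrC.
  - rewrite ger0_norm ?subr_ge0// distrC; apply: le_trans (ler_norm _).
    by rewrite lerD2l lerN2 ltW.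
  - rewrite distrC ger0_norm ?subr_ge0//; apply: le_trans (ler_norm _).
    by rewrite lerD2l lerN2 ltW.
  - by rewrite subrr normr0.
rewrite !normrM normfV (ger0_norm (ltW mu0)) [`|_ * _|]ger0_norm ?mulr_ge0 ?(ltW mU) ?(ltW mV)//.
rewrite mulrAC ler_pdivrMr ?mulr_gt0//.
have d0 : 0 <= d by exact: hnorm_ge0.
have h1 : mu <= Num.max mu u by rewrite le_max lexx.
have h2 : normc (V j) <= Num.max mu v by apply: le_trans hV _; rewrite le_max lexx orbT.
have -> : d * (Num.max mu u * Num.max mu v) = Num.max mu u * d * Num.max mu v by ring.
by apply: ler_pM; rewrite ?normc_ge0 ?mulr_ge0 ?ler_pM// ltW.
Qed.

(** By homogeneity the cut-off inside the quadratic term becomes a scalar factor c^2 in front of it,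
    the [th] of [energy_decay]. *)
Lemma nlin_scale (p c : R) (U : coefs R) (k : freq) :
  nlin N s p (fun j => c%:C%C * U j) (fun j => c%:C%C * U j) k
  = (c ^+ 2)%:C%C * nlin N s p U U k.
Proof.
rewrite /nlin mulr_sumr; apply: eq_bigr => j _.
by rewrite [(c ^+ 2)%:C%C]rmorphXn/= expr2; ring.
Qed.

Let Ca := \sum_(k <- modes N) kabs R k `^ a.
Let Ck := \sum_(k <- modes N) kabs R k.
Let CD := \sum_(k <- modes N) `|D k|.
Let sz := (size (modes N))%:R : R.

Lemma le_modes_sum (f : freq -> R) (k : freq) : (forall j, 0 <= f j) -> k \in modes N ->
  f k <= \sum_(j <- modes N) f j.
Proof. by move=> f0 kN; rewrite (big_rem k)//= lerDl sumr_ge0. Qed.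

Lemma gfield_lip t (x y : I -> R) (i : I) : `|gfield t x i - gfield t y i| <=
  (CD + sz * (Ck * (2 * mu * (2 * Ca))) + 1) * \sum_j `|x j - y j|.
Proof.
case: i => k b; rewrite /gfield -part_sub; apply: le_trans (part_le _ _) _ => /=.
set S := \sum_j _; have S0 : 0 <= S by rewrite sumr_ge0.
have kN := ssvalP k.
set Vx := fun j => (cut (ext x))%:C%C * ext x j; set Vy := fun j => (cut (ext y))%:C%C * ext y j.
set u := ext x (ssval k); set v := ext y (ssval k).
set nx := nlin _ _ _ Vx _ _; set ny := nlin _ _ _ Vy _ _.
have -> : - ((D (ssval k))%:C%C * u) - nx - (- ((D (ssval k))%:C%C * v) - ny) =
   - ((D (ssval k))%:C%C * (u - v)) + - (nx - ny) by ring.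
apply: le_trans (normcD_le _ _) _; rewrite !normc_opp normcM normc_real.
have h1 : normc (nx - ny) <= sz * (kabs R (ssval k) * (2 * mu * (2 * Ca * S))).
  apply: nlin_diff_le => //; rewrite ?(ltW mu0)//.
  - exact: lt_trans s0.
  - by rewrite !mulr_ge0// sumr_ge0// => j _; exact: powR_ge0.
  - by move=> j jN; exact: cut_bound.
  - by move=> j jN; exact: cut_bound.
  - move=> j jN; apply: le_trans (cut_diff _ _ jN) _.
    by rewrite -mulrA ler_wpM2l// hnorm_ext_diff.
have h2 : `|D (ssval k)| * normc (u - v) <= CD * S.
  by apply: ler_pM; rewrite ?normc_ge0 ?ext_diff// (le_modes_sum (f := fun k => `|D k|)).
have h3 : sz * (kabs R (ssval k) * (2 * mu * (2 * Ca * S))) <=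
     sz * (Ck * (2 * mu * (2 * Ca))) * S.
  have -> : sz * (Ck * (2 * mu * (2 * Ca))) * S = sz * (Ck * (2 * mu * (2 * Ca * S))) by ring.
  rewrite ler_wpM2l ?ler0n// ler_wpM2r//.
    by rewrite !mulr_ge0 ?(ltW mu0)// sumr_ge0// => j _; exact: powR_ge0.
  by rewrite (le_modes_sum (f := fun k => kabs R k))// => j; exact: kabs_ge0.
apply: le_trans (lerD h2 (le_trans h1 h3)) _.
by rewrite -mulrDl ler_wpM2r// lerDl.
Qed.

Let x0 : I -> R := fun i => part i.2 (V0 (ssval i.1)).

Lemma ext_x0 k : k \in modes N -> ext x0 k = V0 k.
Proof.
move=> kN; rewrite -[k]/(ssval (SeqSub kN)) ext_in /x0/=.
by case: (V0 k).
Qed.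

Lemma gfield_x0 t (i : I) : `|gfield t x0 i| <=
  \sum_(k <- modes N) (`|D k| * normc (V0 k) + sz * (kabs R k * (2 * mu * mu))).
Proof.
case: i => k b; have kN := ssvalP k.
have f0 (j : freq) : 0 <= `|D j| * normc (V0 j) + sz * (kabs R j * (2 * mu * mu)).
  by rewrite addr_ge0// !mulr_ge0 ?normc_ge0 ?kabs_ge0 ?ler0n ?(ltW mu0).
apply: le_trans (le_modes_sum f0 kN); rewrite /gfield.
apply: le_trans (part_le _ _) _ => /=.
apply: le_trans (normcD_le _ _) _; rewrite !normc_opp normcM normc_real.
rewrite ext_x0//; apply: lerD => //.
set V := fun j => (cut (ext x0))%:C%C * ext x0 j.
have n0 : nlin N s (psi t) (fun=> 0) (fun=> 0) (ssval k) = 0.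
  by rewrite /nlin big1// => j _; rewrite !mulr0.
have := @nlin_diff_le R s _ s1 N (psi t) mu mu V (fun=> 0) (ssval k) (psi_ge0 t) (ltW mu0) (ltW mu0).
rewrite n0 subr0; apply => [|j jN|j jN|j jN].
- exact: lt_trans s0.
- exact: cut_bound.
- by rewrite normc0 ltW.
- by rewrite subr0; exact: cut_bound.
Qed.

Lemma ccont_ext (x : R -> I -> R) k : (forall i, continuous (x ^~ i)) ->
  ccont (fun t => ext (x t) k).
Proof.
move=> cx; rewrite /ext; case: insubP => [k' _ _|_]; split => //=; exact: cont_cst.
Qed.

Lemma gfield_cont (x : R -> I -> R) : (forall i, continuous (x ^~ i)) ->
  forall i, continuous (fun t => gfield t (x t) i).
Proof.
move=> cx [k b]; have ce j := ccont_ext j cx.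
have ccut : continuous (fun t => cut (ext (x t))).
  apply: cont_mul; first exact: cont_cst.
  apply: cont_inv => [t|]; first by rewrite gt_eqF// maxmu_gt0.
  apply: cont_maxr; apply: cont_sqrt; apply: cont_sum => j _.
  apply: cont_mul; first exact: cont_cst.
  exact: ccont_normc_sqr.
suff : ccont (fun t => - ((D (ssval k))%:C%C * ext (x t) (ssval k)) -
   nlin N s (psi t) (fun j => (cut (ext (x t)))%:C%C * ext (x t) j)
     (fun j => (cut (ext (x t)))%:C%C * ext (x t) j) (ssval k)).
  by case: b => -[cr ci].
apply: ccont_add; first by apply: ccont_opp; apply: ccont_realM => //; exact: cont_cst.
apply: ccont_opp; apply: ccont_sum => j _; apply: ccont_realM.
  apply: cont_mul; first exact: cont_cst.
  apply: cont_expR; apply: cont_mul => //; exact: cont_cst.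
by apply: ccont_mul; apply: ccont_realM.
Qed.

Let opp_mode (k : seq_sub (modes N)) : seq_sub (modes N) :=
  SeqSub (etrans (mem_modesN N (ssval k)) (ssvalP k)).
Let sig (i : I) : I := (opp_mode i.1, i.2).
Let sg (i : I) : R := if i.2 then -1 else 1.

Lemma x0_sym i : x0 (sig i) = sg i * x0 i.
Proof.
case: i => k b; rewrite /x0 /sg /= V0_conj; case: (V0 (ssval k)) => u v.
by case: b => /=; rewrite ?mulN1r ?mul1r.
Qed.

Lemma ext_conj (x : I -> R) : (forall i, x (sig i) = sg i * x i) ->
  forall k, ext x (- k) = conjc (ext x k).
Proof.
move=> hx k; have [kN|kN] := boolP (k \in modes N); last first.
  by rewrite !ext_out ?mem_modesN//= oppr0.
pose k' : seq_sub (modes N) := SeqSub kN.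
rewrite -[- k]/(ssval (opp_mode k')) -[k in RHS]/(ssval k') !ext_in.
have /= -> := hx (k', false); have /= -> := hx (k', true).
by rewrite /sg/= mul1r mulN1r.
Qed.

Lemma gfield_sym t (x : I -> R) : (forall i, x (sig i) = sg i * x i) ->
  forall i, gfield t x (sig i) = sg i * gfield t x i.
Proof.
move=> hx [k b]; rewrite /gfield /sg/= D_even; have ec := ext_conj hx.
set V := fun j => (cut (ext x))%:C%C * ext x j.
have Vc j : V (- j) = conjc (V j) by rewrite /V ec conjcM_eq conjc_realE.
rewrite (nlin_conj _ _ _ _ Vc Vc) ec.
move: (nlin _ _ _ _ _ _) (ext _ _) => [p q] [u v].
by case: b => /=; ring.
Qed.

Theorem galerkin_exists : exists V : R -> coefs R,
  [/\ forall k, k \in modes N -> cders (V ^~ k)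
        (fun t => - ((D k)%:C%C * V t k) - nlin N s (psi t) (V t) (V t) k),
      forall k, k \in modes N -> V 0 k = V0 k,
      forall t k, k \notin modes N -> V t k = 0,
      forall t k, 0 <= t -> V t (- k) = conjc (V t k) &
      forall t, 0 <= t -> hsum N a (V t) <= mu ^+ 2].
Proof.
have L0 : 0 < CD + sz * (Ck * (2 * mu * (2 * Ca))) + 1.
  rewrite ltr_wpDl// addr_ge0 ?sumr_ge0// !mulr_ge0 ?ler0n ?(ltW mu0) ?sumr_ge0// => j _.
    exact: kabs_ge0.
  exact: powR_ge0.
have B0 : 0 <= \sum_(k <- modes N) (`|D k| * normc (V0 k) + sz * (kabs R k * (2 * mu * mu))).
  rewrite sumr_ge0// => j _.
  by rewrite addr_ge0// !mulr_ge0 ?normc_ge0 ?kabs_ge0 ?ler0n ?(ltW mu0).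
have [x [xd x00 xs]] := picard_exists L0 B0 gfield_lip gfield_x0 gfield_cont x0_sym gfield_sym.
pose V t := ext (x t).
have Vconj t k : 0 <= t -> V t (- k) = conjc (V t k).
  by move=> t0; apply: ext_conj => i; exact: xs.
have V0E k : k \in modes N -> V 0 k = V0 k.
  move=> kN; rewrite -(ext_x0 kN) /V; congr (ext _ k).
  by apply/funext => i; exact: x00.
have Vd k : k \in modes N -> cders (V ^~ k)
   (fun t => - ((D k)%:C%C * V t k) - ((cut (V t)) ^+ 2)%:C%C * nlin N s (psi t) (V t) (V t) k).
  move=> kN; pose k' : seq_sub (modes N) := SeqSub kN.
  have h (t : R) : ((cut (V t)) ^+ 2)%:C%C * nlin N s (psi t) (V t) (V t) k =
    nlin N s (psi t) (fun j => (cut (V t))%:C%C * V t j) (fun j => (cut (V t))%:C%C * V t j) k.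
    by rewrite nlin_scale.
  under [X in cders _ X]eq_fun do rewrite h.
  have e b : (fun t => part b (V t k)) = (x ^~ (k', b)).
    by apply/funext => t; rewrite /V -[k]/(ssval k') ext_in; case: b.
  split.
    have -> : (fun t => Re (V t k)) = (x ^~ (k', false)) by rewrite -e.
    exact: xd.
  have -> : (fun t => Im (V t k)) = (x ^~ (k', true)) by rewrite -e.
  exact: xd.
have small t : 0 <= t -> hsum N a (V t) <= mu ^+ 2.
  move=> t0; apply: (@le_trans _ _ (hsum N a (V 0))).
    apply: (@energy_decay R N s a mu D psi (fun t => cut (V t) ^+ 2) V) => //.
    - by move=> u u0; exact: sqr_ge0.
    - move=> u u0; rewrite expr2 -mulrA; apply: le_trans (cut_hnorm (V u)).
      by rewrite ler_piMl ?cut_le1// mulr_ge0 ?cut_ge0 ?hnorm_ge0.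
    - by move=> u k u0; apply: Vconj; exact: ltW.
  apply: le_trans V0_small; rewrite /hsum big_seq [leRHS]big_seq le_eqVlt.
  by apply/orP; left; apply/eqP; apply: eq_bigr => k kN; rewrite V0E.
exists V; split=> //; last by move=> t k kN; exact: ext_out.
move=> k kN; apply: cders_ext (Vd k kN) _ => t t0.
rewrite cut_small ?expr1n ?mul1r//.
rewrite -ler_sqr ?nnegrE ?hnorm_ge0 ?(ltW mu0)// hnorm_sqr.
by apply: small; exact: ltW.
Qed.
End galerkin.

(** * Stability *)

Lemma sum_inj_le (R : numDomainType) (r1 r2 : seq freq) (h : freq -> freq) (G : freq -> R) :
  uniq r1 -> uniq r2 -> injective h -> (forall k, 0 <= G k) ->
  \sum_(k <- r1 | h k \in r2) G (h k) <= \sum_(k <- r2) G k.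
Proof.
move=> u1 u2 hi G0; rewrite -big_filter -(big_map h predT) /=.
apply: sum_uniq_subset => //; first by rewrite map_inj_uniq// filter_uniq.
by move=> k /mapP[j]; rewrite mem_filter => /andP[hj _] ->.
Qed.

Lemma mul_am_gm (R : realFieldType) (f x y : R) : 0 <= f ->
  f * (x * y) <= f * (x ^+ 2 / 2) + f * (y ^+ 2 / 2).
Proof. by move=> f0; rewrite -mulrDr ler_wpM2l//; have := sqr_ge0 (x - y); nra. Qed.

(** * Young's inequality for discrete convolutions on a box *)

Section convolution.
Variables (R : realType) (K : nat) (F X Y : freq -> R).
Hypothesis F0 : forall k, 0 <= F k.

Lemma convl_le : \sum_(k <- modes K) \sum_(j <- modes K | k - j \in modes K)
    F j * (X k * Y (k - j))
  <= (\sum_(j <- modes K) F j) *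
     ((\sum_(k <- modes K) X k ^+ 2) / 2 + (\sum_(k <- modes K) Y k ^+ 2) / 2).
Proof.
apply: (@le_trans _ _ (\sum_(k <- modes K) \sum_(j <- modes K | k - j \in modes K)
    (F j * (X k ^+ 2 / 2) + F j * (Y (k - j) ^+ 2 / 2)))).
  by apply: ler_sum => k _; apply: ler_sum => j _; exact: mul_am_gm.
under eq_bigr do rewrite big_split/=.
rewrite big_split/= mulrDr; apply: lerD.
  rewrite [X in _ * X]mulr_suml mulr_sumr; apply: ler_sum => k _.
  rewrite -mulr_suml ler_wpM2r//; last by rewrite big_mkcond/=; apply: ler_sum => j _; case: ifP.
  by rewrite mulr_ge0 ?sqr_ge0.
rewrite (exchange_big_dep xpredT)//= mulr_suml; apply: ler_sum => j _.
rewrite -mulr_sumr ler_wpM2l// mulr_suml.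
apply: (@sum_inj_le _ (modes K) (modes K) (fun k => k - j) (fun k => Y k ^+ 2 / 2)).
- exact: modes_uniq.
- exact: modes_uniq.
- by move=> x y /addIr.
- by move=> k; rewrite mulr_ge0 ?sqr_ge0.
Qed.

Lemma convr_le : \sum_(k <- modes K) \sum_(j <- modes K | k - j \in modes K)
    F (k - j) * (X k * Y j)
  <= (\sum_(j <- modes K) F j) *
     ((\sum_(k <- modes K) X k ^+ 2) / 2 + (\sum_(k <- modes K) Y k ^+ 2) / 2).
Proof.
apply: (@le_trans _ _ (\sum_(k <- modes K) \sum_(j <- modes K | k - j \in modes K)
    (F (k - j) * (X k ^+ 2 / 2) + F (k - j) * (Y j ^+ 2 / 2)))).
  by apply: ler_sum => k _; apply: ler_sum => j _; exact: mul_am_gm.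
under eq_bigr do rewrite big_split/=.
rewrite big_split/= mulrDr; apply: lerD.
  rewrite [X in _ * X]mulr_suml mulr_sumr; apply: ler_sum => k _.
  rewrite -mulr_suml ler_wpM2r//; first by rewrite mulr_ge0 ?sqr_ge0.
  apply: (@sum_inj_le _ (modes K) (modes K) (fun j => k - j)) => //; try exact: modes_uniq.
  by move=> x y /addrI /oppr_inj.
rewrite (exchange_big_dep xpredT)//= [X in _ * X]mulr_suml mulr_sumr; apply: ler_sum => j _.
rewrite -mulr_suml ler_wpM2r//; first by rewrite mulr_ge0 ?sqr_ge0.
apply: (@sum_inj_le _ (modes K) (modes K) (fun k => k - j)) => //; try exact: modes_uniq.
by move=> x y /addIr.
Qed.
End convolution.

Section difference.
Variables (R : realType) (s : R).
Hypotheses (s0 : 0 < s) (s1 : s <= 1).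
Local Notation kabs := (@kabs R).

(* The derivative is shared evenly between k and l = k - j: as 2 s > 1, half a derivative on
   each factor is absorbed by the dissipation. *)
Lemma csym_le_sqrt (k j : freq) :
  `|csym R j (k - j)| <= Num.sqrt (kabs k) * Num.sqrt (kabs (k - j)).
Proof.
rewrite -(@ler_sqr R) ?nnegrE ?normr_ge0 ?mulr_ge0 ?sqrtr_ge0//.
rewrite exprMn !sqr_sqrtr ?kabs_ge0// expr2.
by apply: ler_pM => //; [exact: csym_le|exact: csym_le_r].
Qed.

Lemma weight_le (psi : R) (k j : freq) (z : R[i]) : 0 <= psi ->
  normc ((csym R j (k - j) * wexp s psi k j (k - j))%:C%C * z)
    <= Num.sqrt (kabs k) * Num.sqrt (kabs (k - j)) * normc z.
Proof.
move=> p0; rewrite normcM normc_real ler_wpM2r ?normc_ge0//.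
rewrite normrM -[leRHS]mulr1 ler_pM// ?csym_le_sqrt//.
by rewrite ger0_norm ?wexp_ge0 ?wexp_le1.
Qed.

Lemma nlin_diff (K : nat) (psi : R) (U W : coefs R) k :
  nlin K s psi U U k - nlin K s psi W W k =
  nlin K s psi (fun j => U j - W j) U k + nlin K s psi W (fun j => U j - W j) k.
Proof.
rewrite /nlin -sumrB -big_split/=; apply: eq_bigr => j _.
by rewrite -mulrBr -mulrDr; congr (_ * _); ring.
Qed.

(** The difference is N(w, U) + N(W, w). The half derivative on the second factor falls on U in the
    first term, which costs A2 and needs a smooth U, and on w in the second, which costs only the
    l^1 norm A1 of W. So W needs no extra smoothness. *)
Lemma nlin_diff_pairing (K : nat) (psi A1 A2 : R) (U W w : coefs R) :
  w = (fun j => U j - W j) -> 0 <= psi ->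
  \sum_(j <- modes K) normc (W j) <= A1 ->
  \sum_(j <- modes K) Num.sqrt (kabs j) * normc (U j) <= A2 ->
  `|\sum_(k <- modes K) Re (conjc (w k) * (nlin K s psi U U k - nlin K s psi W W k))|
  <= \sum_(k <- modes K) ((A1 + A2 / 2) * kabs k + A2 / 2) * normc (w k) ^+ 2.
Proof.
move=> wE p0 hA1 hA2; apply: le_trans (ler_norm_sum _ _ _) _.
pose h k := Num.sqrt (kabs k) * normc (w k).
have hk k : h k ^+ 2 = kabs k * normc (w k) ^+ 2 by rewrite exprMn sqr_sqrtr ?kabs_ge0.
have T1 k : normc (conjc (w k) * nlin K s psi w U k) <= \sum_(j <- modes K | k - j \in modes K)
    (Num.sqrt (kabs (k - j)) * normc (U (k - j))) * (h k * normc (w j)).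
  rewrite normcM normcJ.
  apply: (@le_trans _ _ (normc (w k) * \sum_(j <- modes K | k - j \in modes K)
     Num.sqrt (kabs k) * Num.sqrt (kabs (k - j)) * normc (w j * U (k - j)))).
    rewrite ler_wpM2l ?normc_ge0//; apply: le_trans (normc_sum _ _ _) _.
    by apply: ler_sum => j _; exact: weight_le.
  rewrite mulr_sumr; apply: ler_sum => j _; rewrite normcM /h.
  by rewrite le_eqVlt; apply/orP; left; apply/eqP; ring.
have T2 k : normc (conjc (w k) * nlin K s psi W w k) <= \sum_(j <- modes K | k - j \in modes K)
    normc (W j) * (h k * h (k - j)).
  rewrite normcM normcJ.
  apply: (@le_trans _ _ (normc (w k) * \sum_(j <- modes K | k - j \in modes K)
     Num.sqrt (kabs k) * Num.sqrt (kabs (k - j)) * normc (W j * w (k - j)))).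
    rewrite ler_wpM2l ?normc_ge0//; apply: le_trans (normc_sum _ _ _) _.
    by apply: ler_sum => j _; exact: weight_le.
  rewrite mulr_sumr; apply: ler_sum => j _; rewrite normcM /h.
  by rewrite le_eqVlt; apply/orP; left; apply/eqP; ring.
apply: (@le_trans _ _ (\sum_(k <- modes K) (\sum_(j <- modes K | k - j \in modes K)
    (Num.sqrt (kabs (k - j)) * normc (U (k - j))) * (h k * normc (w j)) +
    \sum_(j <- modes K | k - j \in modes K) normc (W j) * (h k * h (k - j))))).
  apply: ler_sum => k _; rewrite nlin_diff -wE; apply: le_trans (Re_le_normc _) _.
  by rewrite mulrDr; apply: le_trans (normcD_le _ _) _; exact: lerD.
rewrite big_split/=.
have C1 := @convr_le R K (fun l => Num.sqrt (kabs l) * normc (U l)) h (fun j => normc (w j)).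
have C2 := @convl_le R K (fun l => normc (W l)) h h.
have {}C1 := C1 (fun l => mulr_ge0 (sqrtr_ge0 _) (normc_ge0 _)).
have {}C2 := C2 (fun l => normc_ge0 _).
apply: le_trans (lerD C1 C2) _.
rewrite (eq_bigr _ (fun k _ => hk k)).
set S1 := \sum_(k <- modes K) kabs k * _; set S0 := \sum_(k <- modes K) normc (w k) ^+ 2.
have -> : \sum_(k <- modes K) ((A1 + A2 / 2) * kabs k + A2 / 2) * normc (w k) ^+ 2 =
    (A1 + A2 / 2) * S1 + A2 / 2 * S0.
  rewrite /S1 /S0 !mulr_sumr -big_split/=; apply: eq_bigr => k _; ring.
have S10 : 0 <= S1 by apply: sumr_ge0 => k _; rewrite mulr_ge0 ?kabs_ge0 ?sqr_ge0.
have S00 : 0 <= S0 by apply: sumr_ge0 => k _; rewrite sqr_ge0.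
have E1 : 0 <= S1 / 2 + S0 / 2 by rewrite addr_ge0 ?mulr_ge0.
have E2 : 0 <= S1 / 2 + S1 / 2 by rewrite addr_ge0 ?mulr_ge0.
apply: le_trans (lerD (ler_wpM2r E1 hA2) (ler_wpM2r E2 hA1)) _.
by rewrite le_eqVlt; apply/orP; left; apply/eqP; field.
Qed.
End difference.

(** * Gronwall estimate for two perturbed truncated solutions *)

Section stability.
Variables (R : realType) (K : nat) (s mu A1 A2 Lam eta G : R) (D : freq -> R) (psi : R -> R).
Variables (U W e1 e2 : R -> coefs R).
Hypotheses (s0 : 0 < s) (s1 : s <= 1) (Lam0 : 0 <= Lam) (eta0 : 0 <= eta) (G0 : 0 <= G).
Local Notation kabs := (@kabs R).
Hypothesis D_ge : forall k, k \in modes K -> mu * kabs k `^ (2 * s) <= D k.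
Hypothesis psi0 : forall t, 0 < t -> 0 <= psi t.
Hypothesis Lam_ge : forall k, k \in modes K ->
  (2 * A1 + A2) * kabs k + A2 <= 2 * (mu * kabs k `^ (2 * s)) + Lam.
Hypothesis U_eq : forall k, k \in modes K -> cders (U ^~ k)
  (fun t => - ((D k)%:C%C * U t k) - nlin K s (psi t) (U t) (U t) k + e1 t k).
Hypothesis W_eq : forall k, k \in modes K -> cders (W ^~ k)
  (fun t => - ((D k)%:C%C * W t k) - nlin K s (psi t) (W t) (W t) k + e2 t k).
Hypothesis e1_le : forall t k, 0 < t -> k \in modes K -> normc (e1 t k) <= eta * kabs k.
Hypothesis e2_le : forall t k, 0 < t -> k \in modes K -> normc (e2 t k) <= eta * kabs k.
Hypothesis W_le : forall t, 0 < t -> \sum_(j <- modes K) normc (W t j) <= A1.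
Hypothesis U_le : forall t, 0 < t -> \sum_(j <- modes K) Num.sqrt (kabs j) * normc (U t j) <= A2.
Hypothesis diff_le : forall t, 0 < t -> \sum_(k <- modes K) kabs k * normc (U t k - W t k) <= G.
Hypothesis UW0 : forall k, k \in modes K -> U 0 k = W 0 k.

(** [Lam_ge] lets the dissipation absorb the |k|-part of [nlin_diff_pairing], so y' <= Lam y + 4 eta
    G: a factor 2 from the square, another from the two error terms, and G bounds the sum of |k|
    |w_k| against which they are tested. *)
Theorem stability t : 0 <= t ->
  \sum_(k <- modes K) normc (U t k - W t k) ^+ 2 <= 4 * eta * G * t * expR (Lam * t).
Proof.
pose w t k := U t k - W t k.
pose y t := hsum K 0 (w t).
have yE u : y u = \sum_(k <- modes K) normc (U u k - W u k) ^+ 2.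
  by apply: eq_bigr => k _; rewrite mulr0 powRr0 mul1r.
pose dw t k := - ((D k)%:C%C * w t k)
  - (nlin K s (psi t) (U t) (U t) k - nlin K s (psi t) (W t) (W t) k) + (e1 t k - e2 t k).
have hw k : k \in modes K -> cders (w ^~ k) (dw ^~ k).
  move=> kK; apply: cders_ext (cders_sub (U_eq kK) (W_eq kK)) _ => u _.
  by rewrite /dw /w; ring.
have dy := hsum_ders 0 hw.
have dy_le u : 0 < u -> 2 * \sum_(k <- modes K) kabs k `^ (2 * 0) * Re (conjc (w u k) * dw u k) <=
    Lam * y u + 4 * eta * G.
  move=> u0; under eq_bigr do rewrite mulr0 powRr0 mul1r.
  pose n k := nlin K s (psi u) (U u) (U u) k - nlin K s (psi u) (W u) (W u) k.
  have P := nlin_diff_pairing s0 s1 (erefl (w u)) (psi0 u0) (W_le u0) (U_le u0).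
  have E : \sum_(k <- modes K) Re (conjc (w u k) * (e1 u k - e2 u k)) <= 2 * eta * G.
    apply: (@le_trans _ _ (\sum_(k <- modes K) (2 * eta) * (kabs k * normc (U u k - W u k)))).
      rewrite big_seq [leRHS]big_seq; apply: ler_sum => k kK.
      apply: le_trans (ler_norm _) (le_trans (Re_le_normc _) _).
      rewrite normcM normcJ.
      have h : normc (e1 u k - e2 u k) <= 2 * (eta * kabs k).
        apply: le_trans (normcD_le _ _) _; rewrite normc_opp.
        by rewrite [2 * _]mulr_natl mulr2n lerD ?e1_le ?e2_le.
      apply: le_trans (ler_wpM2l (normc_ge0 _) h) _.
      by rewrite le_eqVlt; apply/orP; left; apply/eqP; rewrite /w; ring.
    by rewrite -mulr_sumr ler_wpM2l ?diff_le// mulr_ge0.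
  have Q : \sum_(k <- modes K) Re (conjc (w u k) * dw u k) =
      - \sum_(k <- modes K) D k * normc (w u k) ^+ 2
      - \sum_(k <- modes K) Re (conjc (w u k) * n k)
      + \sum_(k <- modes K) Re (conjc (w u k) * (e1 u k - e2 u k)).
    rewrite -!sumrN -!big_split/=; apply: eq_bigr => k _.
    rewrite /dw -/(n k) mulrDr mulrBr raddfD raddfB/=; congr (_ - _ + _).
    rewrite normc_sqr; case: (w u k) => p q; rewrite /=; ring.
  have {}P := le_trans (ler_norm _) (le_trans (_ : `|- _| <= `|_|) P).
  have {}P : - \sum_(k <- modes K) Re (conjc (w u k) * n k) <=
      \sum_(k <- modes K) ((A1 + A2 / 2) * kabs k + A2 / 2) * normc (w u k) ^+ 2.
    by apply: P; rewrite normrN.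
  have L : \sum_(k <- modes K) ((A1 + A2 / 2) * kabs k + A2 / 2) * normc (w u k) ^+ 2 -
     \sum_(k <- modes K) D k * normc (w u k) ^+ 2 <= Lam / 2 * y u.
    rewrite yE mulr_sumr -sumrB big_seq [leRHS]big_seq; apply: ler_sum => k kK.
    rewrite -mulrBl ler_wpM2r ?sqr_ge0//.
    have := Lam_ge kK; have := D_ge kK; move: (D k) (kabs k) (kabs k `^ _).
    by move=> x z v h1 h2; lra.
  rewrite Q; move: E P L; move: (\sum_(k <- _) _) (\sum_(k <- _) _) (\sum_(k <- _) _) (\sum_(k <- _) _) (y u).
  by move=> x1 x2 x3 x4 x5; lra.
move=> t0; rewrite -yE.
have c0 : 0 <= 4 * eta * G by rewrite !mulr_ge0.
have dE := ders_expR 0 (- Lam).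
have dz := ders_sub (ders_mul dE dy) (ders_scale (4 * eta * G) (@ders_id R)).
have := ders_nincr dz _ (lexx 0) t0; rewrite /= !add0r !mulr0 subr0.
have -> : hsum K 0 (w 0) = 0.
  by rewrite -/(y 0) yE big_seq big1// => k kK; rewrite UW0// subrr normc0 expr0n.
rewrite mulr0 => h.
have {}h : expR (- Lam * t) * y t <= 4 * eta * G * t.
  rewrite -subr_le0; apply: h => u u0; have := dy_le u u0; rewrite mulr0.
  have : expR (0 + - Lam * u) <= 1.
    by rewrite add0r -expR0 ler_expR mulNr oppr_le0 mulr_ge0// ltW.
  rewrite -/(y u); have := expR_gt0 (0 + - Lam * u).
  move: (expR _) (2 * \sum_(k <- _) _) (y u) => x z v; move: c0.
  move: (4 * eta * G) => c c0 x0 x1 h.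
  have h1 := ler_wpM2l (ltW x0) h; have h2 := ler_wpM2r c0 x1.
  by lra.
have -> : y t = expR (Lam * t) * (expR (- Lam * t) * y t).
  by rewrite mulrA -expRD mulNr subrr expR0 mul1r.
by rewrite [leRHS]mulrC ler_wpM2l ?expR_ge0.
Qed.
End stability.

(** * Infinite sums over the lattice *)

Lemma le_eps_scale (R : realFieldType) (x C : R) : 0 <= C ->
  (forall e, 0 < e -> x <= C * e) -> x <= 0.
Proof.
move=> C0 h; rewrite leNgt; apply/negP => x0.
have C1 : 0 < C + 1 by rewrite ltr_wpDl.
have e0 : 0 < x / (C + 1) by rewrite divr_gt0.
have := h _ e0; rewrite mulrA ler_pdivlMr// => h1.
by move: h1 x0; lra.
Qed.

Section power_sums.
Variables (R : realType) (a : R).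
Hypothesis a1 : 1 < a.

(** Replaces the comparison of the sum of n^(-a) with an integral; it follows from e^y >= 1 + y and
    ln(1 - z) <= -z with z = 1/(x + 1). *)
Lemma powR_telescope (x : R) : 0 < x ->
  (a - 1) * (x + 1) `^ (- a) <= x `^ (1 - a) - (x + 1) `^ (1 - a).
Proof.
move=> x0; have x10 : 0 < x + 1 by rewrite addr_gt0.
have -> : x `^ (1 - a) = (x + 1) `^ (1 - a) * (x / (x + 1)) `^ (1 - a).
  by rewrite -powRM ?divr_ge0 ?(ltW x0) ?(ltW x10)// [_ * (x / _)]mulrC divfK ?gt_eqF.
have -> : (x + 1) `^ (- a) = (x + 1) `^ (1 - a) * (x + 1)^-1.
  by rewrite -powR_inv1 ?(ltW x10)// -powRDp//; congr (_ `^ _); ring.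
suff H : (a - 1) * (x + 1)^-1 <= (x / (x + 1)) `^ (1 - a) - 1.
  have := ler_wpM2l (powR_ge0 (x + 1) (1 - a)) H.
  by move: ((x + 1)^-1) ((x + 1) `^ (1 - a)) ((x / _) `^ (1 - a)) => z u v; lra.
have y0 : 0 < x / (x + 1) by rewrite divr_gt0.
rewrite /powR gt_eqF//.
have h := expR_ge1Dx ((1 - a) * ln (x / (x + 1))).
have l : ln (x / (x + 1)) <= - (x + 1)^-1.
  have -> : x / (x + 1) = 1 + (- (x + 1)^-1) by field; rewrite gt_eqF.
  by apply: le_ln1Dx; rewrite ltrN2 invf_lt1// ltrDr.
have : (1 - a) * - (x + 1)^-1 <= (1 - a) * ln (x / (x + 1)).
  by apply: ler_wnM2l => //; rewrite subr_le0 ltW.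
by move: h; move: ((x + 1)^-1) ((1 - a) * ln _) (expR _) => z v u; lra.
Qed.

Lemma sum_powR_le (N : nat) :
  \sum_(0 <= n < N) (n.+1%:R : R) `^ (- a) <= 1 + (a - 1)^-1.
Proof.
have a10 : 0 < a - 1 by rewrite subr_gt0.
case: N => [|N]; first by rewrite big_geq// addr_ge0// invr_ge0 ltW.
apply: (@le_trans _ _ (1 + (a - 1)^-1 * (1 - (N.+1%:R : R) `^ (1 - a)))); last first.
  by rewrite lerD2l -[leRHS]mulr1 ler_wpM2l ?invr_ge0 ?(ltW a10)// gerBl powR_ge0.
elim: N => [|N IHN].
  by rewrite big_nat1 !powR1 subrr mulr0 addr0.
rewrite big_nat_recr//=; apply: le_trans (lerD IHN (lexx _)) _.
have h : N.+2%:R `^ (- a) <= (a - 1)^-1 * (N.+1%:R `^ (1 - a) - N.+2%:R `^ (1 - a)).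
  by rewrite ler_pdivlMl//; have := powR_telescope (ltr0Sn R N); rewrite natr1.
apply: le_trans (lerD (lexx _) h) _.
by rewrite -addrA lerD2l -mulrDr; apply: ler_wpM2l; [rewrite invr_ge0 ltW|lra].
Qed.

(** For k = (i, j), (1 + |i|)(1 + |j|) <= (2 |k|)^2 splits |k|^(-2a) into a product of
    one-dimensional terms; 2 (1 + 1/(a-1)) bounds each sum, once for i >= 0 and once for i < 0. *)
Definition modes_const : R := 2 `^ (2 * a) * (2 * (1 + (a - 1)^-1)) ^+ 2.

Lemma modes_const_ge0 : 0 <= modes_const.
Proof. by rewrite mulr_ge0 ?powR_ge0 ?sqr_ge0. Qed.

Lemma sum_kabs_powR_le (N : nat) : \sum_(k <- modes N) kabs R k `^ (- (2 * a)) <= modes_const.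
Proof.
have a0 : 0 < a by rewrite (lt_trans ltr01).
pose f (i : int) : R := (1 + `|i|%:R) `^ (- a).
have f0 i : 0 <= f i by exact: powR_ge0.
have S1 : \sum_(i <- irange N) f i <= 2 * (1 + (a - 1)^-1).
  pose g (n : nat) : R := (n.+1%:R : R) `^ (- a).
  rewrite (bigID (fun i : int => 0 <= i))/= [leRHS]mulr_natl mulr2n.
  have H (P : pred int) : (forall i j : int, P i -> P j -> `|i|%N = `|j|%N -> i = j) ->
      \sum_(i <- irange N | P i) f i <= 1 + (a - 1)^-1.
    move=> inj; apply: le_trans (sum_powR_le N.+1).
    rewrite -big_filter.
    have -> : \sum_(i <- [seq i <- irange N | P i]) f i =
       \sum_(n <- map absz [seq i <- irange N | P i]) g n.
      by rewrite big_map; apply: eq_bigr => i _; rewrite /f /g -natr1 addrC.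
    apply: sum_uniq_subset.
    - rewrite map_inj_in_uniq ?filter_uniq ?irange_uniq// => i j.
      by rewrite !mem_filter => /andP[iP _] /andP[jP _]; exact: inj.
    - exact: iota_uniq.
    - apply/allP; rewrite all_map; apply/allP => i; rewrite mem_filter mem_irange => /andP[_ iN].
      by rewrite /= mem_index_iota/= ltnS.
    - by move=> *; exact: powR_ge0.
  by apply: lerD; apply: H => i j; lia.
apply: (@le_trans _ _ (\sum_(i <- irange N) \sum_(j <- irange N) 2 `^ (2 * a) * (f i * f j))).
  rewrite /modes big_filter big_mkcond big_allpairs/=; apply: ler_sum => i _.
  apply: ler_sum => j _; case: ifP => k0; last by rewrite !mulr_ge0 ?powR_ge0.
  set k : freq := (i, j); have kk := kabs_gt0 R k0; have k1 := kabs_ge1 R k0.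
  have E : (1 + `|i|%:R) * (1 + `|j|%:R) <= (2 * kabs R k) ^+ 2 :> R.
    have hi : `|i|%:R <= kabs R k.
      by apply: le_trans (msup_le_kabs R k); rewrite ler_nat leq_maxl.
    have hj : `|j|%:R <= kabs R k.
      by apply: le_trans (msup_le_kabs R k); rewrite ler_nat leq_maxr.
    rewrite expr2 ler_pM ?addr_ge0//; move: hi hj k1; move: (kabs R k) => x; lra.
  rewrite /f -powRM ?addr_ge0// !powRN; move: E; set X : R := (1 + _) * _ => E.
  have X0 : 0 < X by rewrite mulr_gt0 ?ltr_pwDl.
  rewrite ler_pdivlMr ?powR_gt0// ler_pdivrMl ?powR_gt0// mulrC -powRM ?(ltW kk)// powRrM.
  apply: ge0_ler_powR; rewrite ?nnegrE ?(ltW a0) ?(ltW X0) ?powR_ge0//.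
  by rewrite powR_mulrn ?mulr_ge0 ?(ltW kk).
have -> : \sum_(i <- irange N) \sum_(j <- irange N) 2 `^ (2 * a) * (f i * f j) =
    2 `^ (2 * a) * (\sum_(i <- irange N) f i) ^+ 2.
  rewrite expr2 mulr_suml mulr_sumr; apply: eq_bigr => i _.
  by rewrite !mulr_sumr.
rewrite ler_wpM2l ?powR_ge0// lerXn2r// ?nnegrE ?sumr_ge0// (le_trans _ S1)// sumr_ge0//.
Qed.
End power_sums.

(** * Infinite sums as limits of sums over boxes *)

Section boxes.
Variable R : realType.
Implicit Types (F : freq -> R) (r : seq freq).

Lemma sum_le_boxes F (C : R) r : uniq r -> (forall k, 0 <= F k) -> F 0 = 0 ->
  (forall N, \sum_(k <- modes N) F k <= C) -> \sum_(k <- r) F k <= C.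
Proof.
move=> ur F0 F00 h; apply: le_trans (h (\max_(k <- r) msup k)%N).
rewrite (bigID (fun k => k != 0))/= [X in _ + X]big1 ?addr0; last first.
  by move=> k; rewrite negbK => /eqP->.
rewrite -big_filter; apply: sum_uniq_subset => //; [exact: filter_uniq|exact: modes_uniq|].
move=> k; rewrite mem_filter mem_modes => /andP[-> kr] /=.
exact: leq_bigmax_seq.
Qed.

Lemma sum_inj_boxes F (C : R) (h : freq -> freq) (P : pred freq) r : uniq r -> injective h ->
  (forall k, 0 <= F k) -> F 0 = 0 -> (forall N, \sum_(k <- modes N) F k <= C) ->
  \sum_(k <- r | P k) F (h k) <= C.
Proof.
move=> ur hi F0 F00 hC; rewrite -big_filter -(big_map h predT).
by apply: sum_le_boxes => //; rewrite map_inj_uniq// filter_uniq.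
Qed.

Lemma sum_modes_split (V : nmodType) (K M : nat) (F : freq -> V) : (K <= M)%N ->
  \sum_(k <- modes M) F k =
  \sum_(k <- modes K) F k + \sum_(k <- modes M | k \notin modes K) F k.
Proof.
move=> KM; rewrite (bigID (mem (modes K)))/=; congr (_ + _).
rewrite -big_filter; apply/perm_big/uniq_perm; [exact/filter_uniq/modes_uniq|exact: modes_uniq|].
by move=> k; rewrite mem_filter; case: (boolP (k \in modes K)) => //= /(modes_sub KM) ->.
Qed.


Section esum.
Variables (S : set freq) (F : freq -> R).
Hypotheses (S_sub : forall k, k != 0 -> S k) (F0 : forall k, 0 <= F k) (F00 : F 0 = 0).

Lemma boxes_le_esum N : ((\sum_(k <- modes N) F k)%:E <= \esum_(k in S) (F k)%:E)%E.
Proof.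
apply: esum_ge; exists [set` modes N].
  by split=> [|k /=]; [exact: finite_seq|rewrite mem_modes => /andP[/S_sub]].
by rewrite -fsbig_seq ?modes_uniq// sumEFin.
Qed.

Lemma esum_le_boxes (C : R) : (forall N, \sum_(k <- modes N) F k <= C) ->
  (\esum_(k in S) (F k)%:E <= C%:E)%E.
Proof.
move=> hC; apply: ge_ereal_sup => _ [A [fA _] <-].
rewrite fsbig_finite//= sumEFin lee_fin; apply: sum_le_boxes => //.
exact: finmap.fset_uniq.
Qed.
End esum.

Lemma boxes_bound F (tau : R) K : (forall k, 0 <= F k) ->
  (forall M, (K <= M)%N -> \sum_(k <- modes M | k \notin modes K) F k <= tau) ->
  forall N, \sum_(k <- modes N) F k <= \sum_(k <- modes K) F k + tau.
Proof.
move=> F0 h N; have [KN|NK] := leqP K N; first by rewrite (sum_modes_split _ KN) lerD2l h.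
rewrite (sum_modes_split _ (ltnW NK)) -addrA lerDl addr_ge0 ?sumr_ge0//.
by apply: le_trans (h K (leqnn K)); rewrite sumr_ge0.
Qed.

Lemma esum_approx F (tau : R) K : (forall k, 0 <= F k) -> F 0 = 0 ->
  (forall M, (K <= M)%N -> \sum_(k <- modes M | k \notin modes K) F k <= tau) ->
  \sum_(k <- modes K) F k <= fine (\esum_(k in [set: freq]) (F k)%:E)
    <= \sum_(k <- modes K) F k + tau.
Proof.
move=> F0 F00 h.
have le1 := @boxes_le_esum [set: freq] F (fun _ _ => I) K.
have le2 := @esum_le_boxes [set: freq] F F0 F00 _ (boxes_bound F0 h).
have : (\esum_(k in [set: freq]) (F k)%:E)%E \is a fin_num.
  rewrite ge0_fin_numE; first by apply: le_lt_trans le2 _; rewrite ltry.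
  by apply: esum_ge0 => k _; rewrite lee_fin.
by move=> /fineK e; move: le1 le2; rewrite -e !lee_fin => -> ->.
Qed.

(** The sums of the positive and of the negative part each exceed their box sums by an amount in
    [0, tau]; these errors enter with opposite signs, so the total error is tau rather than 2
    tau. *)
Lemma rsum_approx F (tau : R) K : F 0 = 0 ->
  (forall M, (K <= M)%N -> \sum_(k <- modes M | k \notin modes K) `|F k| <= tau) ->
  `|rsum F - \sum_(k <- modes K) F k| <= tau.
Proof.
move=> F00 h.
have part (G : freq -> R) : (forall k, 0 <= G k) -> (forall k, G k <= `|F k|) ->
    \sum_(k <- modes K) G k <= fine (\esum_(k in [set: freq]) (G k)%:E)
    <= \sum_(k <- modes K) G k + tau.
  move=> G0 GF; apply: esum_approx => //.
    by apply/eqP; rewrite eq_le G0 andbT -(normr0 R) -F00.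
  by move=> M KM; apply: le_trans (h M KM); apply: ler_sum => k _.
have e1 k : ((EFin \o F)^\+ k = (Num.max (F k) 0)%:E)%E.
  by rewrite unlock/= -EFin_max.
have e2 k : ((EFin \o F)^\- k = (Num.max (- F k) 0)%:E)%E.
  by rewrite unlock/= -EFin_max.
rewrite /rsum (eq_esum (fun k _ => e1 k)) (eq_esum (fun k _ => e2 k)).
have /andP[p1 p2] := part (fun k => Num.max (F k) 0)
  (fun k => ltac:(by rewrite le_max lexx orbT))
  (fun k => ltac:(by rewrite ge_max normr_ge0 ler_norm)).
have /andP[q1 q2] := part (fun k => Num.max (- F k) 0)
  (fun k => ltac:(by rewrite le_max lexx orbT))
  (fun k => ltac:(by rewrite ge_max normr_ge0 -normrN ler_norm)).
have -> : \sum_(k <- modes K) F k =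
    \sum_(k <- modes K) Num.max (F k) 0 - \sum_(k <- modes K) Num.max (- F k) 0.
  rewrite -sumrB; apply: eq_bigr => k _; have [h'|h'] := leP (F k) 0.
    by rewrite max_l ?oppr_ge0// sub0r opprK.
  by rewrite max_r ?oppr_le0 ?(ltW h')// subr0.
move: p1 p2 q1 q2; move: (fine _) (fine _) => x y p1 p2 q1 q2.
by rewrite ler_norml; apply/andP; split; lra.
Qed.

Lemma csum_approx (f : freq -> R[i]) (tau : R) K : f 0 = 0 ->
  (forall M, (K <= M)%N -> \sum_(k <- modes M | k \notin modes K) normc (f k) <= tau) ->
  normc (csum f - \sum_(k <- modes K) f k) <= 2 * tau.
Proof.
move=> f0 h; apply: le_trans (normc_le_parts _) _.
rewrite [2 * _]mulr_natl mulr2n; apply: lerD.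
  have -> : Re (csum f - \sum_(k <- modes K) f k) =
    rsum (fun k => Re (f k)) - \sum_(k <- modes K) Re (f k) by rewrite raddfB raddf_sum.
  apply: rsum_approx; first by rewrite f0.
  by move=> M KM; apply: le_trans (h M KM); apply: ler_sum => k _; exact: Re_le_normc.
have -> : Im (csum f - \sum_(k <- modes K) f k) =
    rsum (fun k => Im (f k)) - \sum_(k <- modes K) Im (f k) by rewrite raddfB raddf_sum.
apply: rsum_approx; first by rewrite f0.
by move=> M KM; apply: le_trans (h M KM); apply: ler_sum => k _; exact: Im_le_normc.
Qed.

Lemma csummable_boxes (f : freq -> R[i]) (C : R) : f 0 = 0 ->
  (forall N, \sum_(k <- modes N) normc (f k) <= C) -> csummable f.
Proof.
move=> f0 h; rewrite /csummable /summable.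
under eq_esum do rewrite abse_EFin ger0_norm ?normc_ge0//.
apply: le_lt_trans (ltry C); apply: esum_le_boxes => //; first by move=> k; exact: normc_ge0.
by rewrite f0 normc0.
Qed.

Lemma csum_cvg (f : freq -> R[i]) (C : R) : f 0 = 0 ->
  (forall N, \sum_(k <- modes N) normc (f k) <= C) ->
  forall e, 0 < e -> exists K0, forall K, (K0 <= K)%N ->
    normc (csum f - \sum_(k <- modes K) f k) <= e.
Proof.
move=> f0 h e e0; pose S := [set \sum_(k <- modes N) normc (f k) | N in [set: nat]].
have hS : has_sup S.
  by split; [exists (\sum_(k <- modes 0) normc (f k)), 0%N|exists C => _ [N _ <-]; exact: h].
have e2 : 0 < e / 2 by rewrite divr_gt0.
have [_ [K0 _ <-] hK] := sup_adherent e2 hS.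
have mono K M : (K <= M)%N -> \sum_(k <- modes K) normc (f k) <= \sum_(k <- modes M) normc (f k).
  by move=> KM; rewrite (sum_modes_split _ KM) lerDl sumr_ge0// => k _; exact: normc_ge0.
exists K0 => K K0K; have -> : e = 2 * (e / 2) by rewrite mulrC divfK.
apply: csum_approx => // M KM.
have : \sum_(k <- modes M) normc (f k) <= sup S by apply: sup_upper_bound => //; exists M.
rewrite (sum_modes_split _ KM); have := mono _ _ K0K; move: hK.
by move: (\sum_(_ <- _ | _) _) (\sum_(_ <- _) _) (\sum_(_ <- _) _) => z x y; lra.
Qed.

(** [csum] is built from positive and negative parts and is not visibly linear; finite box sums are,
    and all three sums are limits of them. *)
Lemma csum_lin (f g h : freq -> R[i]) (c C : R) : (forall j, f j + g j = c%:C%C * h j) ->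
  f 0 = 0 -> g 0 = 0 -> h 0 = 0 ->
  (forall N, \sum_(k <- modes N) normc (f k) <= C) ->
  (forall N, \sum_(k <- modes N) normc (g k) <= C) ->
  (forall N, \sum_(k <- modes N) normc (h k) <= C) ->
  csum f + csum g = c%:C%C * csum h.
Proof.
move=> fgh f0 g0 h0 bf bg bh; apply/eqP; rewrite -subr_eq0; apply/eqP.
apply: eq0_normc; apply/eqP; rewrite eq_le normc_ge0 andbT.
apply: (@le_eps_scale _ _ (1 + 1 + `|c|)) => [|e e0]; first by rewrite !addr_ge0.
have [K1 h1] := csum_cvg f0 bf e0; have [K2 h2] := csum_cvg g0 bg e0.
have [K3 h3] := csum_cvg h0 bh e0.
pose K := maxn K1 (maxn K2 K3).
have {}h1 := h1 K (leq_maxl _ _).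
have {}h2 := h2 K (leq_trans (leq_maxl _ _) (leq_maxr _ _)).
have {}h3 := h3 K (leq_trans (leq_maxr _ _) (leq_maxr _ _)).
have E : \sum_(k <- modes K) f k + \sum_(k <- modes K) g k = c%:C%C * \sum_(k <- modes K) h k.
  by rewrite -big_split mulr_sumr; apply: eq_bigr => k _; exact: fgh.
have -> : csum f + csum g - c%:C%C * csum h = (csum f - \sum_(k <- modes K) f k) +
    (csum g - \sum_(k <- modes K) g k) - c%:C%C * (csum h - \sum_(k <- modes K) h k).
  by rewrite [X in _ = _ - X]mulrBr -E; ring.
apply: le_trans (normcD_le _ _) _; rewrite normc_opp normcM normc_real.
rewrite !mulrDl !mul1r; apply: lerD; last by rewrite ler_wpM2l.
by apply: le_trans (normcD_le _ _) _; exact: lerD.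
Qed.
End boxes.

Definition fnl (R : realType) (s psi : R) (U : coefs R) : coefs R := fun k =>
  csum (fun j => (csym R j (k - j) * wexp s psi k j (k - j))%:C%C * (U j * U (k - j))).

(** * The untruncated nonlinearity and its truncation error *)

Section nonlinearity.
Variables (R : realType) (s a psi M : R) (U : coefs R).
Hypotheses (s0 : 0 < s) (s1 : s <= 1) (a0 : 0 <= a) (psi0 : 0 <= psi).
Hypothesis U_bound : forall N, hsum N a U <= M ^+ 2.
Hypothesis U0 : U 0 = 0.
Local Notation kabs := (@kabs R).

Let F j : R := kabs j `^ (2 * a) * normc (U j) ^+ 2.

Let F_ge0 j : 0 <= F j. Proof. by rewrite mulr_ge0 ?powR_ge0 ?sqr_ge0. Qed.
Let F0 : F 0 = 0. Proof. by rewrite /F U0 normc0 expr0n mulr0. Qed.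

Lemma l2_le_F j : normc (U j) ^+ 2 <= F j.
Proof.
have [->|j0] := eqVneq j 0; first by rewrite U0 normc0 expr0n.
rewrite /F -[leLHS]mul1r ler_wpM2r ?sqr_ge0//.
by rewrite -[leLHS](powRr0 (kabs j)); apply: ler_powR; rewrite ?kabs_ge1 ?mulr_ge0.
Qed.

(** Outside the box |k| >= K + 1, so |U_k| <= c |k|^a |U_k| with c = (K+1)^(-a); the
    arithmetic-geometric mean then leaves c times half the bound of [hsum] for each of the two
    factors. *)
Lemma conv_tail (K : nat) (h1 h2 : freq -> freq) (P : pred freq) (r : seq freq) :
  uniq r -> injective h1 -> injective h2 -> (forall j, P j -> h1 j \notin modes K) ->
  \sum_(j <- r | P j) normc (U (h1 j)) * normc (U (h2 j)) <= M ^+ 2 * K.+1%:R `^ (- a).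
Proof.
move=> ur i1 i2 hP; set c : R := K.+1%:R `^ (- a).
have c0 : 0 < c by rewrite powR_gt0.
apply: (@le_trans _ _ (\sum_(j <- r | P j) (c * (F (h1 j) / 2) + c * (F (h2 j) / 2)))); last first.
  rewrite big_split/= -!mulr_sumr -!mulr_suml -mulrDr mulrC ler_wpM2r ?(ltW c0)//.
  have h1' := @sum_inj_boxes R F (M ^+ 2) h1 P r ur i1 F_ge0 F0 U_bound.
  have h2' := @sum_inj_boxes R F (M ^+ 2) h2 P r ur i2 F_ge0 F0 U_bound.
  by move: h1' h2'; move: (\sum_(_ <- _ | _) _) (\sum_(_ <- _ | _) _) => x y; lra.
apply: ler_sum => j Pj; have [z|h10] := eqVneq (h1 j) 0.
  by rewrite z U0 normc0 mul0r -mulrDr mulr_ge0 ?addr_ge0 ?divr_ge0 ?(ltW c0).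
have big : K.+1%:R <= kabs (h1 j).
  apply: le_trans (msup_le_kabs R _); rewrite ler_nat.
  by move: (hP _ Pj); rewrite mem_modes h10/= -ltnNge.
have q1 : normc (U (h1 j)) ^+ 2 <= c ^+ 2 * F (h1 j).
  rewrite /F mulrA -[leLHS]mul1r ler_wpM2r ?sqr_ge0// powR_sqr /c mulrN powRN.
  rewrite -[leRHS]mulrC ler_pdivlMr ?powR_gt0// mul1r.
  by apply: ge0_ler_powR; rewrite ?nnegrE ?kabs_ge0 ?mulr_ge0.
have q2 := l2_le_F (h2 j).
have := sqr_ge0 (normc (U (h1 j)) - c * normc (U (h2 j))).
have := ler_wpM2l (sqr_ge0 c) q2.
move: (normc _) (normc _) (F _) (F _) c0 q1 => x y u v c0 h1' h2' h3.
have : 0 <= c * (c * (v / 2) + c * (u / 2) - y * x) by nra.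
by rewrite pmulr_rge0// subr_ge0.
Qed.

Let g k j := (csym R j (k - j) * wexp s psi k j (k - j))%:C%C * (U j * U (k - j)).

Let g_le k j : normc (g k j) <= kabs k * (normc (U j) * normc (U (k - j))).
Proof.
rewrite /g !normcM normc_real ler_wpM2r ?mulr_ge0 ?normc_ge0//.
rewrite normrM -[leRHS]mulr1 ler_pM// ?csym_le//.
by rewrite ger0_norm ?wexp_ge0 ?wexp_le1.
Qed.

(** Two thirds of the constant 3 come from j outside the box, for real and imaginary part; the last
    third from j inside but k - j outside. *)
Lemma fnl_approx (K : nat) (k : freq) :
  normc (fnl s psi U k - nlin K s psi U U k) <= 3 * (M ^+ 2 * K.+1%:R `^ (- a)) * kabs k.
Proof.
set tau := M ^+ 2 * _.
have i2 : injective (fun j : freq => k - j) by move=> x y /addrI /oppr_inj.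
have h1 : normc (fnl s psi U k - \sum_(j <- modes K) g k j) <= 2 * (kabs k * tau).
  apply: csum_approx; first by rewrite /g U0 mul0r mulr0.
  move=> N KN; apply: (@le_trans _ _ (\sum_(j <- modes N | j \notin modes K)
     kabs k * (normc (U j) * normc (U (k - j))))); first by apply: ler_sum => j _; exact: g_le.
  rewrite -mulr_sumr ler_wpM2l ?kabs_ge0//.
  by apply: (@conv_tail K id _ _ (modes N)) => //; exact: modes_uniq.
have h2 : normc (\sum_(j <- modes K) g k j - nlin K s psi U U k) <= kabs k * tau.
  have -> : \sum_(j <- modes K) g k j - nlin K s psi U U k =
      \sum_(j <- modes K | k - j \notin modes K) g k j.
    by rewrite (bigID (fun j => k - j \in modes K))/= -/(nlin K s psi U U k) addrAC subrr add0r.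
  apply: le_trans (normc_sum _ _ _) _.
  apply: (@le_trans _ _ (\sum_(j <- modes K | k - j \notin modes K)
     kabs k * (normc (U (k - j)) * normc (U j)))).
    by apply: ler_sum => j _; rewrite [_ * normc (U j)]mulrC; exact: g_le.
  rewrite -mulr_sumr ler_wpM2l ?kabs_ge0//.
  by apply: (@conv_tail K _ id _ (modes K)) => //; exact: modes_uniq.
have -> : fnl s psi U k - nlin K s psi U U k = (fnl s psi U k - \sum_(j <- modes K) g k j) +
   (\sum_(j <- modes K) g k j - nlin K s psi U U k) by ring.
by apply: le_trans (normcD_le _ _) _; move: h1 h2; move: (normc _) (normc _) => x y; lra.
Qed.

Lemma conv_bound (k : freq) (C : R) (g' : freq -> R[i]) : 0 <= C ->
  (forall j, normc (g' j) <= C * (normc (U j) * normc (U (k - j)))) ->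
  g' 0 = 0 /\ forall N, \sum_(j <- modes N) normc (g' j) <= C * M ^+ 2.
Proof.
move=> C0 h; have i2 : injective (fun j : freq => k - j) by move=> x y /addrI /oppr_inj.
split=> [|N].
  apply: eq0_normc; apply/eqP; rewrite eq_le normc_ge0 andbT.
  by apply: le_trans (h 0) _; rewrite U0 normc0 mul0r mulr0.
apply: (@le_trans _ _ (\sum_(j <- modes N) C * (normc (U j) * normc (U (k - j))))).
  by apply: ler_sum.
rewrite -mulr_sumr ler_wpM2l//.
apply: (@le_trans _ _ (\sum_(j <- modes N) (F j / 2 + F (k - j) / 2))).
  apply: ler_sum => j _; have := l2_le_F j; have := l2_le_F (k - j).
  have := sqr_ge0 (normc (U j) - normc (U (k - j))).
  by move: (normc _) (normc _) (F _) (F _) => x y u v; nra.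
rewrite big_split/= -!mulr_suml.
have h1 := U_bound N; have h2 := @sum_inj_boxes R F (M ^+ 2) _ predT _ (modes_uniq N) i2 F_ge0 F0 U_bound.
rewrite /hsum -/F in h1; move: h1 h2; rewrite /F; move: (\sum_(_ <- _) _) (\sum_(_ <- _) _).
by move=> x y; lra.
Qed.
End nonlinearity.

Lemma climit (R : realType) (u : nat -> R[i]) (e : nat -> R) (n0 : nat) :
  (forall n, 0 <= e n) ->
  (forall n m, (n0 <= n)%N -> (n <= m)%N -> normc (u n - u m) <= e n) ->
  exists l, forall n, (n0 <= n)%N -> normc (u n - l) <= 2 * e n.
Proof.
move=> e0 h.
have H (f : R[i] -> R) : (forall z w, f (z - w) = f z - f w) -> (forall z, `|f z| <= normc z) ->
    exists l, forall n, (n0 <= n)%N -> `|f (u n) - l| <= e n.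
  move=> fB fn.
  have [|n m nm|l hl] := @sup_limit R (fun n => f (u (n + n0)%N)) (fun n => e (n + n0)%N).
  - by move=> n; exact: e0.
  - by rewrite -fB; apply: le_trans (fn _) _; apply: h; rewrite ?leq_addl// leq_add2r.
  by exists l => n n0n; have := hl (n - n0)%N; rewrite subnK.
have [x hx] := H (fun z => Re z) (raddfB _) (@Re_le_normc R).
have [y hy] := H (fun z => Im z) (raddfB _) (@Im_le_normc R).
exists (Complex x y) => n nn; apply: le_trans (normc_le_parts _) _.
by rewrite [2 * _]mulr_natl mulr2n !raddfB/= lerD ?hx ?hy.
Qed.

Lemma max0_cont (R : realType) : continuous (fun t : R => Num.max t 0).
Proof. by under eq_fun do rewrite maxC; apply: cont_maxr => t; exact: cvg_id. Qed.

(** Convergence of the derivatives locally uniformly in time allows passing to the limit in the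
    integrated equation F = F 0 + [prim dF]; the limit equation is then differentiated again. *)
Lemma ders_limit (R : realType) (L : R) (f g : R -> R) : 0 < L ->
  (forall t, f t = f (Num.max t 0)) -> (forall t, g t = g (Num.max t 0)) ->
  (forall e, 0 < e -> exists F dF : R -> R, [/\ ders F dF, continuous dF,
     forall t, 0 <= t -> `|F t - f t| <= e * expR (L * t) &
     forall t, 0 <= t -> `|dF t - g t| <= e * expR (L * t)]) ->
  ders f g.
Proof.
move=> L0 fm gm h.
have mge (t : R) : 0 <= Num.max t 0 by rewrite le_max lexx orbT.
have unif (k : R -> R) : (forall t, k t = k (Num.max t 0)) ->
    (forall e, 0 < e -> exists2 K : R -> R, continuous K &
       forall t, 0 <= t -> `|K t - k t| <= e * expR (L * t)) -> continuous k.
  move=> km hk; apply: uniform_limit_cont => T e T0 e0.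
  have e'0 : 0 < e * expR (- (L * T)) by rewrite mulr_gt0 ?expR_gt0.
  have [K cK hK] := hk _ e'0; exists (fun t => K (Num.max t 0)).
    by apply: (cont_comp (@max0_cont R)).
  move=> t tT; rewrite km distrC; apply: le_trans (hK _ (mge t)) _.
  rewrite -[leRHS]mulr1 -mulrA ler_wpM2l ?(ltW e0)// -expRD -expR0 ler_expR.
  rewrite addrC subr_le0 ler_wpM2l ?(ltW L0)// ge_max (ltW T0) andbT.
  exact: le_trans (ler_norm t) tT.
have cg : continuous g.
  apply: unif gm _ => e /h[F [dF [_ cdF _ hd]]]; by exists dF.
have key t : 0 <= t -> f t = f 0 + prim g t.
  move=> t0; apply/eqP; rewrite -subr_eq0 -normr_le0.
  apply: (@le_eps_scale _ _ (expR (L * t) + (1 + expR (L * t) / L))).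
    by rewrite !addr_ge0 ?expR_ge0// divr_ge0 ?expR_ge0 ?(ltW L0).
  move=> e e0; have [F [dF [dFF cdF hF hd]]] := h _ e0.
  have FE : F t = F 0 + prim dF t.
    have d0 : ders (fun u => F u - prim dF u) (fun=> 0).
      by apply: ders_ext (ders_sub dFF (ders_prim cdF)) _ => u _; rewrite subrr.
    by have := ders_unique0 d0 t0; rewrite prim0 subr0 => <-; rewrite subrK.
  have P := @prim_sub_le R dF g e L t cdF cg (ltW e0) L0 (fun u u0 => hd u (ltW u0)) t0.
  have h0 := hF 0 (lexx 0); have ht := hF t t0; rewrite mulr0 expR0 mulr1 in h0.
  have -> : f t - (f 0 + prim g t) = - (F t - f t) + ((F 0 - f 0) + (prim dF t - prim g t)).
    by rewrite FE; ring.
  apply: le_trans (ler_normD _ _) _; rewrite normrN [leRHS]mulrDl; apply: lerD.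
    by rewrite mulrC.
  apply: le_trans (ler_normD _ _) _; rewrite mulrDl mul1r; apply: lerD => //.
  by have -> : expR (L * t) / L * e = e / L * expR (L * t) by ring.
have fE : f = (fun t => f 0 + prim g t).
  by apply/funext => t; rewrite fm key// -prim_max.
rewrite fE; apply: ders_ext (ders_add (ders_cst (f 0)) (ders_prim cg)) _ => t _.
by rewrite add0r.
Qed.

Lemma cders_limit (R : realType) (L : R) (f g : R -> R[i]) : 0 < L ->
  (forall t, f t = f (Num.max t 0)) -> (forall t, g t = g (Num.max t 0)) ->
  (forall e, 0 < e -> exists F dF : R -> R[i], [/\ cders F dF, ccont dF,
     forall t, 0 <= t -> normc (F t - f t) <= e * expR (L * t) &
     forall t, 0 <= t -> normc (dF t - g t) <= e * expR (L * t)]) ->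
  cders f g.
Proof.
move=> L0 fm gm h; split.
  apply: (ders_limit L0) => [t|t|e e0]; [by rewrite -fm|by rewrite -gm|].
  have [F [dF [[h1 _] [h2 _] h3 h4]]] := h e e0.
  exists (fun t => Re (F t)), (fun t => Re (dF t)); split=> // t t0.
    by apply: le_trans (h3 t t0); rewrite -raddfB; exact: Re_le_normc.
  by apply: le_trans (h4 t t0); rewrite -raddfB; exact: Re_le_normc.
apply: (ders_limit L0) => [t|t|e e0]; [by rewrite -fm|by rewrite -gm|].
have [F [dF [[_ h1] [_ h2] h3 h4]]] := h e e0.
exists (fun t => Im (F t)), (fun t => Im (dF t)); split=> // t t0.
  by apply: le_trans (h3 t t0); rewrite -raddfB; exact: Im_le_normc.
by apply: le_trans (h4 t t0); rewrite -raddfB; exact: Im_le_normc.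
Qed.

Lemma absorb_linear (R : realType) (A B mu p : R) : 0 <= A -> 0 <= B -> 0 < mu -> 1 < p ->
  exists2 L : R, 0 <= L & forall x, 1 <= x -> A * x + B <= mu * x `^ p + L.
Proof.
move=> A0 B0 mu0 p1; have p10 : 0 < p - 1 by rewrite subr_gt0.
(* At x0 the terms A x and mu x^p balance; beyond it the power wins, below it A x is at most A
   x0. *)
pose x0 := (A / mu) `^ (p - 1)^-1.
exists (A * x0 + B); first by rewrite addr_ge0// mulr_ge0// powR_ge0.
move=> x x1; have xp : 0 < x by rewrite (lt_le_trans ltr01).
have mp : 0 <= mu * x `^ p by rewrite mulr_ge0 ?powR_ge0 ?(ltW mu0).
have [xx|xx] := leP x x0.
  by rewrite addrA lerD2r -[leLHS]add0r lerD// ler_wpM2l.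
rewrite lerD//; last by rewrite lerDr mulr_ge0 ?powR_ge0.
have -> : x `^ p = x `^ (p - 1) * x.
  by rewrite -{3}[x]powRr1 ?(ltW xp)// -powRDp// subrK.
rewrite mulrA ler_wpM2r ?(ltW xp)// mulrC -ler_pdivrMr//.
have -> : A / mu = x0 `^ (p - 1).
  by rewrite /x0 -powRrM mulVf ?gt_eqF// powRr1// divr_ge0 ?(ltW mu0).
by apply: ge0_ler_powR; rewrite ?(ltW p10)// ?nnegrE ?powR_ge0 ?(ltW xp)// ltW.
Qed.

Lemma mul_rearr_le (R : realFieldType) (m n r x y : R) : 0 <= m * n * r -> x <= 2 * y ->
  4 * (6 * (m * r)) * (x * n) <= 48 * (m * n) * (y * r).
Proof. by move=> h /(ler_wpM2l h); lra. Qed.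

(** * Stability with constants independent of the truncation *)

Section bounded_stability.
Variables (R : realType) (s a eps mu M : R).
Hypotheses (s0 : 1 / 2 < s) (s1 : s <= 1) (a1 : 1 < a) (eps0 : 0 < eps) (mu0 : 0 < mu).
Local Notation kabs := (@kabs R).

(** |U_k| is the product of |k|^a |U_k| and |k|^(-a), and |k|^(-2a) is summable over the plane
    lattice as a > 1. *)
Lemma sum_normc_le (K : nat) (U : coefs R) : hsum K a U <= M ^+ 2 ->
  \sum_(k <- modes K) normc (U k) <= (M ^+ 2 + modes_const a) / 2.
Proof.
move=> h; have c := sum_kabs_powR_le a1 K.
apply: (@le_trans _ _ (\sum_(k <- modes K)
   (kabs k `^ (2 * a) * normc (U k) ^+ 2 / 2 + kabs k `^ (- (2 * a)) / 2))); last first.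
  rewrite big_split/= -!mulr_suml; move: h c; rewrite /hsum.
  by move: (\sum_(_ <- _) _) (\sum_(_ <- _) _) => x y; lra.
rewrite big_seq [leRHS]big_seq; apply: ler_sum => k; rewrite mem_modes => /andP[k0 _].
have kk := kabs_gt0 R k0; rewrite powRN -powR_sqr; have q0 := powR_gt0 a kk.
have := sqr_ge0 (kabs k `^ a * normc (U k) - (kabs k `^ a)^-1).
have qi : kabs k `^ a * (kabs k `^ a)^-1 = 1 by rewrite divff ?gt_eqF.
rewrite -exprVn; move: (normc _) (kabs k `^ a) ((kabs k `^ a)^-1) qi => x q y qi.
rewrite sqrrB; have -> : q * x * y = x by rewrite mulrAC qi mul1r.
by rewrite exprMn; lra.
Qed.

(** |k| <= |k|^a, and Cauchy-Schwarz over fewer than (2K+1)^2 points costs a factor 2K + 1. This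
    growth is what the truncation error K^(-a) has to beat. *)
Lemma sum_kabs_normc_le (K : nat) (U : coefs R) : hsum K a U <= M ^+ 2 ->
  \sum_(k <- modes K) kabs k * normc (U k) <= K.*2.+1%:R * ((M ^+ 2 + 1) / 2).
Proof.
move=> h; set c : R := K.*2.+1%:R; have c0 : 0 < c by rewrite ltr0n.
apply: (@le_trans _ _ (\sum_(k <- modes K)
   (c * (kabs k `^ (2 * a) * normc (U k) ^+ 2 / 2) + c^-1 / 2))); last first.
  rewrite big_split/= -mulr_sumr -!mulr_suml big_const_seq count_predT iter_addr_0.
  have : c^-1 *+ size (modes K) <= c.
    have /(congr1 (fun n : nat => n%:R : R)) := size_modes K; rewrite natrX -/c -natr1 => e.
    rewrite -[_ *+ _]mulr_natr ler_pdivrMl//; move: e; rewrite expr2 => <-.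
    by rewrite lerDl.
  move: h c0; rewrite /hsum; move: (\sum_(_ <- _) _) (c^-1 *+ _) => x y h c0 hy.
  have : c * x <= c * M ^+ 2 by rewrite ler_pM2l.
  by lra.
rewrite big_seq [leRHS]big_seq; apply: ler_sum => k; rewrite mem_modes => /andP[k0 _].
have kk := kabs_gt0 R k0; have k1 := kabs_ge1 R k0.
apply: (@le_trans _ _ (kabs k `^ a * normc (U k))).
  rewrite ler_wpM2r ?normc_ge0// -[leLHS]powRr1 ?(ltW kk)//.
  by apply: ler_powR => //; exact: ltW.
rewrite -powR_sqr; have ci : c * c^-1 = 1 by rewrite divff ?gt_eqF.
have := sqr_ge0 (c * (kabs k `^ a * normc (U k)) - 1).
rewrite -exprMn; move: (_ `^ a * _) => x h1.
rewrite -(ler_pM2l c0); move: ci h1; move: (c^-1) => d ci h1.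
have -> : c * (c * (x ^+ 2 / 2) + d / 2) = c * (c * x ^+ 2) / 2 + c * d / 2 by ring.
by rewrite ci; move: h1; lra.
Qed.

(** As s > 1/2, half a derivative is at most |k|^s, which the Gevrey weight dominates by e^x >=
    x. *)
Lemma sqrt_kabs_exp k : k != 0 -> Num.sqrt (kabs k) <= eps^-1 * expR (eps * kabs k `^ s).
Proof.
move=> k0; have k1 := kabs_ge1 R k0.
apply: (@le_trans _ _ (kabs k `^ s)).
  rewrite -powR12_sqrt ?kabs_ge0//; apply: ler_powR => //.
  by rewrite -[2^-1]mul1r ltW.
by rewrite ler_pdivlMl//; apply: le_trans (expR_ge1Dx _); rewrite lerDr.
Qed.

Lemma normc_expA (c : R) (U : coefs R) k :
  normc (expA s c U k) = expR (c * kabs k `^ s) * normc (U k).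
Proof. by rewrite normcM normc_real ger0_norm ?expR_ge0. Qed.

Lemma hsum_le_expA (K : nat) (U : coefs R) : hsum K a U <= hsum K a (expA s eps U).
Proof.
apply: ler_sum => k _; rewrite ler_wpM2l ?powR_ge0// lerXn2r ?nnegrE ?normc_ge0//.
rewrite normc_expA -[leLHS]mul1r ler_wpM2r ?normc_ge0// -expR0 ler_expR.
by rewrite mulr_ge0 ?powR_ge0 ?(ltW eps0).
Qed.

(** C and L are chosen before K, D, psi and the solutions, so one estimate serves the Cauchy
    property of the Galerkin sequence and uniqueness. The rate K^(1-a) is the error size K^(-a)
    times the growth K of [sum_kabs_normc_le]. *)
Theorem bounded_stability : exists C L : R, [/\ 0 <= C, 0 < L &
  forall (K : nat) (D : freq -> R) (psi : R -> R) (U W e1 e2 : R -> coefs R),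
  (forall k, k \in modes K -> mu * kabs k `^ (2 * s) <= D k) ->
  (forall t, 0 < t -> 0 <= psi t) ->
  (forall k, k \in modes K -> cders (U ^~ k)
    (fun t => - ((D k)%:C%C * U t k) - nlin K s (psi t) (U t) (U t) k + e1 t k)) ->
  (forall k, k \in modes K -> cders (W ^~ k)
    (fun t => - ((D k)%:C%C * W t k) - nlin K s (psi t) (W t) (W t) k + e2 t k)) ->
  (forall t k, 0 < t -> k \in modes K ->
     normc (e1 t k) <= 6 * (M ^+ 2 * K.+1%:R `^ (- a)) * kabs k) ->
  (forall t k, 0 < t -> k \in modes K ->
     normc (e2 t k) <= 6 * (M ^+ 2 * K.+1%:R `^ (- a)) * kabs k) ->
  (forall t, 0 < t -> hsum K a (W t) <= M ^+ 2) ->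
  (forall t, 0 < t -> hsum K a (expA s eps (U t)) <= M ^+ 2) ->
  (forall k, k \in modes K -> U 0 k = W 0 k) ->
  forall t, 0 <= t -> \sum_(k <- modes K) normc (U t k - W t k) ^+ 2
    <= C * K.+1%:R `^ (1 - a) * t * expR (L * t)].
Proof.
have sp : 0 < s by apply: lt_trans s0; rewrite divr_gt0.
have ca := @modes_const_ge0 R a.
pose A1 := (M ^+ 2 + modes_const a) / 2; pose A2 := eps^-1 * A1.
have A10 : 0 <= A1 by rewrite divr_ge0 ?addr_ge0 ?sqr_ge0.
have A20 : 0 <= A2 by rewrite mulr_ge0 ?invr_ge0 ?(ltW eps0).
have p1 : 1 < 2 * s by rewrite -ltr_pdivrMl// mulrC.
have A0 : 0 <= 2 * A1 + A2 by rewrite addr_ge0// mulr_ge0.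
have mu2 : 0 < 2 * mu by rewrite mulr_gt0.
have [L L0 hL] := absorb_linear A0 A20 mu2 p1.
have MM : 0 <= M ^+ 2 * (M ^+ 2 + 1) by rewrite mulr_ge0 ?addr_ge0 ?sqr_ge0.
exists (48 * (M ^+ 2 * (M ^+ 2 + 1))), (L + 1); split.
- by rewrite mulr_ge0.
- by rewrite ltr_wpDl.
move=> K D psi U W e1 e2 Dge psi0 Ueq Weq he1 he2 hW hU UW0 t t0.
set r : R := K.+1%:R `^ (- a); have r0 : 0 <= r by exact: powR_ge0.
have et0 : 0 <= 6 * (M ^+ 2 * r) by rewrite mulr_ge0// mulr_ge0 ?sqr_ge0.
pose G : R := K.*2.+1%:R * (M ^+ 2 + 1).
have := @stability R K s mu A1 A2 L (6 * (M ^+ 2 * r)) G D psi U W e1 e2 sp s1 L0.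
have hU' u : 0 < u -> hsum K a (U u) <= M ^+ 2.
  by move=> u0; apply: le_trans (hsum_le_expA _ _) (hU u u0).
move=> /(_ _ _ Dge psi0 _ Ueq Weq he1 he2 _ _ _ UW0 t t0) h.
apply: (@le_trans _ _ (4 * (6 * (M ^+ 2 * r)) * G * t * expR (L * t))).
  apply: h => //.
  - by rewrite /G mulr_ge0 ?addr_ge0 ?sqr_ge0.
  - by move=> k; rewrite mem_modes => /andP[k0 _]; rewrite mulrA; apply: hL; exact: kabs_ge1.
  - by move=> u u0; apply: sum_normc_le; exact: hW.
  - move=> u u0; apply: le_trans (ler_wpM2l _ (sum_normc_le (hU u u0))); last first.
      by rewrite invr_ge0 ltW.
    rewrite mulr_sumr big_seq [leRHS]big_seq; apply: ler_sum => k; rewrite mem_modes => /andP[k0 _].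
    by rewrite normc_expA mulrA ler_wpM2r ?normc_ge0// sqrt_kabs_exp.
  - move=> u u0; apply: (@le_trans _ _ (\sum_(k <- modes K)
       (kabs k * normc (U u k) + kabs k * normc (W u k)))).
      apply: ler_sum => k _; rewrite -mulrDr ler_wpM2l ?kabs_ge0//.
      by apply: le_trans (normcD_le _ _) _; rewrite normc_opp.
    rewrite big_split/=; apply: le_trans (lerD (sum_kabs_normc_le (hU' u u0)) (sum_kabs_normc_le (hW u u0))) _.
    by rewrite -mulrDr ler_wpM2l//; lra.
apply: ler_pM; rewrite ?expR_ge0//.
- apply: mulr_ge0 => //; apply: mulr_ge0; last by rewrite mulr_ge0 ?addr_ge0 ?sqr_ge0.
  by rewrite mulr_ge0.
- rewrite ler_wpM2r// /G powRDp// powRr1// -/r.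
  have K2 : K.*2.+1%:R <= 2 * K.+1%:R :> R by rewrite -natrM ler_nat mul2n doubleS.
  have m0 : 0 <= M ^+ 2 * (M ^+ 2 + 1) * r by rewrite mulr_ge0.
  exact: mul_rearr_le.
- by rewrite ler_expR ler_wpM2r// lerDl.
Qed.
End bounded_stability.

Lemma powR_small (R : realType) (b e : R) : 0 < b -> 0 < e ->
  exists n0 : nat, forall n, (n0 <= n)%N -> n.+1%:R `^ (- b) <= e.
Proof.
move=> b0 e0; pose x := e^-1 `^ b^-1; exists (Num.truncn x).+1 => n hn.
have xn : x <= n.+1%:R.
  by apply: le_trans (ltW (truncnS_gt x)) _; rewrite ler_nat ltnW.
rewrite powRN -[leRHS]invrK lef_pV2 ?posrE ?invr_gt0 ?powR_gt0//.
have -> : e^-1 = x `^ b.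
  by rewrite /x -powRrM mulVf ?gt_eqF// powRr1// invr_ge0 ltW.
by apply: ge0_ler_powR; rewrite ?nnegrE ?powR_ge0 ?(ltW b0).
Qed.

Lemma hsum_near (R : realType) (N : nat) (a B d : R) : 0 <= B -> 0 < d ->
  exists2 e, 0 < e & forall U W : coefs R, hsum N a U <= B ->
    (forall k, k \in modes N -> normc (U k - W k) <= e) -> hsum N a W <= B + d.
Proof.
move=> B0 d0; pose c : R := \sum_(k <- modes N) kabs R k `^ a.
have c0 : 0 <= c by apply: sumr_ge0 => k _; exact: powR_ge0.
pose q := 2 * Num.sqrt B + 1.
have q0 : 0 < q by rewrite ltr_wpDl// mulr_ge0 ?sqrtr_ge0.
pose x := Num.min 1 (d / q).
have x0 : 0 < x by rewrite lt_min ltr01 divr_gt0.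
have c10 : 0 < c + 1 by rewrite ltr_wpDl.
exists (x / (c + 1)); first by rewrite divr_gt0.
move=> U W hU hd.
have h1 : hnorm N a (fun k => U k - W k) <= x.
  apply: le_trans (hnorm_le_sum _ _ _) _.
  apply: (@le_trans _ _ (\sum_(k <- modes N) kabs R k `^ a * (x / (c + 1)))).
    rewrite big_seq [leRHS]big_seq; apply: ler_sum => k kN.
    by rewrite ler_wpM2l ?powR_ge0 ?hd.
  rewrite -mulr_suml -/c mulrCA ler_piMr ?(ltW x0)// ler_pdivrMr// mul1r lerDl.
  exact: ler01.
have h2 : hnorm N a W <= Num.sqrt B + x.
  have h3 : hnorm N a U <= Num.sqrt B by rewrite ler_wsqrtr.
  have := hnorm_dist N a U W; rewrite ler_norml => /andP[+ _].
  by move: h1 h3; lra.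
rewrite -hnorm_sqr; apply: (@le_trans _ _ ((Num.sqrt B + x) ^+ 2)).
  by rewrite lerXn2r ?nnegrE ?hnorm_ge0// addr_ge0 ?sqrtr_ge0// ltW.
rewrite sqrrD sqr_sqrtr// -addrA lerD2l.
apply: (@le_trans _ _ (x * q)).
  have x1 : x <= 1 by rewrite ge_min lexx.
  have : x ^+ 2 <= x by rewrite expr2 ger_pMr.
  by rewrite /q; move: (Num.sqrt B) => v; lra.
by rewrite -ler_pdivlMr// ge_min lexx orbT.
Qed.

(** Conjugating with e^(-e |k|^s) shifts psi by e. Hence solutions for psi + eps yield solutions for
    psi with an extra Gevrey radius eps. *)
Lemma nlin_expA (R : realType) (N : nat) (s p e : R) (V : coefs R) k :
  nlin N s p (expA s (- e) V) (expA s (- e) V) k =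
  (expR (- e * kabs R k `^ s))%:C%C * nlin N s (p + e) V V k.
Proof.
rewrite /nlin mulr_sumr; apply: eq_bigr => j _; rewrite /expA /fmult /wexp.
have E (x y z : R) : expR (p * (x - y - z)) * (expR (- e * y) * expR (- e * z)) =
    expR (- e * x) * expR ((p + e) * (x - y - z)).
  by rewrite -!expRD; apply: (congr1 expR); ring.
have H (c w1 w2 w3 w4 w5 : R) (u v : R[i]) : w1 * (w2 * w3) = w4 * w5 ->
    (c * w1)%:C%C * ((w2%:C%C * u) * (w3%:C%C * v)) = w4%:C%C * ((c * w5)%:C%C * (u * v)).
  move=> e'; have -> : (c * w1)%:C%C * ((w2%:C%C * u) * (w3%:C%C * v)) =
      (c * (w1 * (w2 * w3)))%:C%C * (u * v) by rewrite !rmorphM/=; ring.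
  by rewrite e' !rmorphM/=; ring.
exact/H/E.
Qed.

Lemma expA_comp (R : realType) (s c e : R) (V : coefs R) :
  expA s c (expA s e V) = expA s (c + e) V.
Proof.
by apply/funext => k; rewrite /expA /fmult mulrA -rmorphM/= -expRD -mulrDl.
Qed.

Lemma expA0 (R : realType) (s : R) (V : coefs R) : expA s 0 V = V.
Proof. by apply/funext => k; rewrite /expA /fmult mul0r expR0 mul1r. Qed.

Lemma ccont_nlin (R : realType) (N : nat) (s : R) (psi : R -> R) (U : R -> coefs R) k :
  continuous psi -> (forall j, j \in modes N -> ccont (U ^~ j)) ->
  ccont (fun t => nlin N s (psi t) (U t) (U t) k).
Proof.
move=> cpsi cU; rewrite /nlin; under eq_fun do rewrite big_seq_cond.
apply: ccont_sum => j /andP[jN kjN].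
apply: ccont_realM; last by apply: ccont_mul; exact: cU.
apply: cont_mul; first exact: cont_cst.
by apply: cont_expR; apply: cont_mul => //; exact: cont_cst.
Qed.

Lemma hsum_mono (R : realType) (N M : nat) (a : R) (U : coefs R) : (N <= M)%N ->
  hsum N a U <= hsum M a U.
Proof.
move=> NM; apply: sum_uniq_subset; rewrite ?modes_uniq//; first exact: modes_sub.
by move=> k _; rewrite mulr_ge0 ?powR_ge0 ?sqr_ge0.
Qed.

Lemma hsum_off (R : realType) (N M : nat) (a : R) (U : coefs R) : (N <= M)%N ->
  (forall k, k \notin modes N -> U k = 0) -> hsum M a U = hsum N a U.
Proof.
move=> NM h; rewrite /hsum (sum_modes_split _ NM) [X in _ + X]big1 ?addr0// => k /h ->.
by rewrite normc0 expr0n mulr0.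
Qed.

(** Outside the box e^(-2 eps |k|^s) <= 1/(2 eps (K+1)^s): the extra Gevrey radius gives compactness
    in the norm of order a, which coefficientwise convergence cannot. *)
Lemma gevrey_tail (R : realType) (s a eps B : R) (n K : nat) (U : coefs R) :
  0 < s -> 0 < eps -> hsum n a (expA s eps U) <= B ->
  \sum_(k <- modes n | k \notin modes K) kabs R k `^ (2 * a) * normc (U k) ^+ 2
    <= B / (2 * eps) * K.+1%:R `^ (- s).
Proof.
move=> s0 eps0 hB; pose V := expA s eps U; set c : R := ((2 * eps) * K.+1%:R `^ s)^-1.
have K0 : 0 < K.+1%:R `^ s :> R by rewrite powR_gt0.
have c0 : 0 <= c by rewrite invr_ge0 !mulr_ge0 ?(ltW eps0) ?(ltW K0).
apply: (@le_trans _ _ (\sum_(k <- modes n | k \notin modes K)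
   c * (kabs R k `^ (2 * a) * normc (V k) ^+ 2))); last first.
  have -> : B / (2 * eps) * K.+1%:R `^ (- s) = c * B by rewrite powRN /c (invfM (2 * eps)) [RHS]mulrC mulrA.
  rewrite -mulr_sumr ler_wpM2l//; apply: le_trans hB.
  rewrite big_mkcond; apply: ler_sum => k _; case: ifP => // _.
  by rewrite mulr_ge0 ?powR_ge0 ?sqr_ge0.
rewrite big_seq_cond [leRHS]big_seq_cond; apply: ler_sum => k /andP[].
rewrite !mem_modes => /andP[k0 _]; rewrite k0/= -ltnNge => Kk.
rewrite [leRHS]mulrCA ler_wpM2l ?powR_ge0//.
have -> : U k = (expR (- eps * kabs R k `^ s))%:C%C * V k.
  by rewrite -[RHS]/(expA s (- eps) (expA s eps U) k) expA_comp addNr expA0.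
rewrite normcM normc_real ger0_norm ?expR_ge0// exprMn.
rewrite ler_wpM2r ?sqr_ge0//.
have ks : K.+1%:R `^ s <= kabs R k `^ s.
  apply: ge0_ler_powR; rewrite ?nnegrE ?kabs_ge0 ?(ltW s0)//.
  by apply: le_trans (msup_le_kabs R k); rewrite ler_nat.
rewrite expr2 -expRD -mulrDl -opprD mulNr expRN.
have h1 := expR_ge1Dx ((eps + eps) * kabs R k `^ s).
have h2 : (2 * eps) * K.+1%:R `^ s <= expR ((eps + eps) * kabs R k `^ s).
  apply: le_trans h1; rewrite [2 * eps]mulr_natl mulr2n -[leLHS]add0r lerD//.
  by rewrite ler_wpM2l ?addr_ge0 ?(ltW eps0).
by rewrite lef_pV2 ?posrE ?expR_gt0// !mulr_gt0.
Qed.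

Lemma fnl_cont (R : realType) (s a M : R) (psi : R -> R) (W : R -> coefs R) k :
  0 < s -> s <= 1 -> 0 < a -> (forall t, 0 <= psi t) -> continuous psi ->
  (forall j, ccont (W ^~ j)) -> (forall t, W t 0 = 0) ->
  (forall N t, hsum N a (W t) <= M ^+ 2) ->
  ccont (fun t => fnl s (psi t) (W t) k).
Proof.
move=> s0 s1 a0 p0 cp cW W0 Wb.
have h (T e : R) : 0 < T -> 0 < e -> exists2 g : R -> R[i], ccont g &
    forall t, `|t| <= T -> normc (fnl s (psi t) (W t) k - g t) <= e.
  move=> _ e0; pose q := 3 * M ^+ 2 * kabs R k + 1.
  have q0 : 0 < q by rewrite ltr_wpDl// mulr_ge0 ?kabs_ge0// mulr_ge0 ?sqr_ge0.
  have [K /(_ K (leqnn _)) hK] := powR_small a0 (divr_gt0 e0 q0).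
  exists (fun t => nlin K s (psi t) (W t) (W t) k); first by apply: ccont_nlin.
  move=> t _; apply: le_trans (fnl_approx s0 s1 (ltW a0) (p0 t) (fun N => Wb N t) (W0 t) K k) _.
  rewrite ler_pdivlMr// in hK; apply: le_trans hK.
  rewrite /q mulrDr mulr1 ler_wpDr ?powR_ge0//.
  by rewrite le_eqVlt; apply/orP; left; apply/eqP; ring.
split; apply: uniform_limit_cont => T e T0 e0; have [g [g1 g2] hg] := h T e T0 e0.
  by exists (fun t => Re (g t)) => // t /hg; apply: le_trans; rewrite -raddfB; exact: Re_le_normc.
by exists (fun t => Im (g t)) => // t /hg; apply: le_trans; rewrite -raddfB; exact: Im_le_normc.
Qed.

(** * Global existence and uniqueness *)

Lemma error_budget (R : realFieldType) (S q r x m d D e E : R) :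
  9 * m * q * r <= e / 2 * E -> d * (S * (q * (2 * x)) + D + 1) <= e / 2 * E -> 0 <= d ->
  D * d + (3 * (m * r) * q + (3 * (m * r) * q + (S * (q * (2 * x * d)) + 3 * (m * r) * q)))
    <= e * E.
Proof. by lra. Qed.

(** * Galerkin limit and global existence *)

Section global_existence.
Variables (R : realType) (s a mu eps : R) (D : freq -> R) (psi : R -> R) (V0 : coefs R).
Hypotheses (s0 : 1 / 2 < s) (s1 : s <= 1) (a1 : 1 < a) (a2 : a < 2 * s).
Hypotheses (mu0 : 0 < mu) (eps0 : 0 < eps).
Local Notation kabs := (@kabs R).
Hypothesis D_ge : forall k, k != 0 -> mu * kabs k `^ (2 * s) <= D k.
Hypothesis D_even : forall k, D (- k) = D k.
Hypothesis psi_ge0 : forall t, 0 <= psi t.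
Hypothesis psi_cont : continuous psi.
Hypothesis psi_max : forall t, psi t = psi (Num.max t 0).
Hypothesis V0_conj : forall k, V0 (- k) = conjc (V0 k).
Hypothesis V0_small : forall N, hsum N a V0 <= mu ^+ 2.

Let sp : 0 < s. Proof. by apply: lt_trans s0; rewrite divr_gt0. Qed.
Let a0 : 0 <= a. Proof. by rewrite ltW// (lt_trans ltr01). Qed.

(** U is e^(-eps |nabla|^s) applied to a Galerkin solution for psi + eps that starts from V0. It
    thus solves the system for psi itself, while the bound holds with the weight e^(eps |k|^s). *)
Record galerkin (n : nat) (U : R -> coefs R) : Prop := Galerkin {
  galerkin_eq : forall k, k \in modes n -> cders (U ^~ k)
    (fun t => - ((D k)%:C%C * U t k) - nlin n s (psi t) (U t) (U t) k) ;
  galerkin_init : forall k, k \in modes n -> U 0 k = expA s (- eps) V0 k ;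
  galerkin_off : forall t k, k \notin modes n -> U t k = 0 ;
  galerkin_conj : forall t k, 0 <= t -> U t (- k) = conjc (U t k) ;
  galerkin_bound : forall N t, 0 <= t -> hsum N a (expA s eps (U t)) <= mu ^+ 2 }.

Lemma exists_galerkin n : exists U, galerkin n U.
Proof.
have D_ge' k : k \in modes n -> mu * kabs k `^ (2 * s) <= D k.
  by rewrite mem_modes => /andP[/D_ge].
have psie t : 0 <= psi t + eps by rewrite addr_ge0 ?(ltW eps0).
have cpsie : continuous (fun t => psi t + eps) by apply: cont_add => //; exact: cont_cst.
have [V [Veq Vinit Voff Vconj Vb]] :=
  galerkin_exists s0 s1 a1 a2 mu0 D_ge' D_even psie cpsie V0_conj (V0_small n).
exists (fun t => expA s (- eps) (V t)); split.
- move=> k kn.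
  apply: cders_ext (cders_realM (ders_cst (expR (- eps * kabs k `^ s))) (Veq k kn)) _ => t _.
  by rewrite nlin_expA /expA /fmult; ring.
- by move=> k kn; rewrite /expA /fmult Vinit.
- by move=> t k kn; rewrite /expA /fmult Voff// mulr0.
- by move=> t k t0; rewrite /expA /fmult Vconj// kabsN conjcM_eq conjc_realE.
- move=> N t t0; rewrite expA_comp subrr expA0.
  apply: le_trans (Vb t t0); have [nN|Nn] := leqP n N; last exact/hsum_mono/ltnW.
  by rewrite (hsum_off _ nN)// => k; exact: Voff.
Qed.

Section sequence.
Variable U : nat -> R -> coefs R.
Hypothesis U_galerkin : forall n, galerkin n (U n).

Lemma galerkin_hsum n N t : 0 <= t -> hsum N a (U n t) <= mu ^+ 2.
Proof.
by move=> t0; apply: le_trans (galerkin_bound (U_galerkin n) N t0); exact: hsum_le_expA.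
Qed.

Lemma galerkin_normc n t k : 0 <= t -> k != 0 -> normc (U n t k) <= mu.
Proof.
move=> t0 k0; apply: le_trans (normc_le_hnorm (N := msup k) _ a0 _) _.
  by rewrite mem_modes k0 leqnn.
rewrite -[leRHS](ger0_norm (ltW mu0)) -sqrtr_sqr ler_wsqrtr//; exact: galerkin_hsum.
Qed.

Lemma galerkin0 n t : U n t 0 = 0.
Proof. by apply: (galerkin_off (U_galerkin n)); rewrite mem_modes eqxx. Qed.

Lemma galerkin_cont n k : ccont (U n ^~ k).
Proof.
have [kn|kn] := boolP (k \in modes n).
  by have [[c1 _] [c2 _]] := galerkin_eq (U_galerkin n) kn; split.
by under eq_fun do rewrite (galerkin_off (U_galerkin n) _ kn); split; exact: cont_cst.
Qed.

Lemma fnl_galerkin n K t k : 0 <= t -> normc (fnl s (psi t) (U n t) k -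
   nlin K s (psi t) (U n t) (U n t) k) <= 3 * (mu ^+ 2 * K.+1%:R `^ (- a)) * kabs k.
Proof.
move=> t0; apply: fnl_approx => //; [by move=> N; exact: galerkin_hsum|exact: galerkin0].
Qed.

Lemma powRN_nincr (n m : nat) (b : R) : 0 <= b -> (n <= m)%N ->
  m.+1%:R `^ (- b) <= n.+1%:R `^ (- b).
Proof.
move=> b0 nm; rewrite !powRN lef_pV2 ?posrE ?powR_gt0//.
by apply: ge0_ler_powR; rewrite ?nnegrE// ler_nat.
Qed.

Lemma galerkin_cauchy : exists (rho : nat -> R) (L : R), [/\ 0 < L, forall n, 0 <= rho n,
  forall e, 0 < e -> exists n0, forall n, (n0 <= n)%N -> rho n <= e &
  forall n m t k, (n <= m)%N -> 0 <= t -> k \in modes n ->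
    normc (U n t k - U m t k) <= rho n * expR (L * t)].
Proof.
have [C [L [C0 L0 h]]] := bounded_stability mu s0 s1 a1 eps0 mu0.
(* Raising L by 1 absorbs the linear factor t of [bounded_stability]: t e^(L t) <= (e^((L+1) t))^2,
   and the square root removes the square. *)
exists (fun n => Num.sqrt (C * n.+1%:R `^ (1 - a))), (L + 1); split.
- by rewrite addr_gt0.
- by move=> n; exact: sqrtr_ge0.
- move=> e e0; have b0 : 0 < a - 1 by rewrite subr_gt0.
  have C1 : 0 < C + 1 by rewrite ltr_wpDl.
  have e'0 : 0 < e ^+ 2 / (C + 1) by rewrite divr_gt0 ?exprn_gt0.
  have [n0 hn] := powR_small b0 e'0; exists n0 => n /hn; rewrite opprB => hn'.
  rewrite -[leRHS](ger0_norm (ltW e0)) -sqrtr_sqr ler_wsqrtr//.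
  move: hn'; rewrite ler_pdivlMr// => hn'; apply: le_trans hn'.
  by rewrite mulrC ler_wpM2l ?powR_ge0// lerDl.
move=> n m t k nm t0 kn.
have mn := modes_sub nm.
have := h n D psi (U n) (U m) (fun _ _ => 0) (fun t k =>
   nlin n s (psi t) (U m t) (U m t) k - nlin m s (psi t) (U m t) (U m t) k).
have m0 : 0 <= mu ^+ 2 * n.+1%:R `^ (- a) by rewrite mulr_ge0 ?sqr_ge0 ?powR_ge0.
move=> /(_ _ _ _ _ _ _ _ _ _ t t0) {}h.
have S : \sum_(k <- modes n) normc (U n t k - U m t k) ^+ 2
    <= C * n.+1%:R `^ (1 - a) * t * expR (L * t).
  apply: h.
  - by move=> j; rewrite mem_modes => /andP[/D_ge].
  - by move=> u u0.
  - move=> j jn; apply: cders_ext (galerkin_eq (U_galerkin n) jn) _ => u _.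
    by rewrite addr0.
  - move=> j jn; apply: cders_ext (galerkin_eq (U_galerkin m) (mn _ jn)) _ => u _.
    by ring.
  - move=> u j u0 jn; rewrite normc0 mulr_ge0 ?kabs_ge0// mulr_ge0//.
  - move=> u j u0 jn.
    (* U m satisfies the system of level n up to the difference of the two truncations; each is
       within 3 units of the full nonlinearity, hence the 6 in [bounded_stability]. *)
    have E1 := fnl_galerkin m n j (ltW u0); have E2 := fnl_galerkin m m j (ltW u0).
    set p := fnl _ _ _ _ in E1 E2; set x := nlin n _ _ _ _ _ in E1 *; set y := nlin m _ _ _ _ _ in E2 *.
    have -> : x - y = (p - y) + - (p - x) by ring.
    apply: le_trans (normcD_le _ _) _; rewrite normc_opp.
    have h2 : 3 * (mu ^+ 2 * m.+1%:R `^ (- a)) * kabs j <= 3 * (mu ^+ 2 * n.+1%:R `^ (- a)) * kabs j.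
      by rewrite ler_wpM2r ?kabs_ge0// ler_wpM2l// ler_wpM2l ?sqr_ge0// powRN_nincr.
    apply: le_trans (lerD (le_trans E2 h2) E1) _; move: (mu ^+ 2 * _) => v; lra.
  - by move=> u u0; apply: galerkin_hsum; exact: ltW.
  - by move=> u u0; apply: (galerkin_bound (U_galerkin n)); exact: ltW.
  - by move=> j jn; rewrite (galerkin_init (U_galerkin n))// (galerkin_init (U_galerkin m))// mn.
have S1 : normc (U n t k - U m t k) ^+ 2 <= C * n.+1%:R `^ (1 - a) * t * expR (L * t).
  apply: le_trans S.
  exact: (le_modes_sum (f := fun k => normc (U n t k - U m t k) ^+ 2) (fun j => sqr_ge0 _)).
have Cn : 0 <= C * n.+1%:R `^ (1 - a) by rewrite mulr_ge0 ?powR_ge0.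
rewrite -(ger0_norm (normc_ge0 _)) -sqrtr_sqr.
apply: (@le_trans _ _ (Num.sqrt (C * n.+1%:R `^ (1 - a) * expR ((L + 1) * t) ^+ 2))); last first.
  by rewrite sqrtrM// sqrtr_sqr ger0_norm ?expR_ge0.
apply: ler_wsqrtr; apply: le_trans S1 _; rewrite -mulrA ler_wpM2l//.
have t1 : t <= expR t by apply: le_trans (expR_ge1Dx t); rewrite lerDr.
have e1 : expR t <= expR ((L + 1) * t).
  by rewrite ler_expR mulrDl mul1r lerDr mulr_ge0 ?(ltW L0).
have e2 : expR (L * t) <= expR ((L + 1) * t) by rewrite ler_expR mulrDl mul1r lerDl.
by rewrite expr2 ler_pM ?expR_ge0// (le_trans t1).
Qed.

Lemma galerkin_limit : exists (Ul : R -> coefs R) (rho : nat -> R) (L : R),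
  [/\ [/\ 0 < L, forall n, 0 <= rho n &
      forall e, 0 < e -> exists n0, forall n, (n0 <= n)%N -> rho n <= e],
  forall t k, Ul t k = Ul (Num.max t 0) k, forall t, Ul t 0 = 0 &
  forall n t k, 0 <= t -> k \in modes n -> normc (U n t k - Ul t k) <= rho n * expR (L * t)].
Proof.
have [rho [L [L0 rho0 rho_small hc]]] := galerkin_cauchy.
have lim (p : R * freq) : exists l, forall n, 0 <= p.1 -> p.2 \in modes n ->
    normc (U n p.1 p.2 - l) <= 2 * (rho n * expR (L * p.1)).
  case: p => t k /=; have [t0|t0] := leP 0 t; last by exists 0.
  have [k0|k0] := eqVneq k 0; first by exists 0 => n _; rewrite mem_modes k0 eqxx.
  have [|n m kn nm|l hl] := @climit R (fun n => U n t k) (fun n => rho n * expR (L * t)) (msup k).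
  - by move=> n; rewrite mulr_ge0 ?expR_ge0.
  - by apply: hc => //; rewrite mem_modes k0.
  by exists l => n _; rewrite mem_modes k0 => /hl.
have [lm hlm] := boolp.choice lim.
exists (fun t k => if k == 0 then 0 else lm (Num.max t 0, k)), (fun n => 2 * rho n), L; split.
- split=> // [n|e e0]; first by rewrite mulr_ge0.
  have [n0 hn] := rho_small (e / 2) (divr_gt0 e0 (ltr0Sn _ 1)).
  by exists n0 => n /hn; rewrite ler_pdivlMr// mulrC.
- by move=> t k; rewrite -maxA maxxx.
- by move=> t; rewrite eqxx.
- move=> n t k t0 kn; have := kn; rewrite mem_modes => /andP[k0 _].
  rewrite (negPf k0) (max_l t0) -mulrA; exact: (hlm (t, k)).
Qed.

Section limit.
Variables (Ul : R -> coefs R) (rho : nat -> R) (L : R).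
Hypotheses (L0 : 0 < L) (rho0 : forall n, 0 <= rho n).
Hypothesis rho_small : forall e, 0 < e -> exists n0, forall n, (n0 <= n)%N -> rho n <= e.
Hypothesis Ul_max : forall t k, Ul t k = Ul (Num.max t 0) k.
Hypothesis Ul0 : forall t, Ul t 0 = 0.
Hypothesis Ul_lim : forall n t k, 0 <= t -> k \in modes n ->
  normc (U n t k - Ul t k) <= rho n * expR (L * t).

Let max_ge0 (t : R) : 0 <= Num.max t 0. Proof. by rewrite le_max lexx orbT. Qed.

Lemma limit_near K t e : 0 <= t -> 0 < e ->
  exists n0, forall n, (n0 <= n)%N -> forall k, k \in modes K -> normc (U n t k - Ul t k) <= e.
Proof.
move=> t0 e0; have e'0 : 0 < e / expR (L * t) by rewrite divr_gt0 ?expR_gt0.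
have [n0 hn] := rho_small e'0; exists (maxn n0 K) => n; rewrite geq_max => /andP[n0n Kn] k kK.
apply: le_trans (Ul_lim t0 (modes_sub Kn kK)) _.
by rewrite -ler_pdivlMr ?expR_gt0 ?hn.
Qed.

Lemma limit_init k : k != 0 -> Ul 0 k = expA s (- eps) V0 k.
Proof.
move=> k0; apply/eqP; rewrite eq_sym -subr_eq0; apply/eqP/eq0_normc.
apply/eqP; rewrite eq_le normc_ge0 andbT; apply: (@le_eps_scale _ _ 1) => // e e0.
have [n0 hn] := limit_near (msup k) (lexx 0) e0; rewrite mul1r.
pose n := maxn n0 (msup k); have kK : k \in modes (msup k) by rewrite mem_modes k0 leqnn.
rewrite -(galerkin_init (U_galerkin n)); last by rewrite mem_modes k0 leq_maxr.
by apply: hn => //; exact: leq_maxl.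
Qed.

Lemma limit_conj t k : Ul t (- k) = conjc (Ul t k).
Proof.
have [->|k0] := eqVneq k 0; first by rewrite oppr0 Ul0 conjc0.
rewrite Ul_max [in RHS]Ul_max; have := max_ge0 t; move: (Num.max t 0) => {}t t0.
apply/eqP; rewrite -subr_eq0; apply/eqP/eq0_normc.
apply/eqP; rewrite eq_le normc_ge0 andbT; apply: (@le_eps_scale _ _ 2) => // e e0.
have [n0 hn] := limit_near (msup k) t0 e0.
have kK : k \in modes (msup k) by rewrite mem_modes k0 leqnn.
have h1 := hn n0 (leqnn _) _ kK; have := hn n0 (leqnn _) (- k); rewrite mem_modesN => /(_ kK) h2.
rewrite (galerkin_conj (U_galerkin n0))// in h2.
have -> : Ul t (- k) - conjc (Ul t k) = - (conjc (U n0 t k) - Ul t (- k)) +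
    conjc (U n0 t k - Ul t k) by rewrite rmorphB; ring.
apply: le_trans (normcD_le _ _) _; rewrite normc_opp normcJ.
by rewrite [2 * _]mulr_natl mulr2n lerD.
Qed.

Lemma limit_bound N t : hsum N a (expA s eps (Ul t)) <= mu ^+ 2.
Proof.
have -> : Ul t = Ul (Num.max t 0) by apply/funext => k; exact: Ul_max.
have := max_ge0 t; move: (Num.max t 0) => {}t t0.
apply/ler_addgt0Pr => d d0.
have [e e0 he] := hsum_near N a (sqr_ge0 mu) d0.
pose c : R := \sum_(k <- modes N) expR (eps * kabs k `^ s).
have c0 : 0 < c + 1 by rewrite ltr_wpDl ?sumr_ge0// => k _; exact: expR_ge0.
have e'0 : 0 < e / (c + 1) by rewrite divr_gt0.
have [n hn] := limit_near N t0 e'0.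
apply: (he (expA s eps (U n t))); first exact: (galerkin_bound (U_galerkin n)).
move=> k kN; rewrite /expA /fmult -mulrBr normcM normc_real ger0_norm ?expR_ge0//.
apply: le_trans (ler_wpM2l (expR_ge0 _) (hn n (leqnn _) k kN)) _.
rewrite mulrCA -[leRHS]mulr1 ler_wpM2l ?(ltW e0)// ler_pdivrMr// mul1r.
apply: le_trans (_ : c <= _); last by rewrite lerDl.
exact: (le_modes_sum (f := fun k => expR (eps * kabs k `^ s)) (fun j => expR_ge0 _)).
Qed.

Lemma limit_hsum N t : hsum N a (Ul t) <= mu ^+ 2.
Proof. by apply: le_trans (limit_bound N t); exact: hsum_le_expA. Qed.

Lemma limit_eq k : k != 0 ->
  cders (Ul ^~ k) (fun t => - ((D k)%:C%C * Ul t k) - fnl s (psi t) (Ul t) k).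
Proof.
move=> k0; apply: (cders_limit L0) => [t|t|e e0]; first exact: Ul_max.
  have -> : Ul t = Ul (Num.max t 0) by apply/funext => j; exact: Ul_max.
  by rewrite -psi_max.
have kk := kabs_gt0 R k0.
pose q := 9 * mu ^+ 2 * kabs k; have q0 : 0 < q by rewrite !mulr_gt0 ?exprn_gt0.
have eq0 : 0 < e / 2 / q by rewrite !divr_gt0.
(* K is fixed first, by the truncation error of the nonlinearity; n is taken afterwards, so large
   that U n is close to the limit on the finitely many modes of K. *)
have [K hK] := powR_small (lt_trans ltr01 a1) eq0.
pose B := (size (modes K))%:R * (kabs k * (2 * mu)) + `|D k| + 1.
have B0 : 0 <= (size (modes K))%:R * (kabs k * (2 * mu)).
  by rewrite !mulr_ge0 ?ler0n ?kabs_ge0 ?(ltW mu0).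
have B1 : 0 < B by rewrite ltr_wpDl ?addr_ge0.
have [n0 hn] := @rho_small (e / 2 / B) (divr_gt0 (divr_gt0 e0 (ltr0Sn _ 1)) B1).
pose n := maxn n0 (maxn K (msup k)).
have Kn : (K <= n)%N by rewrite /n !leq_max leqnn ?orbT.
have kn : k \in modes n by rewrite mem_modes k0/=; exact: leq_trans (leq_maxr K _) (leq_maxr _ _).
have rn : rho n <= e / 2 / B by apply: hn; rewrite /n !leq_max leqnn ?orbT.
have rB : rho n * B <= e / 2 by rewrite -ler_pdivlMr.
have rK : q * K.+1%:R `^ (- a) <= e / 2 by rewrite mulrC -ler_pdivlMr// hK.
have rnB : rho n <= e.
  apply: le_trans (_ : rho n * B <= _); last by apply: le_trans rB _; move: e0; lra.
  by rewrite ler_peMr// /B lerDr addr_ge0.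
exists (U n ^~ k), (fun t => - ((D k)%:C%C * U n t k) - nlin n s (psi t) (U n t) (U n t) k); split.
- exact: (galerkin_eq (U_galerkin n)).
- apply: ccont_add; first apply: ccont_opp; last apply: ccont_opp.
    by apply: ccont_realM; [exact: cont_cst|exact: galerkin_cont].
  by apply: ccont_nlin => // j _; exact: galerkin_cont.
- move=> t t0; apply: le_trans (Ul_lim t0 kn) _.
  by rewrite ler_wpM2r ?expR_ge0.
move=> t t0; set E := expR (L * t).
have E1 : 1 <= E by rewrite /E -expR0 ler_expR mulr_ge0 ?(ltW L0).
set d := rho n * E; have d0 : 0 <= d by rewrite mulr_ge0 ?expR_ge0.
have hd j : j \in modes K -> normc (U n t j - Ul t j) <= d.
  by move=> jK; apply: Ul_lim => //; exact: modes_sub jK.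
have F1 := fnl_galerkin n n k t0; have F2 := fnl_galerkin n K k t0.
have F3 : normc (fnl s (psi t) (Ul t) k - nlin K s (psi t) (Ul t) (Ul t) k) <=
    3 * (mu ^+ 2 * K.+1%:R `^ (- a)) * kabs k.
  by apply: fnl_approx => // N; exact: limit_hsum.
have lb j : j \in modes K -> normc (Ul t j) <= mu.
  move=> jK; apply: le_trans (normc_le_hnorm _ a0 jK) _.
  by rewrite -[leRHS](ger0_norm (ltW mu0)) -sqrtr_sqr ler_wsqrtr//; exact: limit_hsum.
have F4 := @nlin_diff_le R s sp s1 K (psi t) mu d (U n t) (Ul t) k (psi_ge0 t) (ltW mu0) d0 _ lb hd.
have {}F4 := F4 (fun j jK => galerkin_normc n t0 (proj1 (andP (etrans (esym (mem_modes K j)) jK)))).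
have F5 : normc ((D k)%:C%C * (U n t k - Ul t k)) <= `|D k| * d.
  by rewrite normcM normc_real ler_wpM2l ?normr_ge0// Ul_lim.
have {}F1 : normc (fnl s (psi t) (U n t) k - nlin n s (psi t) (U n t) (U n t) k) <=
    3 * (mu ^+ 2 * K.+1%:R `^ (- a)) * kabs k.
  apply: le_trans F1 _; rewrite ler_wpM2r ?kabs_ge0// ler_wpM2l// ler_wpM2l ?sqr_ge0//.
  exact: powRN_nincr.
move: F1 F2 F3 F4 F5; set p := fnl _ _ _ _; set x := nlin n _ _ _ _ _.
set y := nlin K _ _ _ _ _; set z := fnl _ _ _ _; set w := nlin K _ _ _ _ _ => F1 F2 F3 F4 F5.
have -> : - ((D k)%:C%C * U n t k) - x - (- ((D k)%:C%C * Ul t k) - z) =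
   - ((D k)%:C%C * (U n t k - Ul t k)) + ((p - x) + (- (p - y) + (- (y - w) + (z - w)))).
  by ring.
have tri (u1 u2 u3 u4 u5 : R[i]) : normc (- u1 + (u2 + (- u3 + (- u4 + u5)))) <=
    normc u1 + (normc u2 + (normc u3 + (normc u4 + normc u5))).
  do 4! (apply: le_trans (normcD_le _ _) _; rewrite ?normc_opp lerD2l).
  exact: lexx.
apply: le_trans (tri _ _ _ _ _) _.
apply: le_trans (lerD F5 (lerD F1 (lerD F2 (lerD F4 F3)))) _.
have G1 : q * K.+1%:R `^ (- a) <= e / 2 * E.
  by apply: le_trans rK _; rewrite -[leLHS]mulr1 ler_wpM2l// divr_ge0 ?(ltW e0).
have G2 : d * B <= e / 2 * E by rewrite /d mulrAC ler_wpM2r ?expR_ge0.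
exact: error_budget G1 G2 d0.
Qed.

(** The Galerkin norms decrease, but coefficientwise limits give only lower semicontinuity, which
    fails to control the norm at the earlier time t. There [gevrey_tail] confines the norm of U n to
    a fixed box up to d/3. Quantifying over the bounds C avoids naming the full norm. *)
Theorem limit_decay t u : 0 <= t -> t <= u -> forall C, (forall N, hsum N a (Ul t) <= C) ->
  forall N, hsum N a (Ul u) <= C.
Proof.
move=> t0 tu C hC N; have u0 := le_trans t0 tu.
have C0 : 0 <= C by apply: le_trans (hsum_ge0 0 a (Ul t)) (hC 0%N).
apply/ler_addgt0Pr => d d0; have d3 : 0 < d / 3 by rewrite divr_gt0.
have m2 : 0 < mu ^+ 2 by rewrite exprn_gt0.
have dm0 : 0 < d / 3 / (mu ^+ 2 / (2 * eps)) by rewrite !divr_gt0// mulr_gt0.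
have [K hK] := powR_small sp dm0.
have [e1 e10 near1] := hsum_near K a C0 d3.
have B0 : 0 <= C + d / 3 + d / 3 by rewrite !addr_ge0 ?(ltW d3).
have [e2 e20 near2] := hsum_near N a B0 d3.
have [n1 hn1] := limit_near K t0 e10.
have [n2 hn2] := limit_near N u0 e20.
pose n := maxn (maxn n1 n2) (maxn N K).
have {}near1 : hsum K a (U n t) <= C + d / 3.
  by apply: (near1 (Ul t)) => // k kK; rewrite -opprB normc_opp; apply: hn1 => //; rewrite /n !leq_max leqnn ?orbT.
have tail : hsum n a (U n t) <= hsum K a (U n t) + d / 3.
  have Kn : (K <= n)%N by rewrite /n !leq_max leqnn ?orbT.
  rewrite [leLHS](sum_modes_split _ Kn) lerD2l.
  apply: (le_trans (@gevrey_tail R s a eps (mu ^+ 2) n K (U n t) sp eps0 _)).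
    exact: (galerkin_bound (U_galerkin n)).
  have := hK K (leqnn _); rewrite ler_pdivlMr; last by rewrite divr_gt0// mulr_gt0.
  by rewrite mulrC.
have dec : hsum n a (U n u) <= hsum n a (U n t).
  apply: (@energy_decay R n s a mu D psi (fun=> 1) (U n)) => //.
  - by move=> k; rewrite mem_modes => /andP[/D_ge].
  - move=> v v0; rewrite mul1r -[leRHS](ger0_norm (ltW mu0)) -sqrtr_sqr ler_wsqrtr//.
    exact: galerkin_hsum (ltW v0).
  - by move=> v k v0; exact: (galerkin_conj (U_galerkin n) _ (ltW v0)).
  - move=> k kn; apply: cders_ext (galerkin_eq (U_galerkin n) kn) _ => v _.
    by rewrite mul1r.
have -> : C + d = C + d / 3 + d / 3 + d / 3 by field.
apply: (near2 (U n u)) => [|k kN]; last by apply: hn2 => //; rewrite /n !leq_max leqnn ?orbT.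
apply: (@le_trans _ _ (hsum n a (U n u))); first by apply: hsum_mono; rewrite /n !leq_max leqnn ?orbT.
apply: le_trans dec (le_trans tail _); by rewrite lerD2r.
Qed.


End limit.
End sequence.

Theorem global_solution : exists U : R -> coefs R,
  [/\ [/\ forall k, k != 0 -> U 0 k = expA s (- eps) V0 k, forall t, U t 0 = 0,
         forall t k, U t k = U (Num.max t 0) k & forall t k, U t (- k) = conjc (U t k)],
      forall k, k != 0 -> cders (U ^~ k)
        (fun t => - ((D k)%:C%C * U t k) - fnl s (psi t) (U t) k),
      forall N t, hsum N a (expA s eps (U t)) <= mu ^+ 2 &
      forall t u, 0 <= t -> t <= u -> forall C, (forall N, hsum N a (U t) <= C) ->
        forall N, hsum N a (U u) <= C].
Proof.
have [V V_galerkin] := boolp.choice exists_galerkin.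
have [U [rho [L [[L0 rho0 rho_small] Um U0 U_lim]]]] := galerkin_limit V_galerkin.
exists U; split; [split| | |].
- move=> k k0; exact: (limit_init V_galerkin rho_small U_lim).
- exact: U0.
- exact: Um.
- move=> t k; exact: (limit_conj V_galerkin rho_small Um U0 U_lim).
- move=> k k0; exact: (limit_eq V_galerkin L0 rho0 rho_small Um U0 U_lim).
- move=> N t; exact: (limit_bound V_galerkin rho_small Um U_lim).
- exact: (limit_decay V_galerkin rho_small U_lim).
Qed.
End global_existence.

(** * Uniqueness against a solution without extra regularity *)

Section uniqueness.
Variables (R : realType) (s a mu M eps : R) (D : freq -> R) (psi : R -> R).
Hypotheses (s0 : 1 / 2 < s) (s1 : s <= 1) (a1 : 1 < a) (mu0 : 0 < mu) (eps0 : 0 < eps).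
Hypothesis D_ge : forall k, k != 0 -> mu * kabs R k `^ (2 * s) <= D k.
Hypothesis psi_ge0 : forall t, 0 <= psi t.
Variables U W : R -> coefs R.
Hypotheses (U_zero : forall t, U t 0 = 0) (W_zero : forall t, W t 0 = 0).
Hypothesis U_bound : forall N t, 0 <= t -> hsum N a (expA s eps (U t)) <= M ^+ 2.
Hypothesis W_bound : forall N t, 0 <= t -> hsum N a (W t) <= M ^+ 2.
Hypothesis U_eq : forall k, k != 0 -> cders (U ^~ k)
  (fun t => - ((D k)%:C%C * U t k) - fnl s (psi t) (U t) k).
Hypothesis W_eq : forall k, k != 0 -> cders (W ^~ k)
  (fun t => - ((D k)%:C%C * W t k) - fnl s (psi t) (W t) k).
Hypothesis UW0 : forall k, U 0 k = W 0 k.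

(** Only U carries the weight e^(eps |k|^s). Both functions solve the truncated system up to the
    error of [fnl_approx], so [bounded_stability] bounds their distance by a multiple of K^(1-a),
    for every K. *)
Theorem solution_unique t : 0 <= t -> W t = U t.
Proof.
have sp : 0 < s by apply: lt_trans s0; rewrite divr_gt0.
have a0 : 0 <= a by rewrite ltW// (lt_trans ltr01).
have [C [L [C0 L0 h]]] := bounded_stability M s0 s1 a1 eps0 mu0.
move=> t0; apply/funext => k; have [->|k0] := eqVneq k 0; first by rewrite U_zero W_zero.
have err K Z : (forall u, Z u 0 = 0) -> (forall N u, 0 <= u -> hsum N a (Z u) <= M ^+ 2) ->
    forall u j, 0 < u -> j \in modes K ->
    normc (nlin K s (psi u) (Z u) (Z u) j - fnl s (psi u) (Z u) j)
      <= 6 * (M ^+ 2 * K.+1%:R `^ (- a)) * kabs R j.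
  move=> Z0 Zb u j u0 jK; rewrite -normc_opp opprB.
  have m0 : 0 <= M ^+ 2 * K.+1%:R `^ (- a) by rewrite mulr_ge0 ?sqr_ge0 ?powR_ge0.
  apply: le_trans (@fnl_approx R s a (psi u) M (Z u) sp s1 a0 (psi_ge0 u) _ (Z0 u) K j) _.
    by move=> N; apply: Zb; exact: ltW.
  by rewrite ler_wpM2r ?kabs_ge0// ler_wpM2r// ler_nat.
have Ub N u : 0 <= u -> hsum N a (U u) <= M ^+ 2.
  by move=> u0; apply: le_trans (U_bound N u0); exact: hsum_le_expA.
apply/eqP; rewrite eq_sym -subr_eq0; apply/eqP/eq0_normc.
apply/eqP; rewrite -sqrf_eq0 eq_le sqr_ge0 andbT.
have CE : 0 <= C * t * expR (L * t) by rewrite !mulr_ge0 ?expR_ge0.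
apply: (@le_eps_scale _ _ (C * t * expR (L * t))) => // e e0.
have b0 : 0 < a - 1 by rewrite subr_gt0.
have [n0 hn] := powR_small b0 e0; pose K := maxn n0 (msup k).
have kK : k \in modes K by rewrite mem_modes k0 leq_maxr.
have {}hn := hn K (leq_maxl _ _); rewrite opprB in hn.
apply: (@le_trans _ _ (\sum_(k <- modes K) normc (U t k - W t k) ^+ 2)).
  exact: (le_modes_sum (f := fun k => normc (U t k - W t k) ^+ 2) (fun j => sqr_ge0 _)).
have {}h := h K D psi U W (fun u j => nlin K s (psi u) (U u) (U u) j - fnl s (psi u) (U u) j)
  (fun u j => nlin K s (psi u) (W u) (W u) j - fnl s (psi u) (W u) j).
apply: le_trans (h _ _ _ _ _ _ _ _ _ t t0) _.
- by move=> j; rewrite mem_modes => /andP[/D_ge].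
- by [].
- by move=> j; rewrite mem_modes => /andP[j0 _]; apply: cders_ext (U_eq j0) _ => u _; ring.
- by move=> j; rewrite mem_modes => /andP[j0 _]; apply: cders_ext (W_eq j0) _ => u _; ring.
- exact: err.
- exact: err.
- by move=> u u0; apply: W_bound; exact: ltW.
- by move=> u u0; apply: U_bound; exact: ltW.
- by move=> j _.
have -> : C * K.+1%:R `^ (1 - a) * t * expR (L * t) =
    C * t * expR (L * t) * K.+1%:R `^ (1 - a) by ring.
by rewrite ler_wpM2l.
Qed.
End uniqueness.

(** * Mild solutions *)

Lemma Rintegral_prim (R : realType) (f : R -> R) (t : R) : continuous f -> 0 <= t ->
  Rintegral (@lebesgue_measure R) `[0, t] f = prim f t.
Proof.
move=> cf t0.
have itf (x y : R) : (@lebesgue_measure R).-integrable `[x, y] (EFin \o f).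
  by apply: continuous_compact_integrable; [exact: segment_compact|exact: continuous_subspaceT].
rewrite /prim (max_l t0) Rintegral_itvB//; last by rewrite bnd_simp.
by rewrite Rintegral_itv_obnd_cbnd//; apply: integrableS (itf 0 t) => //; exact: subset_itv_oc_cc.
Qed.

Lemma sobolev_hsum (R : realType) (a : R) (f : coefs R) (c : R) : 0 <= c ->
  (sobolev_norm a f <= c%:E)%E <-> (forall N, hsum N a f <= c ^+ 2).
Proof.
move=> c0; pose F k := kabs R k `^ (2 * a) * normc (f k) ^+ 2.
have F0 k : 0 <= F k by rewrite mulr_ge0 ?powR_ge0 ?sqr_ge0.
set S := (\esum_(k in [set k : freq | k != 0%R]) (F k)%:E)%E.
have S0 : (0 <= S)%E by apply: esum_ge0 => k _; rewrite lee_fin.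
have cE : (c%:E = ((c ^+ 2)%:E `^ 2^-1)%E).
  by rewrite poweR_EFin powR12_sqrt ?sqr_ge0// sqrtr_sqr ger0_norm.
have h2 : (0 : R) <= 2^-1 by rewrite invr_ge0.
split=> [h N|h].
  have hN : ((hsum N a f)%:E <= S)%E.
    by apply: (@boxes_le_esum _ _ F) => // k.
  have H0 := hsum_ge0 N a f.
  have : (((hsum N a f)%:E `^ 2^-1)%E <= c%:E)%E.
    apply: le_trans h; apply: gt0_ler_poweR => //; rewrite in_itv/= ?lee_fin ?H0 ?S0 ?leey//.
  rewrite poweR_EFin powR12_sqrt// lee_fin => h'.
  by rewrite -[leLHS](sqr_sqrtr H0) lerXn2r// nnegrE ?sqrtr_ge0.
rewrite cE; apply: gt0_ler_poweR => //; rewrite ?in_itv/= ?lee_fin ?sqr_ge0 ?leey ?S0//.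
(* [esum_le_boxes] wants the value 0 at the origin, whereas F may be nonzero there when a = 0, as 0
   to the power 0 is 1. *)
pose G k := if k == 0 then 0 else F k.
rewrite /S (eq_esum (b := fun k => (G k)%:E)); last by move=> k /= /negPf k0; rewrite /G k0.
apply: esum_le_boxes => [k||N]; rewrite /G ?eqxx//; first by case: ifP.
apply: le_trans (h N); rewrite big_seq [leRHS]big_seq; apply: ler_sum => k.
by rewrite mem_modes => /andP[/negPf-> _].
Qed.

Lemma sobolev_ge0 (R : realType) (a : R) (f : coefs R) : (0 <= sobolev_norm a f)%E.
Proof. exact: poweR_ge0. Qed.

Definition cprim (R : realType) (f : R -> R[i]) (t : R) : R[i] :=
  Complex (prim (fun u => Re (f u)) t) (prim (fun u => Im (f u)) t).

Section cprim_theory.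
Variable R : realType.
Implicit Types f g : R -> R[i].

Lemma cders_cprim f : ccont f -> cders (cprim f) f.
Proof. by move=> [h1 h2]; split; exact: ders_prim. Qed.

Lemma cders_cont f g : cders f g -> ccont f.
Proof. by move=> [[h1 _] [h2 _]]; split. Qed.

Lemma cders_const f : cders f (fun=> 0) -> forall t, 0 <= t -> f t = f 0.
Proof.
move=> [h1 h2] t t0; have := ders_unique0 h1 t0; have := ders_unique0 h2 t0.
by case: (f t) (f 0) => x y [z w] /= -> ->.
Qed.

Lemma cders_add f df g dg : cders f df -> cders g dg ->
  cders (fun t => f t + g t) (fun t => df t + dg t).
Proof.
move=> [fr fi] [gr gi]; split.
  have e (z w : R[i]) : Re (z + w) = Re z + Re w by rewrite raddfD.
  by under eq_fun do rewrite e; under [X in ders _ X]eq_fun do rewrite e; exact: ders_add.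
have e (z w : R[i]) : Im (z + w) = Im z + Im w by rewrite raddfD.
by under eq_fun do rewrite e; under [X in ders _ X]eq_fun do rewrite e; exact: ders_add.
Qed.

Lemma cders_cst (z : R[i]) : cders (fun=> z) (fun=> 0).
Proof. by split; exact: ders_cst. Qed.

Lemma cders_eq f g df : cders f df -> (forall t, f t = g t) -> cders g df.
Proof. by move=> h /funext <-. Qed.

Lemma cintegrable_cont f g t : ccont g -> {in `[0, t], f =1 g} -> cintegrable `[0, t] f.
Proof.
move=> [h1 h2] fg.
have H (p : R[i] -> R) : continuous (fun u => p (g u)) ->
    (@lebesgue_measure R).-integrable `[0, t] (fun u => (p (f u))%:E).
  move=> cp.
  have eg : {in `[0, t], (EFin \o (fun u => p (g u))) =1 (fun u => (p (f u))%:E)}.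
    by move=> u ut /=; rewrite fg.
  have mt : measurable (`[0, t] : set (measurableTypeR R)) by exact: measurable_itv.
  refine (eq_integrable mt (EFin \o (fun u => p (g u))) _ _ _).
    by move=> u; rewrite inE => ut; exact: eg.
  by apply: continuous_compact_integrable; [exact: segment_compact|exact: continuous_subspaceT].
by split; apply: H.
Qed.

Lemma cintegral_cprim f g t : ccont g -> 0 <= t -> {in `[0, t], f =1 g} ->
  cintegral `[0, t] f = cprim g t.
Proof.
move=> [h1 h2] t0 fg; rewrite /cintegral /cprim -!Rintegral_prim//.
by congr (Complex _ _); apply: eq_Rintegral => u; rewrite inE => /fg ->.
Qed.

Lemma cprim_realM (c : R) g t : ccont g -> 0 <= t ->
  cprim (fun u => c%:C%C * g u) t = c%:C%C * cprim g t.
Proof.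
move=> [h1 h2] t0.
have e1 : prim (fun u => Re (c%:C%C * g u)) t = c * prim (fun u => Re (g u)) t.
  apply: prim_eqZ => // [|u _]; last by rewrite Re_realM.
  by under eq_fun do rewrite Re_realM; apply: cont_mul => //; exact: cont_cst.
have e2 : prim (fun u => Im (c%:C%C * g u)) t = c * prim (fun u => Im (g u)) t.
  apply: prim_eqZ => // [|u _]; last by rewrite Im_realM.
  by under eq_fun do rewrite Im_realM; apply: cont_mul => //; exact: cont_cst.
by rewrite /cprim e1 e2; apply/eqP; rewrite eq_complex Re_realM Im_realM /= !eqxx.
Qed.

Lemma cprim0 g : cprim g 0 = 0.
Proof. by rewrite /cprim !prim0. Qed.
End cprim_theory.

(** * The transport term in the transformed variables *)

Section transport.
Variables (R : realType) (s a psi M : R) (U : coefs R).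
Hypotheses (s0 : 0 < s) (s1 : s <= 1) (a1 : 1 <= a) (psi0 : 0 <= psi).
Hypothesis U_bound : forall N, hsum N a U <= M ^+ 2.
Hypothesis U0 : U 0 = 0.
Local Notation kabs := (@kabs R).

Let v := expA s (- psi) U.
(** A common majorant in l^2: since a >= 1, Y dominates the Riesz transforms and the first
    derivatives of v, so one convolution bound covers all products. *)
Let Y : coefs R := fun k => (kabs k `^ a)%:C%C * U k.

Let Y_bound N : hsum N 0 Y <= M ^+ 2.
Proof.
apply: le_trans (U_bound N); rewrite le_eqVlt; apply/orP; left; apply/eqP.
apply: eq_bigr => k _; rewrite mulr0 powRr0 mul1r normcM normc_real.
by rewrite ger0_norm ?powR_ge0// exprMn powR_sqr.
Qed.

Let Y0 : Y 0 = 0. Proof. by rewrite /Y U0 mulr0. Qed.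

Let v_le k : normc (v k) <= normc (U k).
Proof.
rewrite normc_expA -[leRHS]mul1r ler_wpM2r ?normc_ge0// -expR0 ler_expR mulNr oppr_le0.
by rewrite mulr_ge0 ?powR_ge0.
Qed.

Let kabs_le_pow k : kabs k <= kabs k `^ a.
Proof.
have [->|k0] := eqVneq k 0; first by rewrite kabs0 powR_ge0.
by rewrite -[leLHS]powRr1 ?kabs_ge0//; apply: ler_powR => //; exact: kabs_ge1.
Qed.

Let normY k : normc (Y k) = kabs k `^ a * normc (U k).
Proof. by rewrite normcM normc_real ger0_norm ?powR_ge0. Qed.

Let U_le_Y k : normc (U k) <= normc (Y k).
Proof.
have [->|k0] := eqVneq k 0; first by rewrite U0 Y0.
rewrite normY -[leLHS]mul1r ler_wpM2r ?normc_ge0//.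
exact: le_trans (kabs_ge1 R k0) (kabs_le_pow k).
Qed.

Let riesz_le (x : int) (k : freq) : `|x%:~R| <= kabs k -> `|x%:~R / kabs k| <= 1.
Proof.
move=> h; rewrite normrM normfV (ger0_norm (kabs_ge0 R k)).
have [->|n0] := eqVneq (kabs k) 0; first by rewrite invr0 mulr0.
by rewrite ler_pdivrMr ?mul1r// lt_neqAle eq_sym n0 kabs_ge0.
Qed.

Let coord1 (k : freq) : `|k.1%:~R| <= kabs k.
Proof. by rewrite -sqrtr_sqr ler_wsqrtr// lerDl sqr_ge0. Qed.
Let coord2 (k : freq) : `|k.2%:~R| <= kabs k.
Proof. by rewrite -sqrtr_sqr ler_wsqrtr// lerDr sqr_ge0. Qed.

Let normc_i : normc (Complex 0 1 : R[i]) = 1.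
Proof. by rewrite /= expr0n expr1n add0r sqrtr1. Qed.

Let normc_ix (x : R) : normc (Complex 0 1 * x%:C%C : R[i]) = `|x|.
Proof. by rewrite normcM normc_i normc_real mul1r. Qed.

Let normc_Nix (x : R) : normc (- Complex 0 1 * x%:C%C : R[i]) = `|x|.
Proof. by rewrite mulNr normc_opp normc_ix. Qed.

Let riesz1_le k : normc (riesz1 v k) <= normc (Y k).
Proof.
rewrite /riesz1 /fmult normcM normc_Nix.
apply: le_trans (le_trans (v_le k) (U_le_Y k)).
by rewrite -[leRHS]mul1r ler_wpM2r ?normc_ge0// riesz_le.
Qed.

Let riesz2_le k : normc ((\- riesz2 v) k) <= normc (Y k).
Proof.
rewrite /= /riesz2 /fmult normc_opp normcM normc_Nix.
apply: le_trans (le_trans (v_le k) (U_le_Y k)).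
by rewrite -[leRHS]mul1r ler_wpM2r ?normc_ge0// riesz_le.
Qed.

Let partial1_le k : normc (partial1 v k) <= normc (Y k).
Proof.
rewrite /partial1 /fmult normcM normc_ix normY.
by apply: ler_pM; rewrite ?normr_ge0 ?normc_ge0//; exact: le_trans (coord1 k) (kabs_le_pow k).
Qed.

Let partial2_le k : normc (partial2 v k) <= normc (Y k).
Proof.
rewrite /partial2 /fmult normcM normc_ix normY.
by apply: ler_pM; rewrite ?normr_ge0 ?normc_ge0//; exact: le_trans (coord2 k) (kabs_le_pow k).
Qed.

Let prod_bound (f g : coefs R) (k : freq) :
  (forall j, normc (f j) <= normc (Y j)) -> (forall j, normc (g j) <= normc (Y j)) ->
  f 0 * g (k - 0) = 0 /\ forall N, \sum_(j <- modes N) normc (f j * g (k - j)) <= 1 * M ^+ 2.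
Proof.
move=> hf hg.
apply: (@conv_bound R 0 M Y (lexx 0) Y_bound Y0 k 1 (fun j => f j * g (k - j)) ler01) => j.
by rewrite mul1r normcM ler_pM ?normc_ge0.
Qed.

Lemma transport_defined_expA : transport_defined v v.
Proof.
split=> k.
  by have [h1 h2] := prod_bound k riesz2_le partial1_le; exact: csummable_boxes h1 h2.
by have [h1 h2] := prod_bound k riesz1_le partial2_le; exact: csummable_boxes h1 h2.
Qed.

(** Termwise, e^(-psi |k|^s) times [wexp] is e^(-psi |j|^s) e^(-psi |l|^s), and the two factors i in
    the symbols multiply to -1, which leaves the symbol [csym]. *)
Lemma transport_expA k :
  transport v v k = (expR (- psi * kabs k `^ s))%:C%C * fnl s psi U k.
Proof.
have [f0 fb] := prod_bound k riesz2_le partial1_le.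
have [g0 gb] := prod_bound k riesz1_le partial2_le.
have [h0 hb] : (csym R 0 (k - 0) * wexp s psi k 0 (k - 0))%:C%C * (U 0 * U (k - 0)) = 0 /\
    forall N, \sum_(j <- modes N) normc ((csym R j (k - j) * wexp s psi k j (k - j))%:C%C *
      (U j * U (k - j))) <= kabs k * M ^+ 2.
  apply: (@conv_bound R 0 M Y (lexx 0) Y_bound Y0 k (kabs k) _ (kabs_ge0 R k)) => j.
  rewrite [X in X <= _]normcM [normc (U j * _)]normcM normc_real.
  apply: ler_pM; rewrite ?normr_ge0 ?mulr_ge0 ?normc_ge0//; last first.
    by apply: ler_pM; rewrite ?normc_ge0.
  rewrite normrM -[leRHS]mulr1 ler_pM ?normr_ge0// ?csym_le//.
  by rewrite ger0_norm ?wexp_ge0 ?wexp_le1.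
have C1 : 1 * M ^+ 2 <= (kabs k + 1) * M ^+ 2 by rewrite ler_wpM2r ?sqr_ge0// lerDr kabs_ge0.
have C2 : kabs k * M ^+ 2 <= (kabs k + 1) * M ^+ 2 by rewrite ler_wpM2r ?sqr_ge0// lerDl.
apply: (csum_lin (C := (kabs k + 1) * M ^+ 2)) => //; last 3 first.
- by move=> N; apply: le_trans (fb N) C1.
- by move=> N; apply: le_trans (gb N) C1.
- by move=> N; apply: le_trans (hb N) C2.
move=> j; set l := k - j.
have -> : csym R j l = j.1%:~R / kabs j * l.2%:~R - j.2%:~R / kabs j * l.1%:~R.
  by rewrite /csym /cross; ring.
have E : expR (- psi * kabs k `^ s) * wexp s psi k j l =
    expR (- psi * kabs j `^ s) * expR (- psi * kabs l `^ s).
  have h (x y z : R) : expR (- psi * x) * expR (psi * (x - y - z)) =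
      expR (- psi * y) * expR (- psi * z) by rewrite -!expRD; apply: (congr1 expR); ring.
  exact: h.
rewrite mulrA -rmorphM/= [expR _ * (_ * _)]mulrCA E /v /expA.
rewrite /riesz1 /riesz2 /partial1 /partial2 /fmult.
have I2 : Complex 0 1 * Complex 0 1 = -1 :> R[i].
  by apply/eqP; rewrite eq_complex /= !mul0r mulr0 mul1r sub0r addr0 oppr0 !eqxx.
have H (i Uj Ul : R[i]) (x1 x2 y1 y2 e1 e2 : R) : i * i = -1 ->
    - (- i * x2%:C%C * (e1%:C%C * Uj)) * (i * y1%:C%C * (e2%:C%C * Ul)) +
    - i * x1%:C%C * (e1%:C%C * Uj) * (i * y2%:C%C * (e2%:C%C * Ul)) =
    ((x1 * y2 - x2 * y1) * (e1 * e2))%:C%C * (Uj * Ul).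
  move=> i2; rewrite rmorphM rmorphB/= !rmorphM/=.
  have -> : - (- i * x2%:C%C * (e1%:C%C * Uj)) * (i * y1%:C%C * (e2%:C%C * Ul)) +
      - i * x1%:C%C * (e1%:C%C * Uj) * (i * y2%:C%C * (e2%:C%C * Ul)) =
      (i * i) * (x2%:C%C * y1%:C%C - x1%:C%C * y2%:C%C) * (e1%:C%C * e2%:C%C) * (Uj * Ul) by ring.
  by rewrite i2; ring.
exact: H.
Qed.
End transport.

Lemma ereal_cvg0P (R : realType) (T : Type) (F : set_system T) (FF : Filter F) (f : T -> \bar R) :
  (forall x, (0 <= f x)%E) ->
  (f @ F --> 0%E) <-> (forall e : R, 0 < e -> \forall x \near F, (f x <= e%:E)%E).
Proof.
move=> f0; split=> [/fine_cvgP[fin /cvgrPdist_le h] e e0|h].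
  near=> x.
  have fx : f x \is a fin_num by near: x.
  have : `|0 - fine (f x)| <= e by near: x; exact: h.
  by rewrite sub0r normrN ger0_norm ?fine_ge0// -lee_fin fineK.
apply/fine_cvgP; split.
  apply: filterS (h 1 ltr01) => x fx; rewrite ge0_fin_numE//.
  by apply: le_lt_trans fx _; rewrite ltry.
apply/cvgrPdist_le => e e0; apply: filterS (h e e0) => x fx.
rewrite sub0r normrN /= ger0_norm ?fine_ge0// -lee_fin fineK// ge0_fin_numE//.
by apply: le_lt_trans fx _; rewrite ltry.
Unshelve. all: by end_near. Qed.

Lemma eq_cintegral (R : realType) (t : R) (f g : R -> R[i]) : {in `[0, t], f =1 g} ->
  cintegral `[0, t] f = cintegral `[0, t] g.
Proof.
by move=> fg; congr (Complex _ _); apply: eq_Rintegral => u; rewrite inE => /fg ->.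
Qed.

Lemma ders_pos (R : realType) (f g df : R -> R) : ders g df ->
  (forall t, f t = g (Num.max t 0)) -> ders f df.
Proof.
move=> [cg dg] fg; have -> : f = (fun t => g (Num.max t 0)) by apply/funext.
split=> [|t t0]; first by apply: (cont_comp (@max0_cont R)).
apply: near_eq_is_derive (dg t t0).
near=> u; rewrite max_l//.
by apply: ltW; near: u; exact: lt_nbhsr.
Unshelve. all: by end_near. Qed.

Lemma cders_pos (R : realType) (f g df : R -> R[i]) : cders g df ->
  (forall t, f t = g (Num.max t 0)) -> cders f df.
Proof. by move=> [h1 h2] fg; split; [apply: ders_pos h1 _|apply: ders_pos h2 _] => t; rewrite fg. Qed.

(** * Solutions for a fixed path below the barrier *)

Section pathwise.
Variables (R : realType) (s nu sigma alpha eps beta : R) (u0 : coefs R) (b : R -> R).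
Hypotheses (hs0 : 0 < s) (hs1 : s <= 1).
Hypotheses (hsigma1 : 1 / s < sigma) (hsigma2 : sigma < 2).
Hypothesis heps : 0 < eps.
Hypotheses (hbeta0 : 0 < beta) (hbeta1 : beta < nu ^+ 2 / 2).
Hypothesis hu0 : real_mean_zero u0.
Hypothesis hsmall : (gevrey_norm s sigma (alpha + eps)%R u0 <= (nu ^+ 2 / 2 - beta)%:E)%E.
Hypothesis b_cont : {within `[0, +oo[, continuous b}.
Hypothesis b_le : forall t, 0 <= t -> nu * b t <= alpha + beta * t.
Local Notation kabs := (@kabs R).

Let phi (t : R) := alpha + beta * t.
Let a := sigma * s.
Let mu := nu ^+ 2 / 2 - beta.
Let lam (k : freq) := nu ^+ 2 / 2 * kabs k `^ (2 * s).
Let D (k : freq) := lam k - beta * kabs k `^ s.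
Let pos (t : R) := Num.max t 0.
Let psi (t : R) := phi (pos t) - nu * b (pos t).

Let pos_ge0 t : 0 <= pos t. Proof. by rewrite le_max lexx orbT. Qed.
Let posE t : 0 <= t -> pos t = t. Proof. by move=> t0; rewrite /pos max_l. Qed.
Let pos_cont : continuous pos. Proof. exact: max0_cont. Qed.

Let s2 : 1 / 2 < s.
Proof.
have : 1 / s < 2 by exact: lt_trans hsigma1 hsigma2.
by rewrite ltr_pdivrMr// ltr_pdivrMr// mulrC.
Qed.

Let a1 : 1 < a. Proof. by rewrite /a -ltr_pdivrMr. Qed.
Let a2 : a < 2 * s. Proof. by rewrite /a ltr_pM2r. Qed.
Let a0 : 0 < a. Proof. exact: lt_trans a1. Qed.
Let mu0 : 0 < mu. Proof. by rewrite subr_gt0. Qed.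

Let D_ge k : k != 0 -> mu * kabs k `^ (2 * s) <= D k.
Proof.
move=> k0; rewrite /D /lam /mu mulrBl lerD2l lerN2 ler_wpM2l ?(ltW hbeta0)//.
apply: ler_powR; first exact: kabs_ge1.
by rewrite ler_peMl ?(ltW hs0)// ler1n.
Qed.

Let D_even k : D (- k) = D k. Proof. by rewrite /D /lam kabsN. Qed.

Let psi_ge0 t : 0 <= psi t. Proof. by rewrite subr_ge0 b_le. Qed.

Let b_pos_cont : continuous (fun t => b (pos t)).
Proof.
move=> t; apply/cvgrPdist_le => e e0.
have /subspace_continuousP h := b_cont.
have pA : `[0, +oo[%classic (pos t) by rewrite /= in_itv/= andbT.
have /cvgrPdist_le/(_ _ e0) H := h _ pA.
(* A limit within [0, +oo[ is a neighbourhood of points for which membership implies the estimate;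
   pulled back along [pos], the membership always holds. *)
have H' : nbhs (pos t) (fun x => x \in `[0, +oo[ -> `|b (pos t) - b x| <= e) := H.
have G : \forall u \near t, pos u \in `[0, +oo[ -> `|b (pos t) - b (pos u)| <= e :=
  @pos_cont t _ H'.
apply: filterS G => u; apply.
by rewrite in_itv/= andbT.
Qed.

Let psi_cont : continuous psi.
Proof.
apply: cont_add; last first.
  by apply: cont_opp; apply: cont_mul; [exact: cont_cst|exact: b_pos_cont].
apply: cont_add; first exact: cont_cst.
by apply: cont_mul; [exact: cont_cst|exact: pos_cont].
Qed.

Let psi_max t : psi t = psi (pos t). Proof. by rewrite /psi (posE (pos_ge0 t)). Qed.

Let V0 := expA s (alpha + eps) u0.

Let expA_conj c (f : coefs R) k : f (- k) = conjc (f k) ->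
  expA s c f (- k) = conjc (expA s c f k).
Proof. by move=> h; rewrite /expA /fmult h kabsN conjcM_eq conjc_realE. Qed.

Let V0_conj k : V0 (- k) = conjc (V0 k).
Proof. by apply: expA_conj; case: hu0 => ->. Qed.

Let V0_small N : hsum N a V0 <= mu ^+ 2.
Proof. by move: N; apply/(sobolev_hsum a V0 (ltW mu0)). Qed.

Lemma expA_at0 c (f : coefs R) : expA s c f 0 = f 0.
Proof. by rewrite /expA /fmult kabs0 powR0 ?gt_eqF// mulr0 expR0 mul1r. Qed.

Let phi_ders k : ders (fun t => expR (lam k * t - phi t * kabs k `^ s))
  (fun t => (lam k - beta * kabs k `^ s) * expR (lam k * t - phi t * kabs k `^ s)).
Proof.
have e t : lam k * t - phi t * kabs k `^ s = - (alpha * kabs k `^ s) + D k * t.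
  by rewrite /phi /D; ring.
under eq_fun do rewrite e; under [X in ders _ X]eq_fun do rewrite e.
exact: ders_expR.
Qed.

(* The unknown in the variables U_k = e^(phi |k|^s) u_k. *)
Let good (U : R -> coefs R) : Prop :=
  [/\ forall t, U t 0 = 0, exists M : R, forall N t, hsum N a (U t) <= M ^+ 2,
      forall j, ccont (U ^~ j) & forall t, U t = U (pos t)].

Let nonlin U k t : R[i] := fnl s (psi t) (U t) k.

(** e^(lam t - phi |k|^s) is the integrating factor of the equation for U_k: the derivative of its
    product with U_k is minus this field. *)
Let mild_field U k t : R[i] :=
  (expR (lam k * t - phi t * kabs k `^ s))%:C%C * nonlin U k t.

Let good_nonlin U k : good U -> ccont (nonlin U k).
Proof. by move=> [h1 [M hM] h3 _]; apply: (fnl_cont k hs0 hs1 a0 psi_ge0 psi_cont h3 h1 hM). Qed.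

Let good_field U k : good U -> ccont (mild_field U k).
Proof.
move=> gU; apply: ccont_realM; last exact: good_nonlin.
by have [] := phi_ders k.
Qed.

Let unknown (U : R -> coefs R) (t : R) : coefs R := expA s (- phi t) (U t).

(** The heat factor splits as e^(-lam t) e^(lam tau), so t leaves the integral; [Gam] and [Gaminv]
    combine with e^(phi |k|^s) into the weights in psi. *)
Let integrandE U t tau k : good U -> 0 <= tau ->
  heat s nu (t - tau) (Gam s nu (b tau) (transport (Gaminv s nu (b tau) (unknown U tau))
    (Gaminv s nu (b tau) (unknown U tau)))) k =
  (expR (- (lam k * t)))%:C%C * mild_field U k tau.
Proof.
move=> [h1 [M hM] h3 _] tau0.
have vE : Gaminv s nu (b tau) (unknown U tau) = expA s (- psi tau) (U tau).
  by rewrite /Gaminv /unknown expA_comp /psi !posE// opprB.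
rewrite vE /heat /Gam /fmult /expA {1}/fmult -/(expA s (- psi tau) (U tau)).
rewrite (transport_expA hs0 hs1 (ltW a1) (psi_ge0 tau) (fun N => hM N tau) (h1 tau)).
rewrite /mild_field /nonlin !mulrA -!rmorphM/= -!expRD.
congr (_%:C%C * _); apply: (congr1 expR); rewrite /psi !posE// /lam.
move: (kabs k `^ (2 * s)) (kabs k `^ s) => x y; rewrite /phi; by field.
Qed.

Let defined U t : good U -> 0 <= t ->
  transport_defined (Gaminv s nu (b t) (unknown U t)) (Gaminv s nu (b t) (unknown U t)).
Proof.
move=> [h1 [M hM] h3 _] t0.
have -> : Gaminv s nu (b t) (unknown U t) = expA s (- psi t) (U t).
  by rewrite /Gaminv /unknown expA_comp /psi !posE// opprB.
by refine (transport_defined_expA _ (ltW a1) (psi_ge0 t) (fun N => hM N t) (h1 t)).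
Qed.

Let duhamel U k t : good U -> 0 <= t ->
  cintegrable `[0, t] (fun tau => heat s nu (t - tau)
    (Gam s nu (b tau) (transport (Gaminv s nu (b tau) (unknown U tau))
      (Gaminv s nu (b tau) (unknown U tau)))) k) /\
  cintegral `[0, t] (fun tau => heat s nu (t - tau)
    (Gam s nu (b tau) (transport (Gaminv s nu (b tau) (unknown U tau))
      (Gaminv s nu (b tau) (unknown U tau)))) k)
  = (expR (- (lam k * t)))%:C%C * cprim (mild_field U k) t.
Proof.
move=> gU t0.
have c : ccont (fun tau => (expR (- (lam k * t)))%:C%C * mild_field U k tau).
  by apply: ccont_realM; [exact: cont_cst|exact: good_field].
have e : {in `[0, t], (fun tau => heat s nu (t - tau)
    (Gam s nu (b tau) (transport (Gaminv s nu (b tau) (unknown U tau))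
      (Gaminv s nu (b tau) (unknown U tau)))) k) =1
    (fun tau => (expR (- (lam k * t)))%:C%C * mild_field U k tau)}.
  by move=> tau; rewrite in_itv/= => /andP[tau0 _]; exact: integrandE.
split; first exact: cintegrable_cont c e.
by rewrite (cintegral_cprim c t0 e) cprim_realM//; exact: good_field.
Qed.

Let heatE t k : heat s nu t u0 k = (expR (- (lam k * t)))%:C%C * u0 k.
Proof.
rewrite /heat /fmult /lam; congr (_%:C%C * _); apply: (congr1 expR).
by move: (kabs k `^ (2 * s)) => x; field.
Qed.

Let nonlin_at0 U t : good U -> nonlin U 0 t = 0.
Proof.
move=> [h1 [M hM] _ _].
have := fnl_approx hs0 hs1 (ltW a0) (psi_ge0 t) (fun N => hM N t) (h1 t) 0 0.
rewrite kabs0 mulr0 /nlin big_nil subr0 => h; apply: eq0_normc.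
by apply/eqP; rewrite eq_le h normc_ge0.
Qed.

Let mild_eq U k := cders (U ^~ k) (fun t => - ((D k)%:C%C * U t k) - nonlin U k t).

Let mild_eq0 U : good U -> mild_eq U 0.
Proof.
move=> gU; have [h1 _ _ _] := gU.
apply: (@cders_eq _ (fun=> 0)) => [|t]; last by rewrite h1.
apply: cders_ext (cders_cst 0) _ => t _.
by rewrite nonlin_at0// h1 mulr0 subr0 oppr0.
Qed.

Let mild_of_ode U k t : good U -> mild_eq U k -> U 0 k = expA s alpha u0 k -> 0 <= t ->
  unknown U t k = heat s nu t u0 k - (expR (- (lam k * t)))%:C%C * cprim (mild_field U k) t.
Proof.
move=> gU Ueq U0 t0; pose c t := expR (lam k * t - phi t * kabs k `^ s).
have Zd := cders_realM (phi_ders k) Ueq.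
have Zc := cders_add Zd (cders_cprim (good_field k gU)).
have {}Zc : cders (fun t => (c t)%:C%C * U t k + cprim (mild_field U k) t) (fun=> 0).
  apply: cders_ext Zc _ => u _; rewrite /mild_field rmorphM/= -/(D k) -/(c u).
  by ring.
have := cders_const Zc t0; rewrite /= cprim0 addr0 U0 => Zt.
have c0 : (c 0)%:C%C * expA s alpha u0 k = u0 k.
  rewrite /expA /fmult mulrA -rmorphM/= /c -expRD /phi !mulr0 addr0 sub0r addNr expR0.
  by rewrite mul1r.
rewrite c0 in Zt; rewrite heatE -Zt mulrDr addrK mulrA -rmorphM/= /c -expRD.
by rewrite /unknown /expA /fmult addrA addNr sub0r mulNr.
Qed.

Let ode_of_mild U k : good U ->
  (forall t, 0 <= t -> unknown U t k =
     heat s nu t u0 k - (expR (- (lam k * t)))%:C%C * cprim (mild_field U k) t) ->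
  mild_eq U k.
Proof.
move=> gU h; have [_ _ _ hpos] := gU.
pose c t := expR (- (lam k * t - phi t * kabs k `^ s)).
have cd : ders c (fun t => - D k * c t).
  have e t : - (lam k * t - phi t * kabs k `^ s) = alpha * kabs k `^ s + - D k * t.
    by rewrite /phi /D; ring.
  rewrite /c; under eq_fun do rewrite e; under [X in ders _ X]eq_fun do rewrite e.
  exact: ders_expR.
have Gd := cders_realM cd (cders_sub (cders_cst (u0 k)) (cders_cprim (good_field k gU))).
have UE t : 0 <= t -> U t k = (c t)%:C%C * (u0 k - cprim (mild_field U k) t).
  move=> t0; have := h t t0; rewrite heatE -mulrBr /unknown /expA /fmult => e.
  have : (expR (phi t * kabs k `^ s))%:C%C * ((expR (- phi t * kabs k `^ s))%:C%C * U t k) = U t k.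
    by rewrite mulrA -rmorphM/= -expRD -mulrDl subrr mul0r expR0 mul1r.
  rewrite e mulrA -rmorphM/= -expRD => <-; congr (_%:C%C * _); apply: (congr1 expR); ring.
apply: cders_ext (cders_pos Gd _) _ => [t|t t0]; first by rewrite hpos UE.
rewrite sub0r UE ?(ltW t0)// /mild_field rmorphM/= rmorphN/=.
have cc : (c t)%:C%C * (expR (lam k * t - phi t * kabs k `^ s))%:C%C = 1 :> R[i].
  by rewrite -rmorphM/= -expRD addNr expR0.
set e := (expR _)%:C%C in cc *; set X := u0 k - _.
transitivity (- ((D k)%:C%C * ((c t)%:C%C * X)) - (c t)%:C%C * e * nonlin U k t); first by ring.
by rewrite cc mul1r.
Qed.

(** On a finite box the norm of the difference is continuous in time; outside it [gevrey_tail] is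
    uniform in time, with B = (2 mu)^2 bounding the difference of two functions of norm at most
    mu. *)
Let good_cont (U : R -> coefs R) : good U ->
  (forall N t, hsum N a (expA s eps (U t)) <= mu ^+ 2) ->
  forall t e, 0 < e -> \forall u \near t, (sobolev_norm a (fun k => (U u k - U t k)%R) <= e%:E)%E.
Proof.
move=> [_ _ cU _] Ub t e e0.
pose B : R := (2 * mu) ^+ 2; pose q := B / (2 * eps).
have B0 : 0 < B by rewrite exprn_gt0// mulr_gt0.
have q0 : 0 < q by rewrite divr_gt0// mulr_gt0.
have ee : 0 < e ^+ 2 / 2 by rewrite divr_gt0// exprn_gt0.
have [K /(_ K (leqnn _))] := powR_small hs0 (divr_gt0 ee q0).
rewrite ler_pdivlMr// => hK.
pose g u := hsum K a (fun k => U u k - U t k).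
have cg : continuous g.
  apply: cont_sum => k _; apply: cont_mul; first exact: cont_cst.
  apply: ccont_normc_sqr; apply: ccont_add => //.
  by split; exact: cont_cst.
have gt : g t = 0.
  by apply: big1 => k _; rewrite subrr normc0 expr0n mulr0.
have /cvgrPdist_le/(_ _ ee) := cg t; rewrite gt.
apply: filterS => u; rewrite sub0r normrN ger0_norm ?hsum_ge0// => gu.
apply/(sobolev_hsum a _ (ltW e0)) => N.
pose n := maxn N K; have Kn : (K <= n)%N by exact: leq_maxr.
apply: le_trans (@hsum_mono R N n a _ (leq_maxl _ _)) _.
rewrite [leLHS](sum_modes_split _ Kn).
have -> : e ^+ 2 = e ^+ 2 / 2 + e ^+ 2 / 2 by field.
apply: lerD; first exact: gu.
apply: (le_trans (@gevrey_tail R s a eps B n K _ hs0 heps _)); last by rewrite mulrC.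
rewrite -hnorm_sqr /B lerXn2r ?nnegrE ?hnorm_ge0 ?mulr_ge0 ?(ltW mu0)//.
have hn v : hnorm n a (expA s eps (U v)) <= mu.
  by rewrite -[leRHS](ger0_norm (ltW mu0)) -sqrtr_sqr ler_wsqrtr.
have -> : expA s eps (fun k => U u k - U t k) =
    (fun k => expA s eps (U u) k - expA s eps (U t) k).
  by apply/funext => k; rewrite /expA /fmult mulrBr.
apply: le_trans (hnormD _ _ _ (fun k => - expA s eps (U t) k)) _.
have -> : hnorm n a (fun k => - expA s eps (U t) k) = hnorm n a (expA s eps (U t)).
  by rewrite /hnorm; congr Num.sqrt; apply: eq_bigr => k _; rewrite normc_opp.
by rewrite [2 * _]mulr_natl mulr2n lerD.
Qed.

(** Brings an arbitrary competitor into the scope of [solution_unique]: continuity in the Gevrey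
    norm gives continuity of each coefficient, and then the Duhamel formula can be
    differentiated. *)
Let exists_unknown (v : R -> coefs R) : C0_gevrey s sigma `[0, +oo[ phi v ->
  mild_solution s nu b u0 v -> exists W : R -> coefs R,
  [/\ good W, forall t, 0 <= t -> v t = unknown W t, forall k, W 0 k = expA s alpha u0 k &
      forall k, mild_eq W k].
Proof.
move=> [vmz vcont vsup] [_ vmild].
pose W t := expA s (phi (pos t)) (v (pos t)).
have inJ t : `[0, +oo[%classic (pos t) by rewrite /= in_itv/= andbT.
have vW t : 0 <= t -> v t = unknown W t.
  by move=> t0; rewrite /unknown /W posE// expA_comp addNr expA0.
have W0 t : W t 0 = 0.
  by rewrite /W expA_at0; case: (vmz _ (inJ t)).
have Wb : exists M : R, forall N t, hsum N a (W t) <= M ^+ 2.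
  set S := ereal_sup _ in vsup.
  have le t : (sobolev_norm a (W t) <= S)%E.
    by apply: ereal_sup_ubound; exists (pos t).
  have S0 : (0 <= S)%E by apply: le_trans (le 0); exact: sobolev_ge0.
  have fS : S \is a fin_num by rewrite ge0_fin_numE.
  exists (fine S) => N t; move: N; apply/(sobolev_hsum a (W t) (fine_ge0 S0)).
  by rewrite fineK.
have Wc j : ccont (W ^~ j).
  have [->|j0] := eqVneq j 0.
    by under eq_fun do rewrite W0; split; exact: cont_cst.
  have h t e : 0 < e -> \forall u \near t, normc (W t j - W u j) <= e.
    move=> e0; have := vcont (pos t) (inJ t) => /ereal_cvg0P h.
    have {}h := h (fun _ => sobolev_ge0 _ _) e e0.
    pose Q (x : R) : Prop := x \in `[0, +oo[ -> (sobolev_norm a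
      (expA s (phi x) (v x) \- expA s (phi (pos t)) (v (pos t)))%R <= e%:E)%E.
    have h' : nbhs (pos t) Q := h.
    have G : \forall u \near t, Q (pos u) := @pos_cont t _ h'.
    apply: filterS G => u /(_ (inJ u))/(sobolev_hsum a _ (ltW e0))/(_ (msup j)) G.
    rewrite -opprB normc_opp.
    have jm : j \in modes (msup j) by rewrite mem_modes j0 leqnn.
    apply: le_trans (@normc_le_hnorm R (msup j) a (fun k => W u k - W t k) j (ltW a0) jm) _.
    by rewrite -[leRHS](ger0_norm (ltW e0)) -sqrtr_sqr ler_wsqrtr.
  split=> t; apply/cvgrPdist_le => e e0; apply: filterS (h t e e0) => u; apply: le_trans.
    by rewrite -raddfB; exact: Re_le_normc.
  by rewrite -raddfB; exact: Im_le_normc.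
have gW : good W by split=> // t; rewrite /W (posE (pos_ge0 t)).
have md k t : 0 <= t -> unknown W t k =
    heat s nu t u0 k - (expR (- (lam k * t)))%:C%C * cprim (mild_field W k) t.
  move=> t0; have [_ e] := duhamel k gW t0; have [_ ev] := vmild t t0 k.
  rewrite -(vW t t0) ev -e; apply: (congr1 (fun z => heat s nu t u0 k - z)).
  apply: eq_cintegral => tau; rewrite in_itv/= => /andP[tau0 _].
  by rewrite (vW tau tau0).
exists W; split=> // [k|k]; last exact: ode_of_mild (md k).
have := md k 0 (lexx 0); rewrite cprim0 mulr0 subr0 heatE mulr0 oppr0 expR0 mul1r => e.
have -> : W 0 = expA s alpha (unknown W 0).
  rewrite /unknown expA_comp; have -> : alpha + - phi 0 = 0 by rewrite /phi mulr0 addr0 subrr.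
  by rewrite expA0.
by rewrite /expA /fmult e.
Qed.

Theorem pathwise_solution : exists u : R -> coefs R,
  [/\ C0_gevrey s sigma `[0, +oo[ phi u, mild_solution s nu b u0 u,
      forall v : R -> coefs R, C0_gevrey s sigma `[0, +oo[ phi v ->
        mild_solution s nu b u0 v -> forall t : R, 0 <= t -> v t = u t &
      forall t1 t2 : R, 0 <= t1 -> t1 <= t2 ->
        (gevrey_norm s sigma (phi t2) (u t2) <= gevrey_norm s sigma (phi t1) (u t1))%E].
Proof.
have [U [[Uinit U0 Um Uconj] Ueq Ub Udec]] := @global_solution R s a mu eps D psi V0
  s2 hs1 a1 a2 mu0 heps D_ge D_even psi_ge0 psi_cont psi_max V0_conj V0_small.
have Ub' N t : hsum N a (U t) <= mu ^+ 2.
  by apply: le_trans (Ub N t); exact: hsum_le_expA.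
have gU : good U.
  split=> [//||j|t]; first by exists mu.
  - have [->|j0] := eqVneq j 0; last by have := Ueq _ j0 => /cders_cont.
    by under eq_fun do rewrite U0; split; exact: cont_cst.
  - by apply/funext => k; exact: Um.
have Ueq' k : mild_eq U k.
  by have [->|k0] := eqVneq k 0; [exact: mild_eq0|exact: Ueq].
have Uinit' k : U 0 k = expA s alpha u0 k.
  have [->|k0] := eqVneq k 0; first by rewrite U0 expA_at0; case: hu0.
  by rewrite Uinit// /V0 expA_comp [- eps + _]addrC addrK.
have uE t : expA s (phi t) (unknown U t) = U t.
  by rewrite /unknown expA_comp subrr expA0.
have gevU t : gevrey_norm s sigma (phi t) (unknown U t) = sobolev_norm a (U t).
  by rewrite /gevrey_norm uE.
exists (unknown U); split.
- split=> [t _|t t0|].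
  + split=> [k|]; first exact: expA_conj.
    by rewrite /unknown expA_at0 U0.
  + have -> : (fun t' => sobolev_norm (sigma * s) (expA s (phi t') (unknown U t') \-
        expA s (phi t) (unknown U t))) = (fun t' => sobolev_norm a (fun k => (U t' k - U t k)%R)).
      by apply/funext => t'; rewrite !uE.
    apply/ereal_cvg0P => [u|e e0]; first exact: sobolev_ge0.
    by apply: cvg_within; exact: good_cont gU Ub t e e0.
  + apply: le_lt_trans (ltry mu); apply: ge_ereal_sup => _ [t t0 <-].
    by rewrite gevU; apply/(sobolev_hsum a _ (ltW mu0)).
- split=> [t t0|t t0 k]; first exact: defined.
  have [h1 h2] := duhamel k gU t0; split=> //.
  by rewrite h2; exact: mild_of_ode.
- move=> v hv mv t t0.
  have [W [gW vW W0 Weq]] := exists_unknown hv mv.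
  have [_ [M hM] _ _] := gW.
  rewrite vW//; congr (expA s _ _).
  (* A common bound: [solution_unique] uses the same constant for both solutions, and the competitor
     may be larger than mu. *)
  pose C := mu + `|M|.
  have sq_le (x y : R) : 0 <= x -> x <= y -> x ^+ 2 <= y ^+ 2.
    by move=> x0 xy; rewrite !expr2; apply: ler_pM.
  have muC : mu ^+ 2 <= C ^+ 2 by apply: sq_le; [exact: ltW|rewrite /C lerDl].
  have MC : M ^+ 2 <= C ^+ 2.
    by rewrite -real_normK ?num_real//; apply: sq_le; rewrite ?normr_ge0// /C lerDr ltW.
  apply: (@solution_unique R s a mu C eps D psi s2 hs1 a1 mu0 heps D_ge psi_ge0 U W) => //.
  + by have [] := gW.
  + by move=> N u _; apply: le_trans (Ub N u) muC.
  + by move=> N u _; apply: le_trans (hM N u) MC.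
  + by move=> k _; exact: Weq.
  + by move=> k; rewrite Uinit' W0.
- move=> t1 t2 t10 t12; rewrite !gevU.
  have := sobolev_ge0 a (U t1); case E : (sobolev_norm a (U t1)) => [c| |] //=; last by move=> _; rewrite leey.
  rewrite lee_fin => c0; apply/(sobolev_hsum a _ c0).
  apply: (Udec t1 t2 t10 t12); apply/(sobolev_hsum a _ c0).
  by rewrite E.
Qed.

End pathwise.

(** * The barrier event *)

Section normal_density.
Variables (R : realType).
Local Notation leb := (@lebesgue_measure R).

(** [normal_prob] is given by its values on sets; its Radon-Nikodym derivative with respect to
    Lebesgue measure agrees almost everywhere with [normal_pdf]. *)
Lemma integral_normal_prob (m s : R) (f : R -> R) : (forall x, 0 <= f x) ->
  measurable_fun [set: R] f ->
  (\int[normal_prob m s]_x (f x)%:E = \int[leb]_x ((f x)%:E * (normal_pdf m s x)%:E))%E.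
Proof.
move=> f0 mf'; have mf : measurable_fun [set: R] (EFin \o f) by exact/measurable_EFinP.
have dom : normal_prob m s `<< leb by exact: normal_prob_dominates.
rewrite -(Radon_Nikodym_SigmaFinite.change_of_variables dom (f := EFin \o f))//.
apply: ae_eq_integral => //.
- apply: emeasurable_funM => //.
  exact: measurable_int (Radon_Nikodym_SigmaFinite.f_integrable dom).
- apply: emeasurable_funM => //; apply/measurable_EFinP; exact: measurable_normal_pdf.
- apply: ae_eqe_mul2l; apply: integral_ae_eq => //.
  + exact: Radon_Nikodym_SigmaFinite.f_integrable.
  + apply/measurable_EFinP; exact: measurable_normal_pdf.
  + by move=> E _ mE; rewrite -Radon_Nikodym_SigmaFinite.f_integral.
Qed.

(** Completing the square, the exponential times the density of variance v is the normal density of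
    mean c v and the same variance. *)
Lemma normal_exponential (c v : R) : 0 < v ->
  (\int[normal_prob 0 (Num.sqrt v)]_y (expR (c * y - c ^+ 2 * v / 2))%:E = 1)%E.
Proof.
move=> v0; have sv0 : Num.sqrt v != 0 by rewrite gt_eqF ?sqrtr_gt0.
rewrite integral_normal_prob; last 2 first.
- by move=> x; rewrite expR_ge0.
- apply: measurableT_comp => //; exact: measurable_funB.
rewrite -(integral_normal_pdf (c * v) (Num.sqrt v)); apply: eq_integral => x _.
rewrite -EFinM !normal_pdfE// mulrCA /normal_fun -expRD; congr (_ * expR _)%:E.
by rewrite sqr_sqrtr ?(ltW v0)// mulr2n; field; rewrite gt_eqF.
Qed.
End normal_density.

Section increments.
Variables (R : realType) (d : measure_display) (T : measurableType d) (P : probability T R).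

Lemma integral_mrestr (A : set T) (mA : measurable A) (f : T -> R) :
  (forall x, 0 <= f x) -> measurable_fun [set: T] f ->
  (\int[mrestr P mA]_x (f x)%:E = \int[P]_(x in A) (f x)%:E)%E.
Proof.
move=> f0 mf'; have mf : measurable_fun [set: T] (EFin \o f) by exact/measurable_EFinP.
have mAC : measurable (~` A) by exact: measurableC.
have -> : (\int[mrestr P mA]_x (f x)%:E =
    \int[mrestr P mA]_(x in A) (f x)%:E + \int[mrestr P mA]_(x in ~` A) (f x)%:E)%E.
  rewrite -[in LHS](setUv A) ge0_integral_setU//; (try by rewrite setUv);
    (try by move=> x _; rewrite lee_fin); try by rewrite disj_set2E setICr.
have -> : (\int[mrestr P mA]_(x in ~` A) (f x)%:E = 0)%E.
  apply: null_set_integral => //; first exact: measurable_funTS.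
  by transitivity (P (~` A `&` A)) => //; rewrite setICl measure0.
rewrite adde0; apply: eq_measure_integral => B mB BA.
by transitivity (P (B `&` A)) => //; rewrite setIidl.
Qed.

(** The law of D restricted to A is P A times a normal law, so the integral factors into P A and the
    integral of [normal_exponential]. *)
Lemma exponential_increment (A : set T) (D : T -> R) (c v : R) : 0 < v ->
  measurable A -> measurable_fun [set: T] D ->
  (forall B : set R, measurable B ->
    P (A `&` D @^-1` B) = (P A * normal_prob 0 (Num.sqrt v) B)%E) ->
  (\int[P]_(x in A) (expR (c * D x - c ^+ 2 * v / 2))%:E = P A)%E.
Proof.
move=> v0 mA mD h; pose f (y : measurableTypeR R) : R := expR (c * y - c ^+ 2 * v / 2).
have f0 y : 0 <= f y by exact: expR_ge0.
have mf : measurable_fun [set: measurableTypeR R] f.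
  by apply: measurableT_comp => //; exact: measurable_funB.
have mf' : measurable_fun [set: measurableTypeR R] (EFin \o f) by exact/measurable_EFinP.
have mD' : measurable_fun [set: T] (D : T -> measurableTypeR R) := mD.
have fin : P A \is a fin_num by exact: fin_num_measure.
have mfD : measurable_fun [set: T] (f \o D) by exact: measurableT_comp mf mD'.
rewrite -(integral_mrestr mA (f := f \o D) (fun x => f0 (D x)))//.
rewrite -[LHS](ge0_integral_pushforward mD' (mrestr P mA) measurableT mf')//; last first.
  by move=> y _; rewrite lee_fin.
have k0 : 0 <= fine (P A) by rewrite fine_ge0.
pose m1 : {measure set (measurableTypeR R) -> \bar R} :=
  measure_function_pushforward__canonical__measure_function_Measure (mrestr P mA) mD'.
pose m2 : {measure set (measurableTypeR R) -> \bar R} :=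
  mscale (NngNum k0) (normal_prob 0 (Num.sqrt v)).
transitivity (\int[m2]_y (EFin \o f) y)%E.
  apply: (@eq_measure_integral _ _ _ setT m2 m1) => B mB _.
  transitivity (P (D @^-1` B `&` A)) => //.
  transitivity ((fine (P A))%:E * normal_prob 0 (Num.sqrt v) B)%E => //.
  by rewrite fineK// setIC h.
transitivity ((fine (P A))%:E * \int[normal_prob 0 (Num.sqrt v)]_y (EFin \o f) y)%E.
  by apply: ge0_integral_mscale => // y _; rewrite lee_fin.
have -> : (\int[normal_prob 0 (Num.sqrt v)]_y (EFin \o f) y = 1)%E by exact: normal_exponential.
by rewrite mule1 fineK.
Qed.
End increments.

(** With c = 2 beta/nu, a crossing at time t gives c w - c^2 t/2 >= 2 alpha beta/nu^2: this c makes
    the slope of the barrier cancel c^2 t/2, so the gain does not depend on t. *)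
Lemma exponent_gain (R : realType) (nu alpha beta t T w v : R) : 0 < nu -> 0 < beta ->
  alpha + beta * t < nu * w ->
  2 * (alpha * beta / nu ^+ 2) + (2 * beta / nu * (v - w) - (2 * beta / nu) ^+ 2 * (T - t) / 2)
    <= 2 * beta / nu * v - (2 * beta / nu) ^+ 2 * T / 2.
Proof.
move=> nu0 b0 h; have q0 : 0 <= 2 * beta / nu ^+ 2.
  by rewrite divr_ge0 ?sqr_ge0// mulr_ge0// ltW.
have h1 := ler_wpM2l q0 (ltW h).
have e1 : 2 * beta / nu ^+ 2 * (nu * w) = 2 * beta / nu * w by field; rewrite gt_eqF.
have e2 : 2 * beta / nu ^+ 2 * (alpha + beta * t) =
    2 * (alpha * beta / nu ^+ 2) + (2 * beta / nu) ^+ 2 * t / 2 by field; rewrite gt_eqF.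
rewrite e1 e2 in h1; move: h1.
by move: (2 * beta / nu) (2 * (_ / _)) => y z; lra.
Qed.

(** * First passage over the barrier on a finite grid *)

Section first_passage.
Variables (R : realType) (d : measure_display) (T : measurableType d) (P : probability T R).
Variables (W : R -> T -> R) (nu alpha beta : R).
Hypotheses (hW : wiener P W) (nu0 : 0 < nu) (beta0 : 0 < beta).
Variables (h : R) (n : nat).
Hypothesis h0 : 0 < h.

Let t (i : nat) : R := i%:R * h.
Let t_ge0 i : 0 <= t i. Proof. by rewrite mulr_ge0// ltW. Qed.
Let t_lt i j : (i < j)%N -> t i < t j. Proof. by move=> ij; rewrite ltr_pM2r// ltr_nat. Qed.

Let c : R := 2 * beta / nu.
(** One step beyond the last tested time t_n, so that the increment up to [last] has positive
    variance for every j <= n. *)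
Let last : R := t n.+1.

(* The events determined by the increments before time t_j form the sigma-algebra generated by
   past j. *)
Definition past (j : nat) : set (set T) :=
  [set A | exists2 B : nat -> set R, (forall i, measurable (B i)) &
     A = \bigcap_(i in `I_j) ((W (t i.+1) \- W (t i)) @^-1` B i)].

Let mW i : measurable_fun [set: T] (W (t i)). Proof. exact: (wiener_measurable hW). Qed.

Let mdW (u v : R) : 0 <= u -> 0 <= v -> measurable_fun [set: T] (W u \- W v).
Proof. by move=> u0 v0; apply: measurable_funB; exact: (wiener_measurable hW). Qed.

Let mpre (f : T -> R) (B : set R) : measurable_fun [set: T] f -> measurable B ->
  measurable (f @^-1` B).
Proof. by move=> mf mB; rewrite -[X in measurable X]setTI; exact: mf. Qed.

Lemma past_measurable j : past j `<=` measurable.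
Proof.
move=> _ [B mB ->]; rewrite bigcap_mkord; apply: bigsetI_measurable => i _.
by apply: mpre => //; apply: mdW; exact: t_ge0.
Qed.

Lemma past_setI j : setI_closed (past j).
Proof.
move=> _ _ [B mB ->] [C mC ->]; exists (fun i => B i `&` C i).
  by move=> i; exact: measurableI.
by rewrite -bigcapI; apply: eq_bigcapr => i _; rewrite preimage_setI.
Qed.

Lemma past_setT j : past j setT.
Proof.
exists (fun=> setT) => //; by apply/esym/seteqP; split=> // x _ i _.
Qed.

(** Independence is given for intersections of increment events, which form a pi-system. Both sides
    are finite measures in A, so they agree on the generated sigma-algebra. *)
Lemma past_indep j A (B : set R) : (j <= n)%N -> <<s past j >> A -> measurable B ->
  P (A `&` (W last \- W (t j)) @^-1` B) =
  (P A * normal_prob 0 (Num.sqrt (last - t j)) B)%E.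
Proof.
move=> jn; have tj : t j < last by apply: t_lt; rewrite ltnS.
move=> sA mB; rewrite -(wiener_normal hW (t_ge0 j) tj)//.
set D := (_ \- _) @^-1` B.
have mD : measurable D by apply: mpre => //; apply: mdW; exact: t_ge0.
have fD : P D \is a fin_num by exact: fin_num_measure.
have k0 : 0 <= fine (P D) by rewrite fine_ge0.
rewrite muleC; transitivity (mscale (NngNum k0) P A); last first.
  by transitivity ((fine (P D))%:E * P A)%E => //; rewrite fineK.
apply: (@g_sigma_algebra_measure_unique _ _ _ (past j) _ (fun=> setT) _ _
  (mrestr P mD) (mscale (NngNum k0) P)) => //.
- exact: past_measurable.
- by move=> _; exact: past_setT.
- by rewrite bigcup_const//; exists 0%N.
- exact: past_setI.
- move=> _ [C mC ->].
  (* After time t_j the grid jumps to the last time; the later points are only there to make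
     tau increasing. *)
  pose tau i := if (i <= j)%N then t i else last + (i - j.+1)%:R.
  pose C' i := if (i < j)%N then C i else B.
  have tau_lt i : (i < j.+1)%N -> tau i < tau i.+1.
    rewrite ltnS /tau => ij; rewrite ij; case: ifP => ij'; first exact: t_lt.
    have -> : i = j by apply/eqP; rewrite eqn_leq ij leqNgt ij'.
    by rewrite subnn addr0.
  have tau0 : 0 <= tau 0%N by exact: t_ge0.
  have mC' i : measurable (C' i) by rewrite /C'; case: ifP.
  have I1 := wiener_independent hW tau0 tau_lt mC'.
  have tau_lt' i : (i < j)%N -> tau i < tau i.+1 by move=> ij; apply: tau_lt; exact: ltnW.
  have I2 := wiener_independent hW tau0 tau_lt' mC'.
  have E1 : \bigcap_(i in `I_j) ((W (t i.+1) \- W (t i)) @^-1` C i) =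
      \bigcap_(i in `I_j) ((W (tau i.+1) \- W (tau i)) @^-1` C' i).
    by apply: eq_bigcapr => i /= ij; rewrite /tau /C' ij (ltnW ij).
  have E2 : (W (tau j.+1) \- W (tau j)) @^-1` C' j = D.
    by rewrite /tau /C' ltnn leqnn subnn addr0.
  pose G := \bigcap_(i in `I_j) ((W (tau i.+1) \- W (tau i)) @^-1` C' i).
  rewrite E1; transitivity (P (G `&` D)) => //.
  transitivity ((fine (P D))%:E * P G)%E => //; rewrite fineK// /G I2 -E2 muleC.
  by rewrite big_ord_recr/= in I1; rewrite -I1 IIS bigcap_setU bigcap_set1.
- move=> _; apply: le_lt_trans (_ : P (setT `&` D) < +oo)%E => //.
  by rewrite -ge0_fin_numE ?measure_ge0//; apply: fin_num_measure; exact: measurableI.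
Qed.
Lemma past_le i j : (i <= j)%N -> <<s past i >> `<=` <<s past j >>.
Proof.
move=> ij; apply: smallest_sub; first exact: smallest_sigma_algebra.
move=> _ [B mB ->]; apply: sub_gen_smallest.
exists (fun l => if (l < i)%N then B l else setT); first by move=> l; case: ifP.
apply/seteqP; split=> [x Bx l /= lj|x Bx l /= li].
  by case: ifP => // li; exact: Bx.
by have := Bx l (leq_trans li ij); rewrite /preimage/= li.
Qed.

Lemma past_value i y : <<s past i >> [set x | y < W (t i) x].
Proof.
pose Ti := g_sigma_algebraType (past i).
suff m : measurable_fun [set: Ti] (W (t i) : Ti -> R).
  have := m measurableT `]y, +oo[%classic (measurable_itv _); rewrite setTI.
  by congr (<<s past i >> _); apply/seteqP; split=> x /=; rewrite in_itv/= andbT.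
have incr l : (l < i)%N -> measurable_fun [set: Ti] (W (t l.+1) \- W (t l) : Ti -> R).
  move=> li _ B mB; rewrite setTI; apply: sub_gen_smallest.
  exists (fun k => if k == l then B else setT); first by move=> k; case: ifP.
  apply/seteqP; split=> [x Bx k /= ki|x Bx].
    by case: eqP => [->//|_]; rewrite /preimage.
  by have := Bx l li; rewrite /preimage/= eqxx.
(* W at time t_k is W at 0, which vanishes, plus the sum of the increments, each measurable for the
   past. *)
suff : forall k, (k <= i)%N -> measurable_fun [set: Ti] (W (t k) : Ti -> R) by apply.
elim=> [_|k IHk ki].
  rewrite /t mul0r; have -> : W 0 = fun=> 0 by apply/funext => x; exact: (wiener_start hW).
  exact: measurable_cst.
have -> : W (t k.+1) = (fun x => W (t k) x + (W (t k.+1) \- W (t k)) x).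
  by apply/funext => x /=; rewrite addrC subrK.
by apply: measurable_funD; [exact: IHk (ltnW ki)|exact: incr].
Qed.

Definition crossing (i : nat) : set T := [set x | alpha + beta * t i < nu * W (t i) x].

Definition crossed (m : nat) : set T := \bigcup_(i in `I_m) crossing i.

Lemma past_crossing i j : (i <= j)%N -> <<s past j >> (crossing i).
Proof.
move=> ij; apply: (past_le ij).
have -> : crossing i = [set x | (alpha + beta * t i) / nu < W (t i) x].
  by apply/seteqP; split=> x; rewrite /crossing/= [nu * _]mulrC ltr_pdivrMr.
exact: past_value.
Qed.

Lemma past_crossed m j : (m <= j.+1)%N -> <<s past j >> (crossed m).
Proof.
move=> mj; pose Tj : measurableType _ := g_sigma_algebraType (past j).
rewrite /crossed bigcup_mkord; apply: (@bigsetU_measurable _ Tj) => i _.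
by apply: past_crossing; rewrite -ltnS (leq_trans _ mj).
Qed.

Lemma past_sub j : <<s past j >> `<=` measurable.
Proof.
by apply: smallest_sub; [exact: sigma_algebra_measurable|exact: past_measurable].
Qed.

Lemma crossed_measurable m : measurable (crossed m).
Proof. by apply: (@past_sub m); apply: past_crossed. Qed.

Let Z (x : T) : R := expR (c * W last x - c ^+ 2 * last / 2).

Let mZ : measurable_fun [set: T] (EFin \o Z).
Proof.
apply/measurable_EFinP; apply: measurableT_comp => //; apply: measurable_funB => //.
by apply: measurable_funM => //; exact: mW.
Qed.

Let K : R := 2 * (alpha * beta / nu ^+ 2).

(** On a crossing at t_j, Z is at least e^K times the exponential of the increment after t_j, whose
    integral over the past event A is P A. *)
Lemma crossing_energy j A : (j <= n)%N -> <<s past j >> A -> A `<=` crossing j ->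
  ((expR K)%:E * P A <= \int[P]_(x in A) (Z x)%:E)%E.
Proof.
move=> jn sA Aj; have mA := past_sub sA.
have tj : 0 < last - t j by rewrite subr_gt0 t_lt.
pose D := W last \- W (t j).
have mD : measurable_fun [set: T] D by apply: mdW; exact: t_ge0.
have := exponential_increment c tj mA mD (fun B mB => past_indep jn sA mB).
pose g x := expR (c * D x - c ^+ 2 * (last - t j) / 2).
have mg : measurable_fun [set: T] g.
  apply: measurableT_comp => //; apply: measurable_funB => //.
  exact: measurable_funM.
have mg' : measurable_fun A (EFin \o g) by apply/measurable_funTS/measurable_EFinP.
move=> <-; rewrite -[X in (_ * X)%E]/(\int[P]_(x in A) (EFin \o g) x)%E.
rewrite -ge0_integralZl//; (try by move=> x _; rewrite /= lee_fin expR_ge0);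
  (try by rewrite lee_fin expR_ge0).
apply: ge0_le_integral => //.
- by move=> x _; rewrite -EFinM lee_fin mulr_ge0 ?expR_ge0.
- by apply/measurable_funTS/measurable_EFinP; exact: measurable_funM.
- exact: measurable_funTS.
move=> x /Aj; rewrite /crossing/= => hx.
rewrite -EFinM lee_fin -expRD ler_expR /D /=.
exact: exponent_gain.
Qed.

Theorem crossed_le : (P (crossed n.+1) <= (expR (- K))%:E)%E.
Proof.
have step m : (m <= n.+1)%N ->
    ((expR K)%:E * P (crossed m) <= \int[P]_(x in crossed m) (Z x)%:E)%E.
  (* The event added at step m, a crossing at t_m without an earlier one, is known at time t_m. This
     first-crossing decomposition does the work of optional stopping. *)
  elim: m => [_|m IHm mn].
    by rewrite /crossed II0 bigcup_set0 measure0 mule0 integral_set0.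
  pose A := crossing m `\` crossed m.
  have sA : <<s past m >> A.
    pose Tm : measurableType _ := g_sigma_algebraType (past m).
    by apply: (@measurableD _ Tm); [exact: past_crossing|exact: past_crossed].
  have mA := past_sub sA; have mC := crossed_measurable m.
  have dis0 : crossed m `&` A = set0 by apply/seteqP; split=> x // [h1 [_]].
  have dis : [disjoint crossed m & A] by rewrite disj_set2E; apply/eqP.
  have -> : crossed m.+1 = crossed m `|` A.
    rewrite [LHS]/crossed IIS bigcup_setU bigcup_set1 -/(crossed m).
    apply/seteqP; split=> x [h1|h1]; [by left| |by left|by right; case: h1].
    by have [h2|h2] := pselect (crossed m x); [left|right].
  have -> : P (crossed m `|` A) = (P (crossed m) + P A)%E by exact: measureU.
  rewrite ge0_integral_setU//; (try exact: measurable_funTS);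
    (try by move=> x _; rewrite lee_fin expR_ge0).
  rewrite ge0_muleDr//; apply: leeD; first exact: IHm (ltnW mn).
  by apply: (crossing_energy (j := m)) => //; exact: subDsetl.
have total : (\int[P]_x (Z x)%:E = 1)%E.
  have l0 : 0 < last - t 0%N by rewrite subr_gt0 t_lt.
  have mD : measurable_fun [set: T] (W last \- W (t 0%N)) by apply: mdW; exact: t_ge0.
  have s0 : <<s past 0 >> [set: T] by apply: sub_gen_smallest; exact: past_setT.
  have := exponential_increment c l0 measurableT mD (fun B mB => past_indep (leq0n n) s0 mB).
  rewrite probability_setT => <-; apply: eq_integral => x _.
  by rewrite /Z /t mul0r subr0 /= (wiener_start hW) subr0.
have := step _ (leqnn _).
have : (\int[P]_(x in crossed n.+1) (Z x)%:E <= 1)%E.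
  rewrite -total; apply: ge0_subset_integral => //; first exact: crossed_measurable.
  by move=> x _; rewrite lee_fin expR_ge0.
move=> h1 h2; have := le_trans h2 h1.
have fin : P (crossed n.+1) \is a fin_num by apply: fin_num_measure; exact: crossed_measurable.
rewrite -(fineK fin) -EFinM !lee_fin expRN => h3.
by rewrite -[leRHS]mul1r ler_pdivlMr ?expR_gt0// mulrC.
Qed.

End first_passage.

Lemma pow2_small (R : realType) (r : R) : 0 < r ->
  exists p0 : nat, forall p, (p0 <= p)%N -> 2 ^- p < r.
Proof.
move=> r0; exists (Num.truncn r^-1).+1 => p hp.
rewrite -[ltRHS]invrK ltf_pV2 ?posrE ?exprn_gt0 ?invr_gt0//.
apply: lt_le_trans (truncnS_gt _) _; rewrite -natrX ler_nat.
exact: leq_trans hp (ltnW (ltn_expl p (isT : 1 < 2)%N)).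
Qed.

Section barrier.
Variables (R : realType) (d : measure_display) (T : measurableType d) (P : probability T R).
Variables (W : R -> T -> R) (nu alpha beta : R).
Hypotheses (hW : wiener P W) (nu0 : 0 < nu) (beta0 : 0 < beta).

(** Grid of mesh 2^(-p) up to time p: refinement and horizon grow together, so the events increase
    to a crossing at some dyadic time. *)
Let F (p : nat) : set T := crossed W nu alpha beta (2 ^- p) (p * 2 ^ p).+1.

Let h_gt0 p : (0 : R) < 2 ^- p. Proof. by rewrite invr_gt0 exprn_gt0. Qed.

Let F_measurable p : measurable (F p).
Proof. exact: (crossed_measurable alpha beta hW nu0 (h_gt0 p)). Qed.

Let F_mono : nondecreasing_seq F.
Proof.
apply/nondecreasing_seqP => p; apply/subsetPset => x [i /= ip hi].
exists (2 * i)%N => /=.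
  by rewrite ltnS expnS mulnCA leq_pmul2l// mulSn (leq_trans _ (leq_addl _ _)).
move: hi; rewrite /crossing/=.
have -> : (2 * i)%N%:R * 2 ^- p.+1 = i%:R * 2 ^- p :> R.
  by rewrite natrM exprS invfM mulrACA divff ?mul1r ?pnatr_eq0.
by [].
Qed.

Theorem barrier : exists E : set T,
  [/\ measurable E, ((1 - expR (- (2 * (alpha * beta / nu ^+ 2))))%:E <= P E)%E &
      forall x, E x -> forall t, 0 <= t -> nu * W t x <= alpha + beta * t].
Proof.
have mU : measurable (\bigcup_p F p) by exact: bigcup_measurable.
exists (~` \bigcup_p F p); split; first exact: measurableC.
  have le : (P (\bigcup_p F p) <= (expR (- (2 * (alpha * beta / nu ^+ 2))))%:E)%E.
    have cv := nondecreasing_cvg_mu (mu := P) F_measurable mU F_mono.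
    rewrite -(cvg_lim _ cv)//; apply: lime_le.
      by apply/cvg_ex; exists (P (\bigcup_p F p)).
    by apply: nearW => p; exact: (crossed_le alpha hW nu0 beta0 (p * 2 ^ p) (h_gt0 p)).
  rewrite probability_setC//.
  have fin : P (\bigcup_p F p) \is a fin_num by apply: fin_num_measure.
  by move: le; rewrite -(fineK fin) lee_fin -EFinB lee_fin lerD2l lerN2.
move=> x Fx t t0; rewrite leNgt; apply/negP => ht; apply: Fx.
have /subspace_continuousP ct := @wiener_continuous _ _ _ _ _ hW x.
have tA : `[0, +oo[%classic t by rewrite /= in_itv/= andbT.
(* Half of the excess over the barrier, divided by nu: a change of W by this amount uses up at most
   half of the excess. *)
have e0 : 0 < (nu * W t x - (alpha + beta * t)) / 2 / nu.
  by rewrite !divr_gt0// subr_gt0.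
have /cvgrPdist_le/(_ _ e0) near1 := ct t tA.
have near2 : nbhs t (fun u : R => u \in `[0, +oo[ ->
  `|W t x - W u x| <= (nu * W t x - (alpha + beta * t)) / 2 / nu) := near1.
have /nbhs_ballP[r /= r0 hr] := near2.
have [p0 hp0] := pow2_small r0.
pose p := maxn p0 (Num.truncn t).+1.
have hp : 2 ^- p < r by apply: hp0; exact: leq_maxl.
(* Rounding t down to the grid: at the earlier time u the barrier is lower, so only the oscillation
   of the path has to be controlled. *)
pose i := Num.truncn (t * 2 ^+ p).
have q0 : 0 < 2 ^+ p :> R by rewrite exprn_gt0.
have tq : 0 <= t * 2 ^+ p by rewrite mulr_ge0// ltW.
pose u : R := i%:R * 2 ^- p.
have u0 : 0 <= u by rewrite mulr_ge0// ltW.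
have ut : u <= t by rewrite ler_pdivrMr// truncn_le.
have tu : t - u <= 2 ^- p.
  rewrite lerBlDl -[X in u + X]mul1r -mulrDl ler_pdivlMr// natr1 ltW//.
  exact: truncnS_gt.
exists p => //; exists i => /=.
  rewrite ltnS -(ler_nat R); apply: (@le_trans _ _ (t * 2 ^+ p)); first by rewrite truncn_le.
  rewrite natrM natrX ler_wpM2r ?(ltW q0)//.
  apply: le_trans (ltW (truncnS_gt t)) _; rewrite ler_nat; exact: leq_maxr.
have := hr u; rewrite /ball/= ger0_norm ?subr_ge0// => /(_ (le_lt_trans tu hp)).
rewrite in_itv/= andbT => /(_ u0) hu.
rewrite /crossing/= -/u.
have : W t x - W u x <= (nu * W t x - (alpha + beta * t)) / 2 / nu by exact: le_trans (ler_norm _) hu.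
rewrite ler_pdivlMr// mulrC mulrBr => h1.
have h2 : beta * u <= beta * t by rewrite ler_pM2l.
by move: h1 h2 ht; move: (nu * _) (nu * _) (beta * _) (beta * _) => a b c e; lra.
Qed.
End barrier.

Unset Implicit Arguments.
Set Strict Implicit.
Set Printing Implicit Defensive.

Theorem theorem5p2 (R : realType) (d : measure_display) (T : measurableType d)
    (P : probability T R) (W : R -> T -> R) (hW : wiener P W)
    (s nu sigma : R) (hs0 : 0 < s) (hs1 : s <= 1) (hnu : 0 < nu)
    (hsigma1 : 1 / s < sigma) (hsigma2 : sigma < 2)
    (alpha eps beta : R) (halpha : 0 < alpha) (heps : 0 < eps)
    (hbeta0 : 0 < beta) (hbeta1 : beta < nu ^+ 2 / 2)
    (u0 : coefs R) (hu0 : real_mean_zero u0)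
    (hsmall : (gevrey_norm s sigma (alpha + eps) u0
               <= (nu ^+ 2 / 2 - beta)%:E)%E) :
  let phi := fun t : R => alpha + beta * t in
  exists E : set T,
    [/\ measurable E,
        ((1 - expR (- (2 * (alpha * beta / nu ^+ 2))))%:E <= P E)%E &
        forall x : T, E x ->
        exists u : R -> coefs R,
          [/\ C0_gevrey s sigma `[0, +oo[ phi u,
              mild_solution s nu (fun t => W t x) u0 u,
              forall v : R -> coefs R,
                C0_gevrey s sigma `[0, +oo[ phi v ->
                mild_solution s nu (fun t => W t x) u0 v ->
                forall t : R, 0 <= t -> v t = u t &
              forall t1 t2 : R, 0 <= t1 -> t1 <= t2 ->
                (gevrey_norm s sigma (phi t2) (u t2)
                 <= gevrey_norm s sigma (phi t1) (u t1))%E]].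
Proof.
have [E [mE PE hE]] := barrier alpha hW hnu hbeta0.
exists E; split=> // x Ex.
exact: (pathwise_solution hs0 hs1 hsigma1 hsigma2 heps hbeta0 hbeta1 hu0 hsmall
  (@wiener_continuous _ _ _ _ _ hW x) (hE x Ex)).
Qed.
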